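(* Let $p\ge1$ be an integer, $n>0$, and $C_n=[0,n^{1/p})^p$ with Euclidean toroidal distance $D$. Let $m\ge1$ and suppose $\sqrt p\,n^{1/p}>2m$ and $n^{1/p}>6$. Let $U_1,\dots,U_m$ be independent random points of $C_n$ with strictly positive densities $f_1,\dots,f_m$ on $C_n$, let $B_\alpha$ be the closed unit ball (with respect to $D$) centered at $U_\alpha$, and let $$M_\alpha=\sum_{\beta\in[m]\setminus\{\alpha\}}\mathbf 1(B_\alpha\cap B_\beta\ne\emptyset),\qquad \alpha\in[m]=\{1,\dots,m\},$$ be the number of neighbors of $U_\alpha$. Let $w_\alpha>0$ and $d_\alpha\in\mathbb Z$, $\alpha\in[m]$, be constants, put $|\mathbf w|=\max_\alpha w_\alpha$, $|\mathbf d|=\max_\alpha d_\alpha$, and $$Y_{ge}=\sum_{\alpha\in[m]}w_\alpha\mathbf 1(M_\alpha\ge d_\alpha),\qquad Y_{ne}=\sum_{\alpha\in[m]}w_\alpha\mathbf 1(M_\alpha\ne d_\alpha).$$ Suppose that all indicator summands of the sum under consideration are non-constant, that is, $0<P(M_\alpha\ge d_\alpha)<1$ for all $\alpha$ when considering $Y_{ge}$, and $0<P(M_\alpha\ne d_\alpha)<1$ for all $\alpha$ when considering $Y_{ne}$. Let $$c_{ge}=|\mathbf w||\mathbf d|(\sigma_{\mathbf d}+1),\qquad c_{ne}=|\mathbf w|(\sigma_{\mathbf d}+\sigma_{\mathbf d+1}+1),$$ $$\mu_{ge}=EY_{ge}=\sum_{\alpha\in[m]}w_\alpha\int_{C_n}q_{ge}(d_\alpha,\mathbf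 p_\alpha(u))f_\alpha(u)\,du,\qquad \mu_{ne}=EY_{ne}=\sum_{\alpha\in[m]}w_\alpha\int_{C_n}q_{ne}(d_\alpha,\mathbf p_\alpha(u))f_\alpha(u)\,du.$$ Then, for $(Y,\mu,c)=(Y_{ge},\mu_{ge},c_{ge})$ and for $(Y,\mu,c)=(Y_{ne},\mu_{ne},c_{ne})$: (i) $P(Y-\mu\le -t)\le \exp\left(-\frac{t^2}{2c\mu}\right)$ for all $t>0$; (ii) $P(Y-\mu\ge t)\le \exp\left(-\frac{t^2}{2c\mu+ct}\right)$ for all $t>0$; (iii) $P(Y-\mu\ge t)\le \left(\frac{\mu}{\mu+t}\right)^{(t+\mu)/c}e^{t/c}$ for all $t\ge0$, and $P(Y-\mu\le t)\le \left(\frac{\mu}{\mu+t}\right)^{(t+\mu)/c}e^{t/c}$ for all $-\mu\le t\le 0$ (the right side being read as $e^{-\mu/c}$ at $t=-\mu$); (iv) $P(Y-\mu\ge t)\le \exp\left(-\frac{t^2}{2c\mu+2ct/3}\right)$ for all $t>0$.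
   Context: The Euclidean toroidal distance on $C_n$ is the distance obtained by identifying $C_n$ with the torus $\mathbb R^p/(n^{1/p}\mathbb Z)^p$. $\kappa_1$ (depending on $p$) is the maximum number of closed unit balls in $\mathbb R^p$ that all intersect the closed unit ball centered at the origin but are pairwise disjoint from each other. For a vector $\mathbf d=(d_\alpha)_{\alpha\in[m]}$ with values arranged in non-strict decreasing order $d_{(1)}\ge d_{(2)}\ge\cdots\ge d_{(m)}$, $\sigma_{\mathbf d}=\sum_{\alpha\in[\kappa_1]}d_{(\alpha)}$, where $d_{(\alpha)}:=0$ for $\alpha>m$. $\mathbf d+1=(d_\alpha+1)_{\alpha\in[m]}$. $\mathbf p_\alpha(u)=(p_\beta(u))_{\beta\in[m]\setminus\{\alpha\}}$ with $p_\beta(u)=P(D(u,U_\beta)\le 2)$. For a finite vector $\mathbf p=(p_j)_{j\in J}$ of probabilities, $q_{eq}(k,\mathbf p)=\sum_{s\subset J,|s|=k}\prod_{j\in s}p_j\prod_{j\in J\setminus s}(1-p_j)$, $q_{ge}(d,\mathbf p)=\sum_{k\ge d}q_{eq}(k,\mathbf p)$ and $q_{ne}(d,\mathbf p)=1-q_{eq}(d,\mathbf p)$. *)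

(* Defs.v *)
From HB Require Import structures.
From mathcomp Require Import all_boot all_order all_algebra.
From mathcomp Require Import all_classical all_reals all_analysis.
From mathcomp Require Import ring lra.
Import Order.TTheory GRing.Theory Num.Theory numFieldNormedType.Exports.

Set Implicit Arguments.
Unset Strict Implicit.
Unset Printing Implicit Defensive.

Local Open Scope classical_set_scope.
Local Open Scope ring_scope.

(* Points of R^p are p-tuples, with the product (= Borel) sigma-algebra that
   the library puts on tuples. *)
Notation "''pt[' R ]_ p" := (p.-tuple (measurableTypeR R))
  (at level 8, p at level 2, format "''pt[' R ]_ p") : type_scope.

(* Lebesgue measure on R^p, by iterated products along R * R^p ~ R^(p+1);
   [leb_box] below computes its value on boxes. *)
Section LebesgueStep.
Context (R : realType) (p : nat).
Local Notation mT := (measurableTypeR R).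
Let lam : {sigma_finite_measure set mT -> \bar R} := lebesgue_measure.
Variable mu : {sigma_finite_measure set 'pt[R]_p -> \bar R}.

Definition pt_cons (x : mT * 'pt[R]_p) : 'pt[R]_(p.+1) :=
  [tuple of x.1 :: x.2].

Lemma measurable_pt_cons : measurable_fun setT pt_cons.
Proof. exact: measurable_cons. Qed.

Definition leb_step : set 'pt[R]_(p.+1) -> \bar R :=
  pushforward (@lebesgue_measure R \x mu)%E pt_cons.

Let leb_step0 : leb_step set0 = 0%E.
Proof. by rewrite /leb_step /pushforward preimage_set0 measure0. Qed.

Let leb_step_ge0 A : (0 <= leb_step A)%E.
Proof. by rewrite /leb_step /pushforward measure_ge0. Qed.

Let leb_step_sigma : semi_sigma_additive leb_step.
Proof.
rewrite /leb_step; have mc := measurable_pt_cons.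
move=> F mF tF mUF; rewrite /pushforward preimage_bigcup.
apply: measure_semi_sigma_additive.
- by move=> n; rewrite -[X in measurable X]setTI; exact: mc.
- apply/trivIsetP => /= i j _ _ ij; rewrite -preimage_setI.
  by move/trivIsetP : tF => /(_ _ _ _ _ ij) ->//; rewrite preimage_set0.
- by rewrite -preimage_bigcup -[X in measurable X]setTI; exact: mc.
Qed.

HB.instance Definition _ := isMeasure.Build _ _ _
  leb_step leb_step0 leb_step_ge0 leb_step_sigma.

Let leb_step_sigma_finite : sigma_finite setT leb_step.
Proof.
have /sigma_finiteP[F [TF ndF Foo]] := sigma_finiteT lam.
have /sigma_finiteP[G [TG ndG Goo]] := sigma_finiteT mu.
have mhd : measurable_fun setT (fun y : 'pt[R]_(p.+1) => tnth y ord0).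
  exact: measurable_tnth.
have mtl : measurable_fun setT
    (fun y : 'pt[R]_(p.+1) => [tuple of behead y] : 'pt[R]_p).
  exact: measurable_behead.
exists (fun k => [set y : 'pt[R]_(p.+1) |
    F k (tnth y ord0) /\ G k [tuple of behead y]]).
  apply/esym; rewrite -subTset => y _.
  have [n _ Fn] : (\bigcup_k F k) (tnth y ord0) by rewrite -TF.
  have [k _ Gk] : (\bigcup_k G k) [tuple of behead y] by rewrite -TG.
  exists (maxn n k) => //; split.
    by move: (tnth y ord0) Fn; exact/subsetPset/ndF/leq_maxl.
  by move: [tuple of behead y] Gk; exact/subsetPset/ndG/leq_maxr.
move=> k; have [mF Fk] := Foo k; have [mG Gk] := Goo k; split.
  have := mhd measurableT _ mF; have := mtl measurableT _ mG.
  rewrite !setTI => mG' mF'; exact: measurableI mF' mG'.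
rewrite /leb_step /pushforward (_ : pt_cons @^-1` _ = F k `*` G k).
  rewrite (_ : (_ \x _)%E _ = (lam (F k) * mu (G k))%E); last first.
    exact: (product_measure1E lam mu).
  by rewrite lte_mul_pinfty// ge0_fin_numE.
apply/seteqP; split => -[x y] /=.
  by rewrite (_ : tnth _ _ = x)// (_ : [tuple of _] = y)//; apply/val_inj.
by rewrite (_ : tnth _ _ = x)// (_ : [tuple of _] = y)//; apply/val_inj.
Qed.

HB.instance Definition _ := Measure_isSigmaFinite.Build _ _ _
  leb_step leb_step_sigma_finite.

End LebesgueStep.

Fixpoint leb (R : realType) (p : nat) :
    {sigma_finite_measure set 'pt[R]_p -> \bar R} :=
  match p with
  | 0 => @dirac _ _ ([tuple] : 'pt[R]_0) R
  | p'.+1 => leb_step (leb R p')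
  end.

Lemma leb_box (R : realType) (p : nat) (A : 'I_p -> set (measurableTypeR R)) :
  (forall i, measurable (A i)) ->
  leb R p [set x | forall i, A i (tnth x i)] =
  (\prod_(i < p) lebesgue_measure (A i))%E.
Proof.
elim: p A => [|p IH] A mA.
  by rewrite big_ord0 /= diracE mem_set// => -[].
rewrite big_ord_recl -(IH (fun i => A (lift ord0 i)))//.
rewrite [LHS]/= /leb_step /pushforward.
rewrite (_ : pt_cons (p:=p) @^-1` _ =
  A ord0 `*` [set x | forall i, A (lift ord0 i) (tnth x i)]); last first.
  apply/seteqP; split => -[x y] /=.
    move=> H; split; first exact: (H ord0).
    by move=> i; have := H (lift ord0 i); rewrite tnthS.
  by move=> [H0 H] i; case: (unliftP ord0 i) => [j|] ->; rewrite ?tnthS.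
apply: product_measure1E => //.
rewrite (_ : mkset _ = \bigcap_(i : 'I_p)
    (fun x : 'pt[R]_p => tnth x i) @^-1` A (lift ord0 i)); last first.
  by apply/seteqP; split => x /= H i; [move=> _; exact: H|exact: (H i)].
apply: fin_bigcap_measurable => // i _.
by have := @measurable_tnth _ (measurableTypeR R) p i measurableT _ (mA (lift ord0 i));
  rewrite setTI.
Qed.

(* Euclidean norm of a vector given by its coordinates. *)
Definition enorm (R : realType) (p : nat) (v : 'I_p -> R) : R :=
  Num.sqrt (\sum_i v i ^+ 2).

Section Kappa.
Context (R : realType) (p : nat).

Definition unit_ball (c : 'pt[R]_p) : set 'pt[R]_p :=
  [set x | enorm (fun i => tnth x i - tnth c i : R) <= 1].

Definition origin : 'pt[R]_p := [tuple (0 : R) | i < p].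

(* k pairwise disjoint closed unit balls, all meeting the one at the origin *)
Definition packing (k : nat) : Prop :=
  exists c : 'I_k -> 'pt[R]_p,
    (forall i, unit_ball (c i) `&` unit_ball origin !=set0) /\
    (forall i j, i != j -> unit_ball (c i) `&` unit_ball (c j) = set0).

(* The default 0 of [xget] plays no role, see [kappa1P]. *)
Definition kappa1 : nat :=
  xget 0%N [set k | packing k /\ forall j, packing j -> (j <= k)%N].

Lemma packing_bounded k : packing k -> (k <= (4 * p + 5) ^ p)%N.
Proof.
move=> [c [c0 cd]].
have coord (v : 'I_p -> R) j : enorm v <= 1 -> `|v j| <= 1.
  rewrite -(@ler_pXn2r _ 2)// ?nnegrE ?sqrtr_ge0// expr1n sqr_sqrtr; last first.
    by apply: sumr_ge0 => i _; exact: sqr_ge0.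
  move=> h; rewrite -(@ler_pXn2r _ 2)// ?nnegrE// expr1n real_normK ?num_real//.
  apply: le_trans h; rewrite (bigD1 j)//= lerDl.
  by apply: sumr_ge0 => i _; exact: sqr_ge0.
have cb i j : -2 <= (tnth (c i) j : R) <= 2.
  have [x [/(coord _ j)/= h1 /(coord _ j)/= h2]] := c0 i.
  move: h2; rewrite tnth_mktuple subr0 => h2.
  move: h1 h2; set u : R := tnth x j; set v : R := tnth (c i) j.
  by rewrite !ler_norml => /andP[? ?] /andP[? ?]; apply/andP; split; lra.
pose y i j : R := ((tnth (c i) j : R) + 2) * p.+1%:R.
have y0 i j : 0 <= y i j.
  by rewrite mulr_ge0//; have /andP[? _] := cb i j; rewrite -lerBlDr sub0r.
pose g (i : 'I_k) : {ffun 'I_p -> 'I_(4 * p + 4).+1} :=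
  [ffun j => inord (Num.truncn (y i j))].
have gn i j : val (g i j) = Num.truncn (y i j).
  rewrite ffunE /= inordK// ltnS -(ler_nat R).
  have /andP[+ _] := truncn_itv (y0 i j); move/le_trans; apply.
  have -> : (4 * p + 4)%N%:R = 4 * p.+1%:R :> R by rewrite -natrM mulnS addnC.
  by rewrite ler_pM2r ?ltr0n//; have /andP[_ ?] := cb i j; lra.
have ginj : injective g.
  move=> i i' gi; apply/eqP/negPn/negP => /cd; apply/eqP/set0P.
  exists (c i'); split; last first.
    rewrite /unit_ball/= /enorm big1 ?sqrtr0// => j _.
    by rewrite subrr expr0n.
  rewrite /unit_ball/= /enorm -[X in _ <= X]sqrtr1 ler_wsqrtr//.
  have close j : `|(tnth (c i') j : R) - tnth (c i) j| <= p.+1%:R^-1.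
    have e : Num.truncn (y i j) = Num.truncn (y i' j) by rewrite -!gn gi.
    have /andP[a1 a2] := truncn_itv (y0 i j).
    have /andP[b1 b2] := truncn_itv (y0 i' j).
    rewrite -e in b1 b2.
    rewrite -(@ler_pM2r _ p.+1%:R) ?ltr0n// mulVf ?pnatr_eq0//.
    rewrite -[X in _ * X]ger0_norm// -normrM.
    have -> : ((tnth (c i') j : R) - tnth (c i) j) * p.+1%:R = y i' j - y i j.
      by rewrite /y; ring.
    by rewrite -natr1 in a2 b2; rewrite ler_norml; apply/andP; split; lra.
  apply: (@le_trans _ _ (\sum_(j < p) p.+1%:R^-1)).
    apply: ler_sum => j _; rewrite -real_normK ?num_real// expr2.
    rewrite -[leRHS]mulr1; apply: ler_pM => //.
    by apply: (le_trans (close j)); rewrite invf_le1 ?ltr0n// ler1n.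
  by rewrite sumr_const card_ord -[_ *+ p]mulr_natl ler_pdivrMr ?ltr0n// mul1r ler_nat.
have := leq_card g ginj.
by rewrite card_ffun !card_ord (addnS (4 * p) 4).
Qed.

Lemma kappa1P : packing kappa1 /\ forall j, packing j -> (j <= kappa1)%N.
Proof.
have ex0 : exists k, `[< packing k >].
  by exists 0%N; apply/asboolP; exists (fun=> origin); split=> -[].
have exb k : `[< packing k >] -> (k <= (4 * p + 5) ^ p)%N.
  by move/asboolP; exact: packing_bounded.
have [k /asboolP pk kmax] := ex_maxnP ex0 exb.
rewrite /kappa1; case: xgetP => [_ -> []//|/(_ k)[]].
by split => // j pj; apply: kmax; apply/asboolP.
Qed.

End Kappa.

Section Torus.
Context (R : realType) (p : nat) (L : R).

(* The cube [0, L)^p. *)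
Definition cube : set 'pt[R]_p := [set x | forall i, 0 <= (tnth x i : R) < L].

(* Quotient distance of R^p / (L Z)^p between the classes of x and y. *)
Definition tdist (x y : 'pt[R]_p) : R :=
  inf (range (fun z : 'I_p -> int =>
    enorm (fun i => (tnth x i : R) - tnth y i + L * (z i)%:~R))).

Definition tball (c : 'pt[R]_p) : set 'pt[R]_p :=
  [set x | cube x /\ tdist x c <= 1].

End Torus.

(* Maximum and sum of the k largest entries of a vector; [nth] pads by 0, and
   the seed of [vmax] is itself an entry as soon as 0 < m. *)
Definition vmax (R : realDomainType) (m : nat) (v : 'I_m -> R) : R :=
  \big[Num.max/head 0 (codom v)]_(a < m) v a.

Definition top_sum (k m : nat) (v : 'I_m -> int) : int :=
  \sum_(0 <= i < k) nth 0 (sort >=%O (codom v)) i.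

(* q_eq(k, (p_j)_{j in J}) and q_ge, q_ne for a subset J of a finite type. *)
Section Q.
Context (R : realType) (I : finType) (J : {set I}) (pr : I -> R).

Definition q_eq (k : int) : R :=
  \sum_(s : {set I} | (s \subset J) && (#|s|%:Z == k))
    (\prod_(j in s) pr j) * (\prod_(j in J :\: s) (1 - pr j)).

(* q_eq k = 0 unless 0 <= k <= #|J|, so this is the sum over all k >= d. *)
Definition q_ge (d : int) : R := \sum_(k < #|J|.+1 | d <= k%:Z) q_eq k%:Z.

Definition q_ne (d : int) : R := 1 - q_eq d.
End Q.

Section Model.
Context (R : realType) (p m : nat) (L : R).
Context (disp : measure_display) (T : measurableType disp).
Context (P : probability T R).

Definition mutually_independent (U : 'I_m -> {RV P >-> 'pt[R]_p}) : Prop :=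
  forall (J : {set 'I_m}) (A : 'I_m -> set 'pt[R]_p),
    (forall a, measurable (A a)) ->
    P (\bigcap_(a in [set` J]) (U a @^-1` A a)) =
    (\prod_(a in J) P (U a @^-1` A a))%E.

Definition has_density (X : {RV P >-> 'pt[R]_p}) (C : set 'pt[R]_p)
    (f : 'pt[R]_p -> R) : Prop :=
  measurable_fun C f /\
  forall A, measurable A ->
    P (X @^-1` A) = (\int[leb R p]_(x in A `&` C) (f x)%:E)%E.

Variable U : 'I_m -> {RV P >-> 'pt[R]_p}.

Definition neighbors (a : 'I_m) (x : T) : nat :=
  \sum_(b < m | b != a)
    `[< tball L (U a x) `&` tball L (U b x) !=set0 >].

Definition Y_ge (w : 'I_m -> R) (d : 'I_m -> int) (x : T) : R :=
  \sum_(a < m) w a * (d a <= (neighbors a x)%:Z)%R%:R.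

Definition Y_ne (w : 'I_m -> R) (d : 'I_m -> int) (x : T) : R :=
  \sum_(a < m) w a * ((neighbors a x)%:Z != d a)%:R.

Definition p_near (u : 'pt[R]_p) (b : 'I_m) : R :=
  fine (P [set x | tdist L u (U b x) <= 2]).

(* At t = - mu the right side of (iii) is 0 `^ 0 * expR (- mu / c), and
   0 `^ 0 = 1, which is the value required there. *)
Definition concentration (Y : T -> R) (mu c : R) : Prop :=
  [/\ (forall t : R, 0 < t ->
        (P [set x | (Y x - mu <= - t)%R] <= (expR (- (t ^+ 2 / (2 * c * mu))))%:E)%E),
      (forall t : R, 0 < t ->
        (P [set x | (t <= Y x - mu)%R] <=
          (expR (- (t ^+ 2 / (2 * c * mu + c * t))))%:E)%E),
      (forall t : R, 0 <= t ->
        (P [set x | (t <= Y x - mu)%R] <=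
          ((mu / (mu + t)) `^ ((t + mu) / c) * expR (t / c))%:E)%E) /\
      (forall t : R, - mu <= t <= 0 ->
        (P [set x | (Y x - mu <= t)%R] <=
          ((mu / (mu + t)) `^ ((t + mu) / c) * expR (t / c))%:E)%E) &
      (forall t : R, 0 < t ->
        (P [set x | (t <= Y x - mu)%R] <=
          (expR (- (t ^+ 2 / (2 * c * mu + 2 * c * t / 3))))%:E)%E)].

End Model.

(* Main.v *)
(* The bound on E exp(theta Y) that yields all four tail estimates,
     E exp(theta Y) <= exp(mu (exp(c theta) - 1) / c)   for all real theta,
   is first proved when every U_alpha takes finitely many values, the cells of
   a fine grid, two cells being adjacent if their corners are at distance at
   most 2 plus a vanishing slack. A packing argument makes every such neighbor
   graph free of stars with kappa_1 + 1 leaves, which bounds how many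
   indicators can react to the move of one point. As the mesh tends to 0 the
   adjacencies of the discretised points become those of the points
   themselves, so the bound and the formula for mu pass to the limit.

   On the finite model, among the product laws consider one maximising
   E exp(theta Y) exp(- mu (exp(c theta) - 1) / c); stationarity in each
   marginal turns the required differential inequality in theta into a bound
   on the exponentially tilted mean of Y at a stationary law. For Y_ge this
   bound holds for every law, by comparing the law of Y given M_alpha >= d_alpha
   with that of Y + c, through a case of Reimer's inequality on the cube. For
   Y_ne, outward moves change Y by less than c, which bounds the tilted
   probability of each indicator given U_alpha, and stationarity converts these
   bounds into one on the mean. *)
Require Import Defs.
From mathcomp Require Import all_boot all_order all_algebra.
From mathcomp Require Import zify ring lra.
Import Order.TTheory GRing.Theory Num.Theory.

Set Implicit Arguments.
Unset Strict Implicit.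
Unset Printing Implicit Defensive.

(** * Stars and thresholds in finite graphs *)

(** The target bound is the moment generating function of [c] times a Poisson variable of mean
    [mu / c]. It is the integrated form of [E (Y exp (theta Y)) <= exp (c theta) E Y E exp (theta
    Y)] for [theta >= 0], with the reverse inequality for [theta <= 0]. A size-bias coupling raising
    [Y] by at most [c] would give this at once, but conditioning on a degree relocates several
    points, each of which disturbs indicators where it leaves and where it arrives. For [Y_ge] only
    losses are counted: deleting a point and [d_alpha] well-chosen neighbors costs at most
    [|d| (sigma_d + 1)] indicators, wherever these points reappear, since more points only raise
    degrees. For [Y_ne] this monotonicity is absent, and tilting also shifts the law of [U_alpha],
    so bounds conditional on [U_alpha] need not average to the right mean. At a stationary law the
    shift is a covariance with [Y], and these covariances can be estimated together. Stationary laws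
    come from compactness of the set of laws, whence the discretisation. *)

Section Graph.
Variable T : finType.
Implicit Types (e : rel T) (X Y Z S I R : {set T}) (n : T -> nat).

Definition nbr e X (x : T) : {set T} := [set y in X | e x y].

Definition indep e I := [forall x in I, forall y in I, (x != y) ==> ~~ e x y].

(** All that the finite argument retains of the geometry, with [k] equal to [kappa1]. *)
Definition starfree e (k : nat) := forall x I,
  I \subset nbr e setT x -> indep e I -> #|I| <= k.

Lemma indepP e I :
  reflect (forall x y, x \in I -> y \in I -> x != y -> ~~ e x y) (indep e I).
Proof.
apply: (iffP forall_inP) => [h x y xI yI xy|h x xI].
  by have /forall_inP/(_ y yI)/implyP/(_ xy) := h x xI.
by apply/forall_inP => y yI; apply/implyP; exact: h.
Qed.

(** For a maximal [I], every vertex of [S] outside [I] has a neighbor in [I], so the closed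
    neighborhoods of the points of [I] cover [S]. *)
Lemma max_indep e S : symmetric e -> exists I,
  [/\ I \subset S, indep e I & #|S| <= \sum_(x in I) #|nbr e S x|.+1].
Proof.
move=> esym.
have h0 : indep e set0 && (set0 \subset S).
  by rewrite sub0set andbT; apply/indepP => x y; rewrite inE.
have [I /maxsetP[/andP[indI IS] maxI] _] :=
  @maxset_exists _ (fun I : {set T} => indep e I && (I \subset S)) _ h0.
exists I; split => //.
have cov : S \subset \bigcup_(x in I) (x |: nbr e S x).
  apply/subsetP => s sS; apply/bigcupP.
  have [sI|sI] := boolP (s \in I); first by exists s => //; rewrite setU11.
  case: (pickP [pred x in I | e x s]) => [x /andP[xI xs]|none].
    by exists x => //; rewrite !inE sS xs orbT.
  suff : s |: I = I by move=> eI; rewrite -eI setU11 in sI.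
  apply: maxI; last exact: subsetUr.
  apply/andP; split; last by rewrite subUset sub1set sS.
  apply/indepP => x y /setU1P[->|xI] /setU1P[->|yI] xy.
  - by rewrite eqxx in xy.
  - by have := none y; rewrite /= yI /= esym => ->.
  - by have := none x; rewrite /= xI /= => ->.
  - by move/indepP : indI; apply.
apply: leq_trans (subset_leq_card cov) _.
apply: (@leq_trans (\sum_(x in I) #|x |: nbr e S x|)).
  elim/big_rec2 : _ => [|x a A _ le]; first by rewrite cards0.
  by apply: leq_trans (leq_card_setU _ _) _; rewrite leq_add2l.
by apply: leq_sum => x _; rewrite cardsU1; case: (_ \notin _); lia.
Qed.

Section Cluster.
Variables (e : rel T) (k : nat).
Hypotheses (esym : symmetric e) (sf : starfree e k).

(** Origin of the sums over [kappa1] entries: [S] is covered by the neighborhoods of an independent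
    subset, whose size star-freeness bounds, and each of them with its center has at most [n y]
    points. *)
Lemma cluster_card n S x : S \subset nbr e setT x ->
  (forall y, y \in S -> #|nbr e S y| < n y) ->
  exists2 I : {set T}, #|I| <= k & #|S| <= \sum_(y in I) n y.
Proof.
move=> Sx Sn; have [I [IS indI SI]] := @max_indep e S esym.
exists I; first by apply: (@sf x) => //; apply: (subset_trans IS).
by apply: (leq_trans SI); apply: leq_sum => y yI; apply/Sn/(subsetP IS).
Qed.

(** The extra neighbor [a] of [x] makes the inequality strict: if some [y] in [I] sees [a], the
    bound at [y] has one unit to spare, and otherwise [a] joins [I] and contributes [n a > 0]. *)
Lemma cluster_card1 n S x a : S \subset nbr e setT x -> a \notin S ->
  e x a -> 0 < n a ->
  (forall y, y \in S -> #|nbr e S y| + e y a < n y) ->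
  exists2 I : {set T}, #|I| <= k & #|S| < \sum_(y in I) n y.
Proof.
move=> Sx aS xa na Sn; have [I [IS indI SI]] := @max_indep e S esym.
have Ile : #|I| <= k by apply: (@sf x) => //; apply: (subset_trans IS).
have SnI y : y \in I -> #|nbr e S y|.+1 + e y a <= n y.
  by move=> /(subsetP IS)/Sn; rewrite -addSn.
case: (pickP [pred y in I | e y a]) => [y /andP[yI ya]|none].
  exists I => //; apply: (leq_ltn_trans SI).
  rewrite (bigD1 y)//= [ltnRHS](bigD1 y)//= -addSn leq_add//.
    by have := SnI y yI; rewrite ya; lia.
  by apply: leq_sum => z /andP[zI _]; have := SnI z zI; lia.
have aI : a \notin I by apply: contra aS; exact: subsetP.
exists (a |: I).
  apply: (@sf x).
    by rewrite subUset sub1set !inE xa/=; apply: subset_trans IS _.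
  apply/indepP => y z /setU1P[->|yI] /setU1P[->|zI] yz.
  - by rewrite eqxx in yz.
  - by have := none z; rewrite /= zI /= esym => ->.
  - by have := none y; rewrite /= yI /= => ->.
  - by move/indepP : indI; apply.
rewrite big_setU1//=; apply: (leq_ltn_trans SI).
rewrite -add1n leq_add//; apply: leq_sum => z zI.
by have := SnI z zI; lia.
Qed.

End Cluster.

Section Threshold.
Variables (e : rel T) (k : nat) (d : T -> nat) (D sig : nat).
Hypotheses (esym : symmetric e) (eirr : irreflexive e) (sf : starfree e k).
Hypotheses (k2 : 1 < k) (dpos : forall x, 0 < d x) (dD : forall x, d x <= D).
Hypothesis Dsig : D <= sig.
Hypothesis sigP : forall I : {set T}, #|I| <= k -> \sum_(x in I) d x <= sig.

Definition sat X : {set T} := [set x in X | d x <= #|nbr e X x|].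

Lemma nbrS X Y x : X \subset Y -> nbr e X x \subset nbr e Y x.
Proof. by move=> XY; rewrite /nbr !setIdE setSI. Qed.

Lemma nbrD1 X x y : e x y -> y \in X ->
  #|nbr e X x| = #|nbr e (X :\ y) x|.+1.
Proof.
move=> xy yX; rewrite (cardsD1 y) !inE yX xy add1n; congr (#|pred_of_set _|.+1).
by apply/setP => z; rewrite !inE andbA.
Qed.

Lemma nbrD1n X x y : ~~ e x y -> nbr e (X :\ y) x = nbr e X x.
Proof.
move=> xy; apply/setP => z; rewrite !inE.
by case: eqVneq => //= ->; rewrite (negbTE xy) andbF.
Qed.

(** Apart from [x] itself, only these vertices fall below their threshold when [x] is deleted. *)
Definition crit X x := [set y in X :\ x | e x y & #|nbr e X y| == d y].

Lemma sat_lose X x : x \in X ->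
  sat X :\: sat (X :\ x) \subset [set y in [set x] | x \in sat X] :|: crit X x.
Proof.
move=> xX; apply/subsetP => y; rewrite inE => /andP[].
have [->|yx] := eqVneq y x; first by rewrite in_setU [X in X || _]in_set set11 => _ ->.
rewrite inE in_setD1 yx /= => h ysat.
move: (ysat); rewrite inE => /andP[yX dy].
rewrite yX /= -ltnNge in h.
apply/setUP; right; rewrite !inE yx yX /=.
have [xy|xy] := boolP (e y x); last by rewrite nbrD1n// ltnNge dy in h.
by rewrite esym xy /= eqn_leq dy andbT (nbrD1 xy).
Qed.

Lemma critE X x y : y \in crit X x -> x \in X ->
  #|nbr e (crit X x) y| < d y.
Proof.
rewrite !inE => /andP[/andP[yx yX] /andP[xy /eqP <-]] xX.
rewrite (nbrD1 (y := x) _ xX) 1?esym// ltnS; apply/subset_leq_card/nbrS.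
by apply/subsetP => z; rewrite !inE => /andP[].
Qed.

Lemma crit_sig X x : x \in X -> #|crit X x| <= sig.
Proof.
move=> xX; have [|y yc|I kI le] := @cluster_card e k esym sf d (crit X x) x.
- by apply/subsetP => y; rewrite !inE => /and3P[].
- exact: critE.
- exact: leq_trans le (sigP kI).
Qed.

Lemma crit_nbr X x : crit X x \subset nbr e X x.
Proof. by apply/subsetP => y; rewrite !inE => /andP[/andP[_ ->] /andP[->]]. Qed.

Definition loss X Y := #|sat X :\: sat Y|.

Lemma loss_trans X Y Z : loss X Z <= loss X Y + loss Y Z.
Proof.
apply: leq_trans (leq_card_setU _ _); apply/subset_leq_card/subsetP => x.
by rewrite in_setU !in_setD; case: (x \in sat X); case: (x \in sat Y); case: (x \in sat Z).
Qed.

Lemma loss1 X x : x \in X -> loss X (X :\ x) <= (x \in sat X) + #|crit X x|.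
Proof.
move=> xX; apply: leq_trans (subset_leq_card (sat_lose xX)) _.
apply: leq_trans (leq_card_setU _ _) _; rewrite leq_add2r.
case: (_ \in _); last by rewrite (_ : [set _ in _ | _] = set0) ?cards0//;
  apply/setP => y; rewrite !inE andbF.
by rewrite (_ : [set _ in _ | _] = [set x]) ?cards1//; apply/setP => y; rewrite !inE andbT.
Qed.

(** Vertices are deleted one at a time, each at the cost of itself and at most [sig] critical
    vertices. *)
Lemma loss_gen X Y : X \subset Y -> loss Y X <= #|Y :\: X| * sig.+1.
Proof.
move: {2}#|Y :\: X| (erefl #|Y :\: X|) => n; elim: n Y => [|n IH] Y.
  move/eqP; rewrite cards_eq0 setD_eq0 => YX XY.
  have -> : Y = X by apply/eqP; rewrite eqEsubset YX.
  by rewrite /loss setDv cards0.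
move=> Yn XY; have [y yY] : exists y, y \in Y :\: X.
  by apply/set0Pn; rewrite -cards_eq0 Yn.
move: (yY); rewrite inE => /andP[yX yY'].
have XYy : X \subset Y :\ y by rewrite subsetD1 XY.
have E : (Y :\ y) :\: X = (Y :\: X) :\ y.
  by apply/setP => z; rewrite !inE andbCA.
have En : #|(Y :\ y) :\: X| = n.
  by move: Yn; rewrite E (cardsD1 y (Y :\: X)) yY => -[].
apply: leq_trans (loss_trans _ (Y :\ y) _) _.
have := IH _ En XYy; rewrite En Yn mulSn => le; apply: leq_add le.
apply: leq_trans (loss1 yY') _; rewrite -add1n leq_add ?leq_b1//.
exact: crit_sig.
Qed.

(** A deleted vertex below its threshold is not itself counted, and its critical vertices are among
    its fewer than [d y <= D] neighbors. Deletions preserve the hypothesis, as degrees only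
    decrease. *)
Lemma loss_unsat X Y : X \subset Y ->
  (forall y, y \in Y :\: X -> #|nbr e Y y| < d y) ->
  loss Y X <= #|Y :\: X| * D.-1.
Proof.
move: {2}#|Y :\: X| (erefl #|Y :\: X|) => n; elim: n Y => [|n IH] Y.
  move/eqP; rewrite cards_eq0 setD_eq0 => YX XY _.
  have -> : Y = X by apply/eqP; rewrite eqEsubset YX.
  by rewrite /loss setDv cards0.
move=> Yn XY uns; have [y yY] : exists y, y \in Y :\: X.
  by apply/set0Pn; rewrite -cards_eq0 Yn.
move: (yY); rewrite inE => /andP[yX yY'].
have XYy : X \subset Y :\ y by rewrite subsetD1 XY.
have E : (Y :\ y) :\: X = (Y :\: X) :\ y.
  by apply/setP => z; rewrite !inE andbCA.
have En : #|(Y :\ y) :\: X| = n.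
  by move: Yn; rewrite E (cardsD1 y (Y :\: X)) yY => -[].
apply: leq_trans (loss_trans _ (Y :\ y) _) _.
have uns' z : z \in (Y :\ y) :\: X -> #|nbr e (Y :\ y) z| < d z.
  rewrite E => /setD1P[_ /uns]; apply: leq_ltn_trans.
  exact/subset_leq_card/nbrS/subsetDl.
have := IH _ En XYy uns'; rewrite En Yn mulSn => le; apply: leq_add le.
apply: leq_trans (loss1 yY') _.
have yu := uns y yY.
have -> : (y \in sat Y) = false by rewrite inE yY' leqNgt yu.
rewrite add0n.
apply: leq_trans (subset_leq_card (crit_nbr _ _)) _.
by have := dD y; have := dpos y; lia.
Qed.

Lemma subset_card (X : {set T}) j : j <= #|X| ->
  exists2 Y : {set T}, Y \subset X & #|Y| = j.
Proof.
case/card_geqP => s [us ss sX]; exists [set x in s].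
  by apply/subsetP => x; rewrite inE; exact: sX.
by rewrite cardsE (card_uniqP us).
Qed.

(* The vertices of [R] form a witness of [d a <= degree of a] whose removal,
   together with that of [a], is cheap; the case distinction is on the set [Q]
   of those neighbours that are below their threshold without [a]. *)
Lemma cheap_witness a : d a <= #|nbr e setT a| -> exists R,
  [/\ R \subset nbr e setT a, #|R| = d a &
      loss setT (~: (a |: R)) <= D * sig.+1].
Proof.
set N := nbr e setT a => dN.
pose W := setT :\ a.
have aN : a \notin N by rewrite !inE eirr.
have NW : N \subset W by apply/subsetP => x xN; rewrite !inE andbT; apply: contraNneq aN => <-.
pose Q := [set x in N | #|nbr e W x| < d x].
have QN : Q \subset N by apply/subsetP => x; rewrite inE => /andP[].
have dsig x : d x <= sig.
  by have := @sigP [set x]; rewrite cards1 big_set1; apply; lia.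
have dsig2 x y : x != y -> d x + d y <= sig.
  move=> xy; have := @sigP [set x; y].
  by rewrite cards2 xy big_setU1 ?inE//= big_set1; apply.
have loss0 : loss setT W <= #|Q|.+1 /\ loss setT W <= sig.+1.
  have h := loss1 (in_setT a).
  split; apply: leq_trans h _; rewrite -add1n leq_add ?leq_b1 ?crit_sig ?inE//.
  apply/subset_leq_card/subsetP => y; rewrite !inE andbT => /and3P[ya ay /eqP <-].
  by rewrite ay (@nbrD1 setT y a) ?inE ?ltnSn// esym.
have RW R : R \subset N -> [/\ W :\: (~: (a |: R)) = R & ~: (a |: R) \subset W].
  move=> RN; split.
    apply/setP => x; rewrite !inE; case: eqVneq => [->|] /=; last by rewrite andbT negbK.
    by rewrite /=; apply/eqP; rewrite eq_sym; apply/eqP/negbTE; apply: contra aN; move/subsetP: RN; apply.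
  by apply/subsetP => x; rewrite !inE; case: eqVneq.
(* If [Q] supplies the whole witness, deleting [a] costs at most [sig + 1] and each further deletion
   at most [D - 1]; this fits since [D <= sig]. *)
have [dQ|Qd] := leqP (d a) #|Q|.
  have [R RQ cR] := subset_card dQ; exists R; split => //.
    exact: subset_trans RQ QN.
  have RN := subset_trans RQ QN; have [E1 E2] := RW R RN.
  apply: leq_trans (loss_trans _ W _) _.
  have h1 := @loss_unsat (~: (a |: R)) W E2; rewrite E1 in h1.
  have {}h1 := h1 _; rewrite cR in h1.
  have h2 : loss W (~: (a |: R)) <= d a * D.-1.
    by apply: h1 => y /(subsetP RQ); rewrite inE => /andP[].
  have := dpos a; have := dD a; have := dsig a; have [_ h3] := loss0.
  by move: h2 h3; set x := loss _ _; set y := loss _ _; nia.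
have mixed (j : {set T}) : j \subset N -> #|j| <= d a -> Q \subset j ->
    exists R, [/\ R \subset N, #|R| = d a, j \subset R &
      loss setT (~: (a |: R)) <=
      loss setT W + loss W (W :\: j) + (d a - #|j|) * sig.+1].
  move=> jN jd Qj.
  have : d a - #|j| <= #|N :\: j| by rewrite cardsD (setIidPr jN); lia.
  case/subset_card => R' R'N cR'.
  have jR : j :|: R' \subset N.
    by rewrite subUset jN; apply: subset_trans R'N _; exact: subsetDl.
  exists (j :|: R'); split => //.
  - rewrite cardsU cR' (_ : j :&: R' = set0) ?cards0; first lia.
    apply/setP => x; rewrite !inE; apply/negP => /andP[xj /(subsetP R'N)].
    by rewrite inE xj.
  - exact: subsetUl.
  apply: leq_trans (loss_trans _ W _) _; rewrite -addnA leq_add2l.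
  apply: leq_trans (loss_trans _ (W :\: j) _) _; rewrite leq_add2l.
  have [E1 E2] := RW _ jR.
  have h : ~: (a |: (j :|: R')) \subset W :\: j.
    apply/subsetP => x; rewrite !inE !negb_or => /andP[-> /andP[-> _]] //.
  apply: leq_trans (loss_gen h) _.
  rewrite leq_mul2r -cR'; apply/orP; right; apply/subset_leq_card/subsetP => x.
  rewrite in_setD in_setC negbK in_setU1 in_setU in_setD in_setD1.
  by case: (x == a); case: (x \in j); case: (x \in R').
have unsat_Q : loss W (W :\: Q) <= #|Q| * D.-1.
  have E : W :\: (W :\: Q) = Q.
    by rewrite setDDr setDv set0U; apply/setIidPr/(subset_trans QN).
  have := @loss_unsat (W :\: Q) W (subsetDl _ _); rewrite E; apply => y.
  by rewrite inE => /andP[].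
(* A smaller nonempty [Q] is used up: deleting [a] loses only [a] and members of [Q], so the total
   is at most [1 + #|Q| * D + (d a - #|Q|) * (sig + 1)]. *)
have [Q0|Q0] := posnP #|Q|; last first.
  have [R [RN cR _ le]] := mixed Q QN (ltnW Qd) (subxx _).
  exists R; split => //; apply: leq_trans le _.
  have := dpos a; have := dD a; have [h3 _] := loss0.
  by move: unsat_Q h3; set x := loss _ _; set y := loss _ _; nia.
have {}loss0 : loss setT W <= 1 by case: loss0; rewrite Q0.
have Qs (j : {set T}) : Q \subset j.
  by move/eqP: Q0; rewrite cards_eq0 => /eqP ->; exact: sub0set.
(* With [Q] empty, deleting [a] costs at most 1. This fits if [d a < D]; if [d a = D], some neighbor
   must be found whose deletion costs [sig] rather than [sig + 1]. *)
have [dDa|dDa] := eqVneq (d a) D; last first.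
  have [R [RN cR _ le]] := mixed set0 (sub0set _) (leq_trans (eq_leq (cards0 _)) (leq0n _)) (Qs _).
  exists R; split => //; apply: leq_trans le _.
  rewrite setD0 cards0 {2}/loss setDv cards0.
  by have := dD a; nia.
have [j jN] : exists j, j \in N.
  by apply/set0Pn; rewrite -cards_eq0 -lt0n; apply: leq_trans (dpos a) dN.
have aj : a != j by apply: contraNneq aN => ->.
have := dsig2 a j aj; have := dpos j; rewrite dDa => dj0 Dsig2.
have single x : x \in N -> loss W (W :\ x) <= sig ->
  exists R, [/\ R \subset N, #|R| = D & loss setT (~: (a |: R)) <= D * sig.+1].
  move=> xN lx; have [||R [RN cR _ le]] := mixed [set x] _ _ (Qs _).
  - by rewrite sub1set.
  - by rewrite cards1.
  exists R; split => //; first by rewrite cR.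
  apply: leq_trans le _; rewrite cards1 dDa.
  have := dpos a; rewrite dDa => {}dj0.
  apply: (@leq_trans (1 + sig + D.-1 * sig.+1)).
    by rewrite subn1 leq_add2r leq_add.
  by rewrite -{2}(prednK dj0) mulSn; lia.
have jW := subsetP NW j jN.
have ea x : x \in N -> e a x by rewrite !inE.
(* A critical vertex adjacent to [a] is such a neighbor, since it has at most [D < sig] neighbors in
   [W]. If there is none, [a] is the extra vertex of [cluster_card1] and saves the unit at [j]. *)
case: (pickP [pred y in crit W j | e y a]) => [y /andP[yc ya]|none].
  have [yN yW] : y \in N /\ y \in W.
    move: yc; rewrite !inE => /andP[/andP[_ /andP[-> _]] _]; by rewrite esym ya.
  apply: (single y yN); apply: leq_trans (loss1 yW) _.
  have : #|crit W y| <= D.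
    apply: leq_trans (subset_leq_card (crit_nbr _ _)) _.
    by move: yc; rewrite !inE => /andP[_ /andP[_ /eqP ->]].
  move=> cD; clear - cD Dsig2 dj0.
  by case: (y \in _); lia.
apply: (single j jN); apply: leq_trans (loss1 jW) _.
have [||||y yc|I kI le] := @cluster_card1 e k esym sf d (crit W j) j a.
- by apply/subsetP => y; rewrite !inE => /and3P[].
- by rewrite !inE eqxx andbF.
- by rewrite esym; exact: ea.
- exact: dpos.
- by have := none y; rewrite /= yc /= => ->; rewrite addn0; exact: critE yc jW.
have := leq_trans le (sigP kI).
by case: (j \in _); lia.
Qed.
End Threshold.
End Graph.

(** * Vertices leaving their prescribed degree when one vertex moves *)

Section Move.
Variables (T : finType) (e e' : rel T) (k : nat) (d : T -> nat) (sig sig1 : nat).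
Variables (a b : T).
Hypotheses (esym : symmetric e) (eirr : irreflexive e) (sf : starfree e k).
Hypotheses (esym' : symmetric e') (eirr' : irreflexive e') (sf' : starfree e' k).
Hypothesis ee' : forall x y, x != b -> y != b -> e x y = e' x y.
Hypotheses (k2 : 1 < k) (dnz : exists x, 0 < d x).
Hypothesis sigP : forall I : {set T}, #|I| <= k -> \sum_(x in I) d x <= sig.
Hypothesis sigP1 : forall I : {set T}, #|I| <= k -> \sum_(x in I) (d x).+1 <= sig1.
Hypothesis ab : a != b.

Local Notation deg f x := #|nbr f setT x|.

(** The graphs before and after the move of [b] are [e] and [e']. Losers have degree [d x] counting
    [b], which leads to [sig]; gainers have it without [b], so their closed neighborhoods may reach
    [d x + 1], which leads to [sig1]. *)
Let losers := [set x in [set~ a] :\ b | [&& deg e x == d x, e x b & ~~ e' x b]].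
Let gainers := [set x in [set~ a] :\ b | [&& deg e x == d x, ~~ e x b & e' x b]].

Definition newly := [set x in [set~ a] | (deg e x == d x) && (deg e' x != d x)].

Let newly_sub : #|newly| <= #|losers| + #|gainers| + (b \in newly).
Proof.
have : newly \subset (losers :|: gainers) :|: [set x in [set b] | b \in newly].
  apply/subsetP => x; have [->|xb] := eqVneq x b.
    by move=> h; rewrite !in_setU [X in _ || X]inE h inE eqxx orbT.
  rewrite !inE xb => /andP[-> /andP[dx0 /= dx]]; rewrite dx0 /=; rewrite orbC /=.
  apply: contraNT dx; rewrite (negbTE xb)/=.
  have [xb1|xb1] := boolP (e x b); have [xb2|xb2] := boolP (e' x b) => //= _;
    rewrite (_ : nbr e' setT x = nbr e setT x) ?inE //; (try by move: dx; rewrite inE);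
    apply/setP => y; rewrite !inE /=; have [->|yb] := eqVneq y b;
    rewrite ?xb1 ?xb2 ?(negbTE xb1) ?(negbTE xb2)// ee'//.
move/subset_leq_card/leq_trans; apply.
apply: leq_trans (leq_card_setU _ _) _; apply: leq_add; first exact: leq_card_setU.
case: (b \in _); last by rewrite (_ : [set _ in _ | _] = set0) ?cards0//;
  apply/setP => y; rewrite !inE andbF.
by rewrite (_ : [set _ in _ | _] = [set b]) ?cards1//; apply/setP => y; rewrite !inE andbT.
Qed.

Let dsig x : d x <= sig.
Proof. by have := @sigP [set x]; rewrite cards1 big_set1; apply; lia. Qed.

Let dsig2 x y : x != y -> d x + d y <= sig.
Proof.
move=> xy; have := @sigP [set x; y].
by rewrite cards2 xy big_setU1 ?inE//= big_set1; apply.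
Qed.

Let losersE x : x \in losers -> [/\ x != b, x != a, deg e x = d x & e x b].
Proof. by rewrite !inE => /andP[/andP[-> ->] /and3P[/eqP -> -> _]]. Qed.

Let gainersE x : x \in gainers -> [/\ x != b, x != a, deg e x = d x & e' x b].
Proof. by rewrite !inE => /andP[/andP[-> ->] /and3P[/eqP -> _ ->]]. Qed.

Let nbr_lt (X : {set T}) x : b \notin X -> e x b -> #|nbr e X x| < deg e x.
Proof.
move=> bX xb; apply: proper_card; apply/properP; split.
  by apply: nbrS; exact: subsetT.
by exists b; rewrite !inE ?xb // (negbTE bX).
Qed.

Let aL : a \notin losers. Proof. by rewrite !inE eqxx /= andbF. Qed.
Let aE : a \notin gainers. Proof. by rewrite !inE eqxx /= andbF. Qed.
Let bL : b \notin losers. Proof. by rewrite !inE eqxx. Qed.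

Let losers_sig : #|losers| <= sig.
Proof.
have [|y yL|I kI le] := @cluster_card _ e k esym sf d losers b.
- by apply/subsetP => y /losersE[_ _ _ yb]; rewrite !inE esym.
- by have [_ _ <- yb] := losersE yL; exact: nbr_lt.
- exact: leq_trans le (sigP kI).
Qed.

Let nbr_gainers x : x != b -> nbr e' gainers x = nbr e gainers x.
Proof.
move=> xb; apply/setP => y; rewrite /nbr [in LHS]in_set [in RHS]in_set.
by have [/gainersE[yb _ _ _]|//] := boolP (y \in gainers); rewrite ee'.
Qed.

Let deg_gainers x : x != b -> #|nbr e gainers x| <= deg e x.
Proof. by move=> xb; apply/subset_leq_card/nbrS/subsetT. Qed.

Let gainers_sig : #|gainers| <= sig1.
Proof.
have [|y yE|I kI le] := @cluster_card _ e' k esym' sf' (fun x => (d x).+1) gainers b.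
- by apply/subsetP => y /gainersE[_ _ _ yb]; rewrite !inE esym'.
- have [yb _ <- _] := gainersE yE.
  by rewrite ltnS nbr_gainers// deg_gainers.
- exact: leq_trans le (sigP1 kI).
Qed.

Let losers_deg_b : #|losers| <= deg e b.
Proof.
by apply/subset_leq_card/subsetP => y /losersE[_ _ _ yb]; rewrite !inE esym.
Qed.

Let b_newly : b \in newly -> deg e b = d b.
Proof. by rewrite !inE => /andP[_ /andP[/eqP]]. Qed.

(** The crude bound is [sig + sig1 + 1], with one unit for [b]. As [b] arrives next to [a], the
    latter is the extra vertex among the gainers and saves one unit. If [b] itself counts, a second
    unit is saved because the losers are at most [d b] in number, or absent. *)
Lemma newly_arrival : e' a b -> #|newly| < sig + sig1.
Proof.
move=> ab'.
have gE : #|gainers| < sig1.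
  have [|||| y yE|I kI le] :=
      @cluster_card1 _ e' k esym' sf' (fun x => (d x).+1) gainers b a => //.
  - by apply/subsetP => y /gainersE[_ _ _ yb]; rewrite !inE esym'.
  - by rewrite esym'.
  - have [yb _ <- _] := gainersE yE.
    rewrite ltnS nbr_gainers// -ee'//.
    have [ya|ya] := boolP (e y a); last by rewrite addn0 deg_gainers.
    rewrite addn1; apply: proper_card; apply/properP; split.
      by apply: nbrS; exact: subsetT.
    by exists a; [rewrite !inE | rewrite in_set (negbTE aE)].
  - exact: leq_trans le (sigP1 kI).
have := newly_sub; have [bn|bn] := boolP (b \in newly); last first.
  by move: losers_sig gE; lia.
have db := b_newly bn.
suff : #|losers| < sig by move: gE; lia.
have [l0|l0] := posnP #|losers|.
  by rewrite l0; have [x dx] := dnz; apply: leq_trans dx (dsig x).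
have [y yL] : exists y, y \in losers by apply/set0Pn; rewrite -cards_eq0 -lt0n.
have [yb _ dy eyb] := losersE yL.
have : 0 < d y.
  by rewrite -dy; apply/card_gt0P; exists b; rewrite !inE.
move=> dy0; apply: leq_ltn_trans losers_deg_b (leq_trans _ (dsig2 yb)).
by rewrite db -add1n leq_add2r.
Qed.

(** Having degree at most [d a], the vertex [a] can join the losers in the cluster around [b], which
    saves one unit. If [b] counts, [a] is a neighbor of [b] that is not a loser, and
    [d a + d b <= sig] saves the second. *)
Lemma newly_departure : e a b -> deg e a <= d a -> #|newly| < sig + sig1.
Proof.
move=> ab1 da.
have lL : #|losers| < sig.
  have [|y|I kI] := @cluster_card _ e k esym sf d (a |: losers) b.
  - apply/subsetP => y /setU1P[->|/losersE[_ _ _ yb]]; by rewrite !inE esym.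
  - move=> /setU1P[->|yL].
      by apply: leq_trans da; apply: nbr_lt => //; rewrite in_setU1 (negbTE bL) eq_sym (negbTE ab).
    have [_ _ <- yb] := losersE yL.
    by apply: nbr_lt => //; rewrite in_setU1 (negbTE bL) eq_sym (negbTE ab).
  - by rewrite cardsU1 aL add1n => le; exact: leq_trans le (sigP kI).
have := newly_sub; have [bn|bn] := boolP (b \in newly); last first.
  by move: gainers_sig lL; lia.
have db := b_newly bn.
have : #|losers| < deg e b.
  apply: proper_card; apply/properP; split.
    by apply/subsetP => y /losersE[_ _ _ yb]; rewrite !inE esym.
  by exists a => //; rewrite !inE esym.
have : 0 < d a.
  by apply: leq_trans da; apply/card_gt0P; exists b; rewrite !inE.
by have := dsig2 ab; move: gainers_sig; rewrite db; lia.
Qed.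

End Move.

(** * Inequalities on the cube *)

Section Reimer.
Local Open Scope ring_scope.
Variable T : finType.
Implicit Types (B C : {set {set T}}) (R X Y Z : {set T}).

Let toggle (r : T) Y : {set T} := if r \in Y then Y :\ r else r |: Y.

Let toggleK r : involutive (toggle r).
Proof.
move=> Y; rewrite /toggle; case: (boolP (r \in Y)) => rY.
  by rewrite setD11 setD1K.
by rewrite setU11 setU1K.
Qed.

Let in_toggle x r Y : x != r -> (x \in toggle r Y) = (x \in Y).
Proof.
by move=> xr; rewrite /toggle; case: (r \in Y); rewrite ?in_setD1 ?in_setU1 ?xr ?(negbTE xr).
Qed.

Let toggle_sub r Y Z : r \in Z -> (toggle r Y \subset Z) = (Y \subset Z).
Proof.
move=> rZ; apply/subsetP/subsetP => h x; have [->//|xr] := eqVneq x r => xY;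
  by apply: h; rewrite in_toggle in xY *.
Qed.

Let sub_toggle r Y Z : r \notin Z -> (Z \subset toggle r Y) = (Z \subset Y).
Proof.
move=> rZ; apply/subsetP/subsetP => h x xZ; have xr : x != r by apply: contraTneq xZ => ->.
  by have := h x xZ; rewrite in_toggle.
by rewrite in_toggle//; exact: h.
Qed.

Let alt X R Y : rat := if (X :\: R \subset Y) && (Y \subset X) then (-1) ^+ #|Y| else 0.

Let alt_toggle X R Y r : R \subset X -> r \in R -> alt X R (toggle r Y) = - alt X R Y.
Proof.
move=> /subsetP RX rR; rewrite /alt toggle_sub ?RX// sub_toggle ?inE ?rR//.
case: ifP => _; last by rewrite oppr0.
rewrite /toggle; case: (boolP (r \in Y)) => rY.
  by rewrite [in RHS](cardsD1 r Y) rY exprS mulN1r opprK.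
by rewrite cardsU1 rY exprS mulN1r.
Qed.

(** The sizes force [Z] to meet [R], and toggling a common element is a sign-reversing involution of
    the subsets of [Z]. *)
Let alt_sum X R Z : R \subset X -> (#|T| < #|Z| + #|R|)%N ->
  \sum_(Y : {set T} | Y \subset Z) alt X R Y = 0.
Proof.
move=> RX ZR; have [r /andP[rR rZ]] : exists r, (r \in R) && (r \in Z).
  apply/existsP; apply: contraTT ZR; rewrite negb_exists -leqNgt => /forallP h.
  have <- : #|Z :|: R| = (#|Z| + #|R|)%N.
    rewrite cardsU (_ : Z :&: R = set0) ?cards0 ?subn0//.
    by apply/setP => x; have := h x; rewrite !inE andbC => /negbTE.
  exact: max_card.
set s := LHS; suff : s = - s by move/eqP; rewrite -addr_eq0 -mulr2n mulrn_eq0 => /eqP.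
rewrite {1}/s (reindex_inj (inv_inj (toggleK r))) /s -sumrN.
apply: eq_big => [Y|Y _]; last exact: alt_toggle.
by rewrite toggle_sub.
Qed.

(* A special case of Reimer's disjoint-occurrence inequality. The alternating
   indicators of the intervals [X :\: R, X] are linearly independent modulo the
   functions supported on sets of more than [#|T| - d] elements, since they
   annihilate all polynomials of degree less than [d]. *)
Lemma disjoint_occurrence (d : nat) B C :
  (forall X, X \in C -> exists R, [/\ R \subset X, #|R| = d &
     forall Z, X :\: R \subset Z -> Z \subset X -> Z \in B]) ->
  (#|C| <= #|[set Z in B | (#|Z| + d <= #|T|)%N]|)%N.
Proof.
move=> hC; have [rf rfP] : exists rf : {set T} -> {set T}, forall X, X \in C ->
    [/\ rf X \subset X, #|rf X| = d &
      forall Z, X :\: rf X \subset Z -> Z \subset X -> Z \in B].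
  apply: (@fin_all_exists _ (fun=> {set T} : Type) (fun X u => X \in C ->
    [/\ u \subset X, #|u| = d &
      forall Z, X :\: u \subset Z -> Z \subset X -> Z \in B])) => X.
  have [XC|XC] := boolP (X \in C); last by exists X.
  by have [R hR] := hC X XC; exists R.
set Bl := [set Z in B | _].
(* Rows are indexed by [C] and columns by the low sets of [B]; independence of the rows is the
   claim. *)
pose M : 'M[rat]_(#|C|, #|Bl|) :=
  \matrix_(i, j) alt (enum_val i) (rf (enum_val i)) (enum_val j).
suff /eqP <- : row_free M by exact: rank_leq_col.
apply: inj_row_free => v vM.
pose f Y : rat := \sum_i v 0 i * alt (enum_val i) (rf (enum_val i)) Y.
have f_low Z : (#|Z| + d <= #|T|)%N -> f Z = 0.
  move=> Zd; have [ZB|ZB] := boolP (Z \in B); last first.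
    rewrite /f big1// => i _; rewrite /alt; case: ifP => [/andP[h1 h2]|]; rewrite ?mulr0//.
    have [_ _ /(_ Z h1 h2) ZB'] := rfP _ (enum_valP i).
    by rewrite ZB' in ZB.
  have ZBl : Z \in Bl by rewrite inE ZB.
  have := congr1 (fun w : 'rV_ _ => w 0 (enum_rank_in ZBl Z)) vM.
  rewrite !mxE => h; rewrite /f -[RHS]h; apply: eq_bigr => i _.
  by rewrite mxE enum_rankK_in.
have f_sum Z : (#|T| < #|Z| + d)%N -> \sum_(Y : {set T} | Y \subset Z) f Y = 0.
  move=> Zd; rewrite /f exchange_big big1//= => i _.
  have [h1 h2 _] := rfP _ (enum_valP i).
  by rewrite -big_distrr/= alt_sum ?mulr0// h2.
(* Values on low sets vanish, and so do the sums over all subsets of a high set; induction on the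
   size gives the rest. *)
have f0 Z : f Z = 0.
  move: {2}#|Z| (leqnn #|Z|) => k; elim: k Z => [|k IH] Z Zk.
    have [/f_low//|/f_sum] := leqP (#|Z| + d) #|T|.
    move: Zk; rewrite leqn0 cards_eq0 => /eqP ->.
    by rewrite (big_pred1 set0)// => Y; rewrite subset0.
  have [/f_low//|/f_sum] := leqP (#|Z| + d) #|T|.
  rewrite (bigD1 Z)//= big1 ?addr0// => Y /andP[YZ nYZ]; apply: IH.
  by rewrite -ltnS; apply: leq_trans Zk; apply: proper_card; rewrite properEneq nYZ.
apply/rowP => i; rewrite mxE; apply/eqP/negPn/negP => vi.
(* At a largest [X] with nonzero coefficient only its own interval contributes, since another one
   containing [X] would have a strictly larger top. *)
pose bad := [pred i : 'I_#|C| | v 0 i != 0].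
have badi : bad i by [].
have [j badj maxj] := @arg_maxnP _ i bad (fun i => #|enum_val i|) badi.
have := f0 (enum_val j); rewrite /f (bigD1 j)//= big1 ?addr0 => [|l lj].
  rewrite /alt subsetDl subxx /= => /eqP; rewrite mulf_eq0 (negbTE badj) /=.
  by rewrite expf_eq0 oppr_eq0 oner_eq0 andbF.
have [->|vl] := eqVneq (v 0 l) 0; first by rewrite mul0r.
rewrite /alt; case: ifP => [/andP[_ jl]|]; last by rewrite mulr0.
have := maxj l vl; rewrite /geq /= leqNgt => /negP[]; apply: proper_card.
by rewrite properEneq jl andbT; apply: contra lj => /eqP/enum_val_inj ->.
Qed.

End Reimer.

Section Levels.
Local Open Scope ring_scope.
Variables (R : realFieldType) (T : finType).
Implicit Types (X : {set T}) (g chi : {set T} -> R).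

Lemma bin_le_mid n r j : (r <= j)%N -> (j + r <= n)%N -> ('C(n, r) <= 'C(n, j))%N.
Proof.
have mid k : (r <= k)%N -> (k.*2 <= n.+1)%N -> ('C(n, r) <= 'C(n, k))%N.
  elim: k => [|k IH]; first by rewrite leqn0 => /eqP ->.
  rewrite leq_eqVlt => /predU1P[->//|rk] kn.
  apply: leq_trans (IH _ _) _ => //; first by rewrite doubleS in kn; lia.
  have := mul_bin_left n k.
  have : (k.+1 <= n - k)%N by rewrite doubleS -addnn in kn; lia.
  by nia.
move=> rj jn; have [h|h] := leqP j.*2 n.+1; first exact: mid.
rewrite -(@bin_sub n j); last by lia.
by apply: mid; rewrite -?addnn in h *; lia.
Qed.

Let lev g (j : nat) : R := \sum_(X : {set T} | #|X| == j) g X.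

(** Double counting of the pairs formed by a set of size [j + 1] and one of its elements. *)
Let lev_step g chi j : (j < #|T|)%N ->
  (forall X x, #|X| = j -> x \notin X -> g (x |: X) <= g X + chi X) ->
  lev g j.+1 *+ j.+1 <= (lev g j + lev chi j) *+ (#|T| - j).
Proof.
move=> jT h.
have -> : lev g j.+1 *+ j.+1 =
    \sum_(X : {set T} | #|X| == j) \sum_(x | x \notin X) g (x |: X).
  rewrite /lev -sumrMnl.
  transitivity (\sum_(X : {set T} | #|X| == j.+1) \sum_(x in X) g X).
    by apply: eq_bigr => X /eqP <-; rewrite sumr_const.
  rewrite pair_big_dep [RHS]pair_big_dep /=.
  rewrite (reindex_onto (fun u : {set T} * T => (u.2 |: u.1, u.2))
     (fun u : {set T} * T => (u.1 :\ u.2, u.2))) /=; last first.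
    by move=> [X x] /= /andP[_ xX]; rewrite setD1K.
  apply: eq_big => [[X x]|[X x] //] /=.
  rewrite setU11 andbT; have [xX|xX] := boolP (x \in X).
    rewrite !andbF; apply/negP => /andP[_ /eqP[E]].
    by move: xX; rewrite -E !inE eqxx.
  by rewrite setU1K// eqxx !andbT cardsU1 xX eqSS.
rewrite /lev -big_split -sumrMnl /=; apply: ler_sum => X /eqP Xj.
apply: (@le_trans _ _ (\sum_(x | x \notin X) (g X + chi X))).
  by apply: ler_sum => x xX; exact: h.
rewrite sumr_const (_ : #|_| = (#|T| - j)%N)//.
by have := cardC X; rewrite Xj => <-; rewrite addKn; apply: eq_card => x; rewrite !inE.
Qed.

(** The average of [g] grows from one level to the next by at most the average of [chi], which is
    normalised by the size of level [r], the smallest of the levels involved. *)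
Let lev_chain g chi r k : (forall X, 0 <= chi X) -> (r + (r + k) <= #|T|)%N ->
  (forall X x, (r <= #|X|)%N -> x \notin X -> g (x |: X) <= g X + chi X) ->
  (lev g (r + k)) / 'C(#|T|, r + k)%:R - (lev g r) / 'C(#|T|, r)%:R <=
  (\sum_(r <= j < r + k) lev chi j) / 'C(#|T|, r)%:R.
Proof.
move=> chi0 + h; elim: k => [|k IH] rk.
  by rewrite !addn0 big_geq// mul0r subrr.
have {}IH := IH (leq_trans (leq_add (leqnn _) (leq_add (leqnn _) (leqnSn _))) rk).
rewrite addnS big_nat_recr ?leq_addr//= mulrDl.
have jT : (r + k < #|T|)%N by lia.
have step := lev_step jT (fun X x Xj => h X x (leq_trans (leq_addr k r) (eq_leq (esym Xj)))).
have c0 i : (i <= #|T|)%N -> 0 < 'C(#|T|, i)%:R :> R by rewrite ltr0n bin_gt0.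
have c1 := c0 _ jT; have c2 := c0 _ (ltnW jT); have c3 : 0 < 'C(#|T|, r)%:R :> R.
  by apply: c0; lia.
have E : (r + k).+1%:R * 'C(#|T|, (r + k).+1)%:R = (#|T| - (r + k))%:R * 'C(#|T|, r + k)%:R :> R.
  by rewrite -!natrM mul_bin_left.
have s1 : lev g (r + k).+1 / 'C(#|T|, (r + k).+1)%:R <=
    (lev g (r + k) + lev chi (r + k)) / 'C(#|T|, r + k)%:R.
  rewrite ler_pdivrMr// mulrAC ler_pdivlMr//.
  have p0 : 0 < (r + k).+1%:R :> R by rewrite ltr0n.
  rewrite -(ler_pM2l p0) [leRHS]mulrCA E [leRHS]mulrCA !mulrA.
  by move: step; rewrite -[X in X <= _]mulr_natl -[X in _ <= X]mulr_natl ler_pM2r.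
have s2 : lev chi (r + k) / 'C(#|T|, r + k)%:R <= lev chi (r + k) / 'C(#|T|, r)%:R.
  apply: ler_wpM2l; first by apply: sumr_ge0.
  rewrite lef_pV2 ?posrE// ler_nat; apply: bin_le_mid; lia.
by rewrite mulrDl in s1; lra.
Qed.

Let level_growth_half g chi r : (forall X, 0 <= chi X) -> (r + r <= #|T|)%N ->
  (forall X x, (r <= #|X|)%N -> x \notin X -> g (x |: X) <= g X + chi X) ->
  \sum_(X : {set T} | #|X| == r) (g (~: X) - g X) <= \sum_(X | #|~: X| != r) chi X.
Proof.
move=> chi0 rT h; pose k := (#|T| - (r + r))%N.
have rk : (r + k)%N = (#|T| - r)%N by rewrite /k; lia.
have := @lev_chain g chi r k chi0 _ h; rewrite rk => /(_ _).
have -> : 'C(#|T|, #|T| - r) = 'C(#|T|, r) by rewrite bin_sub//; lia.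
have c0 : 0 < 'C(#|T|, r)%:R :> R by rewrite ltr0n bin_gt0; lia.
rewrite -mulrBl ler_pM2r ?invr_gt0// => main.
have cC X : #|~: X| = (#|T| - #|X|)%N by rewrite cardsCs setCK.
rewrite sumrB (_ : \sum_(X : {set T} | #|X| == r) g (~: X) = lev g (#|T| - r)%N); last first.
  rewrite (reindex_inj (can_inj (@setCK T))); apply: eq_big => [X|X _]; last by rewrite setCK.
  by rewrite cC; apply/eqP/eqP; have := max_card X; lia.
apply: le_trans (main _) _; first by lia.
rewrite /lev (exchange_big_dep predT)//= [leRHS]big_mkcond /=.
apply: ler_sum => X _; rewrite big_mkcond /=.
have -> : \sum_(r <= j < #|T| - r) (if #|X| == j then chi X else 0) =
    if (r <= #|X| < #|T| - r)%N then chi X else 0.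
  case: ifP => h1.
    rewrite (bigD1_seq #|X|) ?iota_uniq ?mem_index_iota//= eqxx big1 ?addr0//.
    by move=> j /negbTE; rewrite eq_sym => ->.
  rewrite big_nat big1// => j hj; case: eqP => // E; by rewrite E hj in h1.
case: ifP => [/andP[_ h1]|_]; last by case: ifP.
by rewrite ifT// cC; apply/eqP; lia.
Qed.

(* Comparing the levels [r] and [#|T| - r] of the cube through the levels in
   between, each of which is at least as large as level [r]. *)
Lemma level_growth g chi r : (forall X, 0 <= chi X) ->
  (forall X x, (r <= #|X|)%N -> x \notin X -> g (x |: X) <= g X + chi X) ->
  (forall X x, (#|X| <= r)%N -> x \in X -> g (X :\ x) <= g X + chi X) ->
  \sum_(X : {set T} | #|X| == r) (g (~: X) - g X) <= \sum_(X | #|~: X| != r) chi X.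
Proof.
move=> chi0 hup hdown.
have cC X : #|~: X| = (#|T| - #|X|)%N by rewrite cardsCs setCK.
have [rr|rr] := leqP (r + r) #|T|; first exact: level_growth_half.
have [rT|rT] := leqP r #|T|; last first.
  rewrite big1; last by move=> X /eqP E; have := max_card X; lia.
  by apply: sumr_ge0.
(* Above the middle, complementation reduces to the lower half and turns [hdown] into the growth
   hypothesis. *)
pose r' := (#|T| - r)%N.
have := @level_growth_half (fun X => g (~: X)) (fun X => chi (~: X)) r'.
have E (F : {set T} -> R) (P Q : pred {set T}) : (forall X, P X = Q (~: X)) ->
    \sum_(X | P X) F (~: X) = \sum_(X | Q X) F X.
  move=> PQ; rewrite [RHS](reindex_inj (can_inj (@setCK T))).
  by apply: eq_bigl.
rewrite (E chi _ [pred X : {set T} | #|~: X| != r]); last first.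
  by move=> X; rewrite /= setCK cC /r'; congr (~~ _); apply/eqP/eqP; have := max_card X; lia.
have -> : \sum_(X : {set T} | #|X| == r') (g (~: ~: X) - g (~: X)) =
   \sum_(X : {set T} | #|X| == r) (g (~: X) - g X).
  rewrite -(E (fun X => g (~: X) - g X) [pred X : {set T} | #|X| == r']) //=.
  by move=> X; rewrite /= cC /r'; apply/eqP/eqP; have := max_card X; lia.
apply => [//||X x Xr xX]; first by rewrite /r'; lia.
have -> : ~: (x |: X) = (~: X) :\ x by rewrite setCU setIC -setDE.
by apply: hdown; rewrite ?inE// cC /r' in Xr *; have := max_card X; lia.
Qed.

End Levels.

Local Open Scope ring_scope.

(** * Finite product spaces *)

Lemma card_natr (R : pzSemiRingType) (T : finType) (A : {set T}) :
  #|A|%:R = \sum_x (x \in A)%:R :> R.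
Proof.
by rewrite -sum1_card natr_sum big_mkcond; apply: eq_bigr => x _; case: (x \in A).
Qed.

Section ProductSpace.
Variables (R : realFieldType) (V I : finType).
Local Notation Om := {ffun V -> I}.
Implicit Types (p : V -> I -> R) (F H : Om -> R) (om : Om) (v a : V) (u : I).

Definition prob p := (forall v i, 0 <= p v i) /\ (forall v, \sum_i p v i = 1).
Definition Pr p om : R := \prod_v p v (om v).
Definition Ex p F : R := \sum_om Pr p om * F om.
Definition upd om a u : Om := [ffun v => if v == a then u else om v].

Lemma Pr_ge0 p om : prob p -> 0 <= Pr p om.
Proof. by move=> [p0 _]; apply: prodr_ge0. Qed.

Lemma Pr_sum p : prob p -> \sum_om Pr p om = 1.
Proof.
move=> [_ p1]; transitivity (\prod_v \sum_i p v i); last by rewrite big1.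
by rewrite bigA_distr_bigA.
Qed.

Lemma Ex_cst p k : prob p -> Ex p (fun=> k) = k.
Proof. by move=> pp; rewrite /Ex -mulr_suml Pr_sum// mul1r. Qed.

Lemma Ex_le p F H : prob p -> (forall om, F om <= H om) -> Ex p F <= Ex p H.
Proof. by move=> pp FH; apply: ler_sum => om _; apply: ler_wpM2l (FH om); exact: Pr_ge0. Qed.

Lemma Ex_ge0 p F : prob p -> (forall om, 0 <= F om) -> 0 <= Ex p F.
Proof. by move=> pp F0; rewrite -(Ex_cst 0 pp); exact: Ex_le. Qed.

Lemma Ex_gt0 p F : prob p -> (forall om, 0 < F om) -> 0 < Ex p F.
Proof.
move=> pp F0; rewrite lt_def Ex_ge0 ?andbT => [|//|om]; last exact: ltW.
apply: contra_neq (oner_neq0 R) => /psumr_eq0P Ex0; rewrite -(Pr_sum pp) big1// => om _.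
have /eqP := Ex0 (fun om _ => mulr_ge0 (Pr_ge0 om pp) (ltW (F0 om))) om isT.
by rewrite mulf_eq0 [F om == 0]gt_eqF// orbF => /eqP.
Qed.

Lemma eq_Ex p F H : F =1 H -> Ex p F = Ex p H.
Proof. by move=> FH; apply: eq_bigr => om _; rewrite FH. Qed.

Lemma ExD p F H : Ex p (fun om => F om + H om) = Ex p F + Ex p H.
Proof. by rewrite -big_split; apply: eq_bigr => om _; rewrite mulrDr. Qed.

Lemma ExZ p k F : Ex p (fun om => k * F om) = k * Ex p F.
Proof. by rewrite /Ex mulr_sumr; apply: eq_bigr => om _; rewrite mulrCA. Qed.

Lemma ExZr p k F : Ex p (fun om => F om * k) = Ex p F * k.
Proof. by rewrite mulrC -ExZ; apply: eq_Ex => om; rewrite mulrC. Qed.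

Lemma ExN p F : Ex p (fun om => - F om) = - Ex p F.
Proof. by rewrite /Ex -sumrN; apply: eq_bigr => om _; rewrite mulrN. Qed.

Lemma ExB p F H : Ex p (fun om => F om - H om) = Ex p F - Ex p H.
Proof. by rewrite ExD ExN. Qed.

Lemma Ex_sum p (J : finType) (P : pred J) (F : J -> Om -> R) :
  Ex p (fun om => \sum_(j | P j) F j om) = \sum_(j | P j) Ex p (F j).
Proof.
rewrite /Ex exchange_big; apply: eq_bigr => om _; by rewrite mulr_sumr.
Qed.

Lemma updK om a u : upd (upd om a u) a (om a) = om.
Proof. by apply/ffunP => v; rewrite !ffunE; case: eqVneq => // ->. Qed.

Lemma upd_same om a u : upd om a u a = u.
Proof. by rewrite ffunE eqxx. Qed.

Lemma Pr_upd p om a u : p a u * Pr p om = p a (om a) * Pr p (upd om a u).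
Proof.
rewrite /Pr (bigD1 a)//= [in RHS](bigD1 a)//= upd_same mulrCA; congr (_ * (_ * _)).
by apply: eq_bigr => v /negbTE va; rewrite ffunE va.
Qed.

(** Swapping the coordinate at [a] with an independent copy of it is an involution that preserves
    the weights. *)
Lemma Ex_upd p F a : prob p -> Ex p F = \sum_u p a u * Ex p (fun om => F (upd om a u)).
Proof.
move=> [_ p1]; transitivity (\sum_u \sum_om p a u * (Pr p om * F om)).
  rewrite exchange_big; apply: eq_bigr => om _.
  by rewrite -mulr_suml p1 mul1r.
rewrite [RHS](eq_bigr (fun u => \sum_om p a u * (Pr p om * F (upd om a u)))); last first.
  by move=> u _; rewrite mulr_sumr.
rewrite !pair_bigA /=.
have inv : involutive (fun z : I * Om => (z.2 a, upd z.2 a z.1)).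
  by move=> [u om] /=; rewrite upd_same updK.
rewrite (reindex_inj (inv_inj inv)); apply: eq_bigr => -[u om] _ /=.
by rewrite !mulrA -Pr_upd.
Qed.

Lemma Ex_indep p a (h : I -> R) H : prob p -> (forall om u, H (upd om a u) = H om) ->
  Ex p (fun om => h (om a) * H om) = (\sum_u p a u * h u) * Ex p H.
Proof.
move=> pp Ha; rewrite (Ex_upd _ a pp) mulr_suml; apply: eq_bigr => u _.
rewrite -mulrA; congr (_ * _); rewrite -ExZ; apply: eq_Ex => om.
by rewrite upd_same Ha.
Qed.

Section Swap.
Variables (p : V -> I -> R) (xi : V -> pred I).
Hypothesis pp : prob p.

Definition mix (S : {set V}) om om' : Om := [ffun v => if v \in S then om' v else om v].

Definition discord om om' : {set V} := [set v | xi v (om v) != xi v (om' v)].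

Definition hits om : nat := #|[set v | xi v (om v)]|.

Let discord_mix S om om' : discord (mix S om om') (mix S om' om) = discord om om'.
Proof.
by apply/setP => v; rewrite !inE !ffunE; case: ifP => // _; rewrite eq_sym.
Qed.

Let mixK S om om' : mix S (mix S om om') (mix S om' om) = om.
Proof. by apply/ffunP => v; rewrite !ffunE; case: (v \in S). Qed.

Let Pr_mix S om om' : Pr p (mix S om om') * Pr p (mix S om' om) = Pr p om * Pr p om'.
Proof.
rewrite /Pr -!big_split /=; apply: eq_bigr => v _; rewrite !ffunE.
by case: ifP => // _; rewrite mulrC.
Qed.

(** Every exchange of coordinates preserves both the joint law of two independent copies and their
    [discord]. Averaging over the subsets of [discord] accounts for the powers of 2. *)
Let symmetrize (G : Om -> Om -> R) :
  (forall om om', \sum_(S : {set V} | S \subset discord om om')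
     G (mix S om om') (mix S om' om) <= 0) ->
  Ex p (fun om => Ex p (fun om' => G om om')) <= 0.
Proof.
move=> h; pose D (z : Om * Om) := discord z.1 z.2.
pose q (z : Om * Om) := Pr p z.1 * Pr p z.2.
have -> : Ex p (fun om => Ex p (fun om' => G om om')) =
    \sum_z q z / 2 ^+ #|D z| * \sum_(S : {set V} | S \subset D z) G z.1 z.2.
  rewrite /Ex [LHS](eq_bigr (fun om => \sum_om' Pr p om * (Pr p om' * G om om'))).
    rewrite pair_bigA; apply: eq_bigr => -[om om'] _ /=.
    rewrite (eq_bigl (mem (powerset (D (om, om'))))); last by move=> S; rewrite /= inE.
    rewrite sumr_const card_powerset.
    rewrite -[G om om' *+ _]mulr_natr natrX /q /=.
    by field; rewrite expf_neq0// pnatr_eq0.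
  by move=> om _; rewrite mulr_sumr.
rewrite (eq_bigr (fun z => \sum_(S : {set V} | S \subset D z)
    q z / 2 ^+ #|D z| * G z.1 z.2)); last by move=> z _; rewrite mulr_sumr.
rewrite (exchange_big_dep predT)//=.
rewrite (eq_bigr (fun S : {set V} => \sum_(z | S \subset D z)
    q z / 2 ^+ #|D z| * G (mix S z.1 z.2) (mix S z.2 z.1))); last first.
  move=> S _; pose sw (z : Om * Om) := (mix S z.1 z.2, mix S z.2 z.1).
  have inv : involutive sw by move=> [om om']; rewrite /sw /= !mixK.
  rewrite (reindex_inj (inv_inj inv)); apply: eq_big => [z|z _].
    by rewrite /D discord_mix.
  by rewrite /D /q /= discord_mix Pr_mix.
rewrite (exchange_big_dep predT)//=.
apply: sumr_le0 => z _; rewrite -mulr_sumr; apply: mulr_ge0_le0; last exact: h.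
by rewrite divr_ge0 ?exprn_ge0// mulr_ge0// Pr_ge0.
Qed.

(* Exchanging the coordinates at which exactly one of two independent copies
   hits [xi] leaves their joint law invariant. Hence it suffices to average
   over such exchanges, a cube indexed by the hits of the first copy there. *)
Lemma cube_symmetrization (G : Om -> nat -> R) :
  (forall (D : {set V}) (c : {set {v | v \in D}} -> Om) h,
     (forall X, hits (c X) = (h + #|X|)%N) ->
     (forall X t, xi (val t) (c X (val t)) = (t \in X)) ->
     (forall (X Y : {set {v | v \in D}}) v,
        (forall t, val t = v -> (t \in X) = (t \in Y)) -> c X v = c Y v) ->
     \sum_X G (c X) (h + #|~: X|)%N <= 0) ->
  Ex p (fun om => Ex p (fun om' => G om (hits om'))) <= 0.
Proof.
move=> hyp; apply: symmetrize => om om'.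
set D := discord om om'.
pose T : finType := {v | v \in D}.
(* The coordinates to exchange so that, inside [D], the first copy hits exactly at [X], and the
   second then at [~: X]. *)
pose sg (X : {set T}) : {set V} :=
  [set v | if insub v is Some t then ((t : T) \in X) != xi v (om v) else false].
have sgT X (t : T) : (val t \in sg X) = ((t \in X) != xi (val t) (om (val t))).
  by rewrite inE valK.
have sgD X v : v \notin D -> (v \in sg X) = false by move=> vD; rewrite inE insubN.
have Dt (t : T) : xi (val t) (om' (val t)) = ~~ xi (val t) (om (val t)).
  have : val t \in discord om om' by exact: valP.
  rewrite inE.
  by case: (xi _ (om _)); case: (xi _ (om' _)).
have Dn v : v \notin D -> xi v (om' v) = xi v (om v) by rewrite inE negbK => /eqP.
(* Hits outside [D] are common to both copies. *)
pose h := #|[set v in ~: D | xi v (om v)]|.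
have hitsE (om1 : Om) (X : {set T}) : (forall v, v \notin D -> xi v (om1 v) = xi v (om v)) ->
    (forall t : T, xi (val t) (om1 (val t)) = (t \in X)) -> hits om1 = (h + #|X|)%N.
  move=> h1 h2; rewrite /hits -(card_imset X val_inj) -(cardsID D) addnC; congr (_ + _)%N.
    apply: eq_card => v; rewrite in_setD in_set [RHS]in_set in_setC.
    by have [//|/h1 ->] := boolP (v \in D).
  apply: eq_card => v; rewrite in_setI [X in X && _]inE.
  have [vD|vD] := boolP (v \in D).
    rewrite andbT -[v]/(val (exist _ v vD : T)) h2 mem_imset//; exact: val_inj.
  by rewrite andbF; apply/esym/negP => /imsetP[t _ E]; rewrite E (valP t) in vD.
have c1 X (t : T) : xi (val t) (mix (sg X) om om' (val t)) = (t \in X).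
  by rewrite ffunE sgT; case: eqP => [<-//|]; rewrite Dt; case: (xi _ _); case: (t \in X).
have c2 X (t : T) : xi (val t) (mix (sg X) om' om (val t)) = (t \in ~: X).
  rewrite ffunE sgT inE; case: eqP => [->|]; first by rewrite Dt.
  by case: (xi _ _); case: (t \in X).
have := hyp D (fun X => mix (sg X) om om') h.
rewrite (reindex_onto sg (fun S : {set V} =>
    [set t : T | (val t \in S) != xi (val t) (om (val t))])) /=; last first.
  move=> S SD; apply/setP => v; have [vD|vD] := boolP (v \in D).
    rewrite -[v]/(val (exist _ v vD : T)) sgT inE.
    by case: (_ \in S); case: (xi _ _).
  by rewrite sgD//; apply/esym/negbTE; apply: contra vD; move/subsetP: SD; apply.
rewrite (eq_big xpredT (fun X => G (mix (sg X) om om') (h + #|~: X|)%N)); last first.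
- move=> X _; congr (G _ _); apply: hitsE; last exact: c2.
  by move=> v vD; rewrite ffunE sgD// Dn.
- move=> X; apply/andP; split.
    by apply/subsetP => v; apply: contraLR => vD; rewrite sgD.
  apply/eqP/setP => t; rewrite inE sgT.
  by case: (t \in X); case: (xi _ _).
apply => [X|X t|X Y v XY]; first 2 last.
- rewrite !ffunE; congr (if _ then _ else _).
  have [vD|vD] := boolP (v \in D); last by rewrite !sgD.
  by rewrite -[v]/(val (exist _ v vD : T)) !sgT (XY (exist _ v vD)).
- apply: hitsE; last exact: c1.
  by move=> v vD; rewrite ffunE sgD.
- exact: c1.
Qed.

End Swap.

End ProductSpace.

(** * Size bias for degrees above a threshold *)

Section TailDominance.
Variables (R : realFieldType) (phi : R -> R).
Hypothesis phi_mono : {homo phi : x y / x <= y}.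

(** The increments of [phi] along sorted values, each times the indicator of an upper tail: Abel
    summation. *)
Let Fixpoint tele (v : R) (l : seq R) (y : R) {struct l} : R :=
  if l is v' :: l' then (phi v' - phi v) * (v < y)%R%:R + tele v' l' y else 0.

Let tele_le v l y : path <%R v l -> y <= v -> tele v l y = 0.
Proof.
elim: l v => //= v' l IH v /andP[vv' pl] yv.
by rewrite ltNge yv mulr0 add0r IH// (le_trans yv)// ltW.
Qed.

Let tele_mem v l y : path <%R v l -> y \in v :: l -> phi y = phi v + tele v l y.
Proof.
elim: l v => [|v' l IH] v /=; first by rewrite inE => _ /eqP ->; rewrite addr0.
move=> /andP[vv' pl]; rewrite inE => /predU1P[->|yl].
  by rewrite ltxx mulr0 add0r tele_le ?addr0// ltW.
have vy : v < y.
  move: yl; rewrite inE => /predU1P[->//|yl].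
  by apply: lt_trans vv' _; have /allP := order_path_min lt_trans pl; apply.
by rewrite vy mulr1 addrA subrKC; exact: IH.
Qed.

Lemma tail_dominance (J : finType) (w x : J -> R) : \sum_j w j = 0 ->
  (forall s, \sum_(j | s < x j) w j <= 0) -> \sum_j w j * phi (x j) <= 0.
Proof.
move=> w0 ws; pose vs := sort <=%R (undup (codom x)).
have mem_vs j : x j \in vs by rewrite mem_sort mem_undup codom_f.
have : sorted <%R vs by rewrite sort_lt_sorted undup_uniq.
case: vs mem_vs => [|v l] mem_vs /= pl.
  by rewrite big1// => j _; have := mem_vs j; rewrite in_nil.
rewrite (eq_bigr (fun j => w j * phi v + w j * tele v l (x j))); last first.
  by move=> j _; rewrite (tele_mem pl (mem_vs j)) mulrDr.
rewrite big_split /= -mulr_suml w0 mul0r add0r {mem_vs}.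
elim: l v pl => [|v' l IH] v /=; first by rewrite big1// => j _; rewrite mulr0.
move=> /andP[vv' /IH le].
rewrite (eq_bigr (fun j => (phi v' - phi v) * (if v < x j then w j else 0)
   + w j * tele v' l (x j))); last first.
  by move=> j _; rewrite mulrDr mulrCA; case: ifP; rewrite ?mulr1 ?mulr0.
rewrite big_split /= -mulr_sumr -big_mkcond -[leRHS]addr0 lerD//.
by rewrite mulr_ge0_le0// subr_ge0 phi_mono// ltW.
Qed.

End TailDominance.

Section Config.
Variables (R : realFieldType) (V I : finType) (adj : rel I).
Local Notation Om := {ffun V -> I}.
Implicit Types (om : Om) (a b v : V) (u : I).

Definition gr om : rel V := fun a b => (a != b) && adj (om a) (om b).
Definition deg om a : nat := #|nbr (gr om) setT a|.

Lemma gr_irr om : irreflexive (gr om).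
Proof. by move=> a; rewrite /gr eqxx. Qed.

Lemma gr_sym om : symmetric adj -> symmetric (gr om).
Proof. by move=> s a b; rewrite /gr eq_sym s. Qed.

(** With [a] held at [u], its degree is the number of hits of this predicate, hence a sum of
    independent indicators. *)
Definition nearby a u v (i : I) := (v != a) && adj u i.

Lemma nbr_upd om a u : nbr (gr (upd om a u)) setT a = [set v | nearby a u v (om v)].
Proof.
apply/setP => v; rewrite !inE /= /gr /nearby eq_sym upd_same.
by have [//|va] := eqVneq v a; rewrite ffunE (negbTE va).
Qed.

Lemma deg_upd om a u : deg (upd om a u) a = hits (nearby a u) om.
Proof. by rewrite /deg nbr_upd. Qed.

End Config.

Section AtLeast.
Variables (R : realFieldType) (V I : finType) (adj : rel I) (p : V -> I -> R).
Variables (k D sig : nat) (d : V -> nat) (w : V -> R) (wm : R).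
Local Notation Om := {ffun V -> I}.
Implicit Types (om : Om) (a b v : V) (u : I).
Hypotheses (pp : prob p) (adj_sym : symmetric adj).
Hypothesis sf : forall om, starfree (gr adj om) k.
Hypotheses (k2 : (1 < k)%N) (d0 : forall v, (0 < d v)%N) (dD : forall v, (d v <= D)%N).
Hypothesis Dsig : (D <= sig)%N.
Hypothesis sigP : forall J : {set V}, (#|J| <= k)%N -> (\sum_(x in J) d x <= sig)%N.
Hypothesis w0 : forall v, 0 <= w v <= wm.

Let c : R := wm * (D * sig.+1)%:R.

Definition Yge om : R := \sum_v w v * (d v <= deg adj om v)%N%:R.

(** A vertex of [X] that reaches its threshold inside [X] still does so in [om'], where further
    neighbors only help. *)
Let Yge_move om om' (X : {set V}) : (forall v, v \in X -> om v = om' v) ->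
  Yge om <= Yge om' + wm * (loss (gr adj om) d setT X)%:R.
Proof.
move=> E; rewrite /loss -sum1_card natr_sum mulr_sumr big_mkcond -big_split /=.
apply: ler_sum => v _; have /andP[wv wvm] := w0 v.
set s := (v \in _).
have : (d v <= deg adj om v)%N -> ~~ s -> (d v <= deg adj om' v)%N.
  rewrite /s in_setD negb_and negbK /sat [X in _ || ~~ X]in_set in_setT /= => dv.
  rewrite /deg in dv; rewrite dv orbF.
  rewrite inE => /andP[vX /leq_trans]; apply; apply: subset_leq_card.
  apply/subsetP => x; rewrite !inE /gr => /andP[xX /andP[vx]].
  by rewrite !E// vx.
have w1 : 0 <= wm by apply: le_trans wvm.
case: (d v <= deg adj om v)%N => [/(_ isT)|_]; last first.
  by rewrite mulr0; apply: addr_ge0; [apply: mulr_ge0|case: s; rewrite ?mulr0 ?mulr1].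
case: s => [_|/(_ isT) ->]; last by rewrite mulr1 addr0.
by rewrite !mulr1 -[leLHS]add0r lerD// mulr_ge0.
Qed.

(** Size bias for upper tails. The positions [u] and [u0] are unrelated, because [a] is deleted
    together with its witness. On each cube of exchanges this is [disjoint_occurrence], where the
    [d a] hits pass to the second copy. *)
Let Ex_tail a u u0 s :
  Ex p (fun om => (d a <= deg adj (upd om a u) a)%N%:R * (c + s < Yge (upd om a u))%R%:R) <=
  Ex p (fun om => (d a <= deg adj (upd om a u) a)%N%:R) *
  Ex p (fun om => (s < Yge (upd om a u0))%R%:R).
Proof.
pose A (j : nat) : R := (d a <= j)%N%:R.
pose G om (j : nat) := A (deg adj (upd om a u) a) * (c + s < Yge (upd om a u))%R%:R
  - A j * (s < Yge (upd om a u0))%R%:R.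
have := @cube_symmetrization R V I p (nearby adj a u) pp G.
rewrite (@eq_Ex _ _ _ p _ (fun om => A (deg adj (upd om a u) a) * (c + s < Yge (upd om a u))%R%:R
   - Ex p (fun om => A (deg adj (upd om a u) a)) * (s < Yge (upd om a u0))%R%:R)); last first.
  move=> om; rewrite /G ExB Ex_cst// ExZr; congr (_ - _ * _).
  by apply: eq_Ex => om'; rewrite deg_upd.
rewrite ExB ExZ subr_le0; apply => Ds cf h H1 H2 H3; rewrite /G sumrB subr_le0.
pose T : finType := {v | v \in Ds}.
pose B := [set Z : {set T} | s < Yge (upd (cf Z) a u0)].
pose C := [set X : {set T} | (d a <= h + #|X|)%N && (c + s < Yge (upd (cf X) a u))].
have -> : \sum_X A (deg adj (upd (cf X) a u) a) * (c + s < Yge (upd (cf X) a u))%R%:R =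
    #|C|%:R :> R.
  rewrite card_natr; apply: eq_bigr => X _.
  by rewrite inE deg_upd H1 /A; case: (_ <= _)%N; rewrite ?mul0r// mul1r; case: (_ < _).
apply: (@le_trans _ _ (#|[set Z in B | (#|Z| + (d a - h) <= #|{: T}|)%N]|%:R)); last first.
  rewrite card_natr; apply: ler_sum => X _.
  rewrite !inE; case: (_ < _); rewrite ?mulr0 ?mulr1//= /A.
  rewrite ler_nat; case: (leqP (#|X| + (d a - h))) => //= le.
  rewrite (_ : (d a <= _)%N = true)//.
  by move: le; rewrite -(cardsC X) leq_add2l leq_subLR.
rewrite ler_nat; apply: disjoint_occurrence => X; rewrite inE => /andP[dX YX].
set e := gr adj (upd (cf X) a u).
have dN : (d a <= #|nbr e setT a|)%N.
  by have := deg_upd adj (cf X) a u; rewrite /deg -/e => ->; rewrite H1.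
have [RR [RN cR lossR]] := @cheap_witness V e k d D sig (gr_sym _ adj_sym)
  (gr_irr _ _) (@sf _) k2 d0 dD Dsig sigP a dN.
pose RT := [set t : T | val t \in RR].
have Nval (t : T) : (val t \in nbr e setT a) = (t \in X).
  by rewrite /e nbr_upd inE H2.
have RTX : RT \subset X.
  by apply/subsetP => t; rewrite inE => /(subsetP RN); rewrite Nval.
(* Only [h] neighbors of [a] are outside the cube, so at least [d a - h] members of the witness are
   inside. *)
have : (d a - h <= #|RT|)%N.
  rewrite leq_subLR -cR -(cardsID (val @: RT) RR) addnC; apply: leq_add; last first.
    by rewrite -(card_imset RT val_inj) subset_leq_card// subsetIr.
  have <- : #|nbr e setT a :\: (val @: X)| = h.
    rewrite cardsD (setIidPr _) ?(card_imset X val_inj).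
      by have := H1 X; rewrite /hits -nbr_upd -/e => ->; rewrite addnK.
    by apply/subsetP => v /imsetP[t tX ->]; rewrite Nval.
  apply/subset_leq_card/subsetP => v; rewrite !in_setD => /andP[vRT vR].
  rewrite (subsetP RN)// andbT; apply: contra vRT => /imsetP[t tX vE].
  by apply/imsetP; exists t => //; rewrite inE -vE.
case/subset_card => R' R'RT cR'; exists R'; split => //.
  exact: subset_trans RTX.
move=> Z XZ ZX; rewrite inE.
have := @Yge_move (upd (cf X) a u) (upd (cf Z) a u0) (~: (a |: RR)) _.
have w1 : 0 <= wm by have /andP[/le_trans] := w0 a; apply.
have : wm * (loss e d setT (~: (a |: RR)))%:R <= c by rewrite ler_wpM2l// ler_nat.
rewrite -/e => l1 /(_ _) l2.
have {}l2 : Yge (upd (cf X) a u) <= Yge (upd (cf Z) a u0) + wm * (loss e d setT (~: (a |: RR)))%:R.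
  apply: l2 => v; rewrite in_setC in_setU1 negb_or => /andP[va vR].
  rewrite !ffunE (negbTE va); apply: H3 => t tv.
  apply/idP/idP => [tX|/(subsetP ZX)//].
  apply: (subsetP XZ); rewrite inE tX andbT; apply: contra vR => /(subsetP R'RT).
  by rewrite inE tv.
by move: YX l1 l2; lra.
Qed.

(** The tail bounds express stochastic dominance. [tail_dominance] is applied to two disjoint copies
    of the configurations, weighted with opposite signs and equal mass. *)
Let Ex_phi_cond phi a u u0 : {homo phi : x y / x <= y} ->
  Ex p (fun om => (d a <= deg adj (upd om a u) a)%N%:R * phi (Yge (upd om a u) - c)) <=
  Ex p (fun om => (d a <= deg adj (upd om a u) a)%N%:R) *
  Ex p (fun om => phi (Yge (upd om a u0))).
Proof.
move=> phi_mono; pose A om : R := (d a <= deg adj (upd om a u) a)%N%:R.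
pose wt (z : Om + Om) := match z with
  | inl om => Pr p om * A om | inr om => - (Ex p A * Pr p om) end.
pose x (z : Om + Om) := match z with
  | inl om => Yge (upd om a u) - c | inr om => Yge (upd om a u0) end.
have := @tail_dominance R phi phi_mono _ wt x.
rewrite !big_sumType /= !sumrN -mulr_sumr.
have -> : \sum_om Pr p om = 1.
  exact: Pr_sum.
rewrite mulr1 subrr => /(_ erefl) main.
rewrite -subr_le0; have -> : Ex p (fun om => A om * phi (Yge (upd om a u) - c)) -
    Ex p A * Ex p (fun om => phi (Yge (upd om a u0))) =
  \sum_(om : Om) Pr p om * A om * phi (Yge (upd om a u) - c) +
  \sum_(om : Om) - (Ex p A * Pr p om) * phi (Yge (upd om a u0)).
  rewrite /Ex mulr_sumr -sumrN; congr (_ + _); apply: eq_bigr => om _; ring.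
apply: main => s; rewrite big_mkcond big_sumType /=.
have := Ex_tail a u u0 s; rewrite -subr_le0; congr (_ <= _).
rewrite /Ex mulr_sumr -sumrN; congr (_ + _); apply: eq_bigr => om _.
  rewrite ltrBrDl; case: ifP; rewrite ?mulr1 ?mulr0// -/(A om) ?mulr0//.
by case: ifP; rewrite ?mulr1 ?mulr0 ?oppr0.
Qed.

Lemma Ex_ge_bias phi a : {homo phi : x y / x <= y} ->
  Ex p (fun om => (d a <= deg adj om a)%N%:R * phi (Yge om - c)) <=
  Ex p (fun om => (d a <= deg adj om a)%N%:R) * Ex p (fun om => phi (Yge om)).
Proof.
move=> phi_mono; have [p0 p1] := pp.
have step u : Ex p (fun om => (d a <= deg adj (upd om a u) a)%N%:R * phi (Yge (upd om a u) - c)) <=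
    Ex p (fun om => (d a <= deg adj (upd om a u) a)%N%:R) * Ex p (fun om => phi (Yge om)).
  rewrite (Ex_upd (fun om => phi (Yge om)) a pp) mulr_sumr.
  set lhs := Ex _ _; rewrite -[leLHS]mul1r -{1}(p1 a) mulr_suml.
  by apply: ler_sum => u0 _; rewrite mulrCA ler_wpM2l// Ex_phi_cond.
rewrite (Ex_upd _ a pp) [X in _ <= X * _](Ex_upd _ a pp) mulr_suml.
by apply: ler_sum => u _; rewrite -mulrA ler_wpM2l.
Qed.

Lemma Ex_Yge_bias phi : {homo phi : x y / x <= y} ->
  Ex p (fun om => Yge om * phi (Yge om - c)) <= Ex p Yge * Ex p (fun om => phi (Yge om)).
Proof.
move=> phi_mono.
rewrite (@eq_Ex _ _ _ p _ (fun om => \sum_v w v * ((d v <= deg adj om v)%N%:R * phi (Yge om - c)))).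
  rewrite Ex_sum (@eq_Ex _ _ _ p Yge (fun om => \sum_v w v * (d v <= deg adj om v)%N%:R))//.
  rewrite Ex_sum mulr_suml; apply: ler_sum => v _.
  rewrite !ExZ -mulrA ler_wpM2l ?Ex_ge_bias//.
  by have /andP[] := w0 v.
by move=> om; rewrite {1}/Yge mulr_suml; apply: eq_bigr => v _; rewrite mulrA.
Qed.

End AtLeast.

(** * Degrees that differ from a given value *)

Section NotEqual.
Variables (R : realFieldType) (V I : finType) (adj : rel I) (p : V -> I -> R).
Variables (k sig sig1 : nat) (d : V -> nat) (w : V -> R) (wm : R).
Local Notation Om := {ffun V -> I}.
Implicit Types (om : Om) (a b v : V) (u : I).
Hypotheses (pp : prob p) (adj_sym : symmetric adj).
Hypothesis sf : forall om, starfree (gr adj om) k.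
Hypotheses (k2 : (1 < k)%N) (dnz : exists v, (0 < d v)%N).
Hypothesis sigP : forall J : {set V}, (#|J| <= k)%N -> (\sum_(x in J) d x <= sig)%N.
Hypothesis sigP1 : forall J : {set V}, (#|J| <= k)%N -> (\sum_(x in J) (d x).+1 <= sig1)%N.
Hypothesis w0 : forall v, 0 <= w v <= wm.

Definition ne_at om v : R := (deg adj om v != d v)%:R.
Definition Yne om : R := \sum_v w v * ne_at om v.
Definition Yne_off a om : R := \sum_(v | v != a) w v * ne_at om v.
(** The probability that the indicator of [a] is 1, given that [a] is at [u]. *)
Definition delta a u : R := Ex p (fun om => ne_at (upd om a u) a).

Lemma ne_at_itv om v : 0 <= ne_at om v <= 1.
Proof. by rewrite /ne_at ler0n lern1 leq_b1. Qed.

Lemma delta_itv a u : 0 <= delta a u <= 1.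
Proof using pp.
apply/andP; split.
  by apply: Ex_ge0 => // om; have /andP[] := ne_at_itv (upd om a u) a.
rewrite -(Ex_cst 1 pp); apply: Ex_le => // om.
by have /andP[] := ne_at_itv (upd om a u) a.
Qed.

Lemma Yne_split a om : Yne om = w a * ne_at om a + Yne_off a om.
Proof. by rewrite /Yne (bigD1 a). Qed.

Definition off b om om' := forall v, v != b -> om v = om' v.

(* Changing the position of [b] so that the degree of [a] moves away from
   [d a]. *)
Definition outward a om om' b := a != b /\
  (gr adj om' a b \/ gr adj om a b /\ (deg adj om a <= d a)%N).

Lemma Yne_off_outward a b om om' : off b om om' -> outward a om om' b ->
  Yne_off a om' <= Yne_off a om + wm * (sig + sig1).-1%:R.
Proof using adj_sym sf k2 dnz sigP sigP1 w0.
clear pp.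
move=> oo [ab out]; pose N := newly (gr adj om) (gr adj om') d a.
have ee' x y : x != b -> y != b -> gr adj om x y = gr adj om' x y.
  by move=> xb yb; rewrite /gr !oo.
have Nle : (#|N| <= (sig + sig1).-1)%N.
  have symm := @gr_sym V I adj ^~ adj_sym; have irr := @gr_irr V I adj.
  have : (#|N| < sig + sig1)%N.
    case: out => [o|[o1 o2]].
      by apply: (@newly_arrival _ _ _ k d sig sig1 a b) => //; exact: sf.
    by apply: (@newly_departure _ _ _ k d sig sig1 a b) => //; exact: sf.
  by case: (sig + sig1)%N.
have w1 : 0 <= wm by have /andP[/le_trans] := w0 a; apply.
apply: (@le_trans _ _ (Yne_off a om + wm * #|N|%:R)); last first.
  by rewrite lerD2l ler_wpM2l// ler_nat.
rewrite card_natr mulr_sumr /Yne_off (bigID (fun v => v != a) xpredT) /= addrA -big_split.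
rewrite -[leLHS]addr0; apply: lerD; last first.
  by apply: sumr_ge0 => v _; apply: mulr_ge0.
apply: ler_sum => v va; have /andP[wv wvm] := w0 v.
rewrite /N /newly inE in_setC1 va /= /ne_at -/(deg adj om v) -/(deg adj om' v).
case: (deg adj om' v != d v); last first.
  rewrite andbF mulr0 ?mulr0 addr0; by rewrite mulr_ge0.
by rewrite andbT; case: (deg adj om v == d v); rewrite ?mulr0 ?mulr1 ?add0r ?addr0.
Qed.

Lemma Ex_ne_at (g : Om -> R) a :
  Ex p (fun om => ne_at om a * g om) =
  \sum_u p a u * Ex p (fun om => ne_at (upd om a u) a * g (upd om a u)).
Proof using pp. exact: Ex_upd. Qed.

Lemma Ex_ne_atE a : Ex p (fun om => ne_at om a) = \sum_u p a u * delta a u.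
Proof using pp. exact: Ex_upd. Qed.

Lemma Ex_coord (h : I -> R) a : Ex p (fun om => h (om a)) = \sum_u p a u * h u.
Proof using pp.
rewrite -[RHS]mulr1 -(Ex_cst 1 pp) -Ex_indep//.
by apply: eq_Ex => om; rewrite mulr1.
Qed.

(** Degree [d a] in the first or in the second of two copies singles out two opposite levels of the
    exchange cube. Passing from the first level to the second takes outward moves only, each raising
    [g] by at most [chi], so [level_growth] applies. *)
Lemma Ex_static (a : V) u (g chi : Om -> R) : (forall om, 0 <= chi om) ->
  (forall om om' b, off b om om' -> outward a (upd om a u) (upd om' a u) b ->
    g om' <= g om + chi om) ->
  Ex p (fun om => ne_at (upd om a u) a * g om) <= delta a u * (Ex p g + Ex p chi).
Proof using pp.
clear k2 dnz sigP sigP1 sf adj_sym w0.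
move=> chi0 gchi.
pose eqd (j : nat) : R := (j == d a)%:R.
pose ned (j : nat) : R := (j != d a)%:R.
have nedE j : ned j = 1 - eqd j by rewrite /ned /eqd; case: eqP => _; rewrite ?subrr ?subr0.
(* Its mean over two independent copies is the left side minus the right side of the claim. *)
pose G om (j : nat) := eqd j * g om - eqd (deg adj (upd om a u) a) * g om - ned j * chi om.
have := @cube_symmetrization R V I p (nearby adj a u) pp G.
have -> : Ex p (fun om => Ex p (fun om' => G om (hits (nearby adj a u) om'))) =
    Ex p (fun om => ne_at (upd om a u) a * g om) - delta a u * (Ex p g + Ex p chi).
  have -> : Ex p (fun om => ne_at (upd om a u) a * g om) =
      Ex p g - Ex p (fun om => eqd (deg adj (upd om a u) a) * g om).
    rewrite -ExB; apply: eq_Ex => om; rewrite /ne_at -/(ned _) nedE.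
    by rewrite mulrBl mul1r.
  have Eeq : Ex p (fun om => eqd (hits (nearby adj a u) om)) = 1 - delta a u.
    rewrite /delta -[1 in RHS](Ex_cst 1 pp) -ExB; apply: eq_Ex => om.
    by rewrite /ne_at -/(ned _) nedE deg_upd; ring.
  have -> : Ex p (fun om => Ex p (fun om' => G om (hits (nearby adj a u) om'))) =
    Ex p (fun om => (1 - delta a u) * g om - eqd (deg adj (upd om a u) a) * g om
       - delta a u * chi om).
    apply: eq_Ex => om; rewrite /G !ExB Ex_cst// !ExZr Eeq.
    congr (_ - _ * _); rewrite /delta; apply: eq_Ex => om'.
    by rewrite /ne_at deg_upd.
  by rewrite !ExB !ExZ; ring.
rewrite subr_le0; apply => Ds c h H1 H2 H3.
pose T : finType := {v | v \in Ds}.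
rewrite /G !sumrB.
have Edeg X : deg adj (upd (c X) a u) a = (h + #|X|)%N by rewrite deg_upd H1.
(* If the common hits alone exceed [d a], degree [d a] does not occur on the cube. *)
have [dh|dh] := ltnP (d a) h.
  rewrite [X in X - _ - _]big1 => [|X _]; last first.
    by rewrite /eqd (_ : (_ == _) = false) ?mul0r//; apply/eqP; lia.
  rewrite [X in _ - X - _]big1 => [|X _]; last first.
    by rewrite /eqd Edeg (_ : (_ == _) = false) ?mul0r//; apply/eqP; lia.
  rewrite subr0 sub0r oppr_le0; apply: sumr_ge0 => X _.
  by rewrite mulr_ge0// /ned ler0n.
pose r := (d a - h)%N.
have dE (j : nat) : (h + j == d a)%N = (j == r) by rewrite /r; apply/eqP/eqP; lia.
have E1 : \sum_X eqd (h + #|~: X|) * g (c X) = \sum_(X : {set T} | #|X| == r) g (c (~: X)).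
  rewrite (reindex_inj (can_inj (@setCK T))) [RHS]big_mkcond; apply: eq_bigr => X _.
  by rewrite setCK /eqd dE; case: ifP; rewrite ?mul1r ?mul0r.
have E2 : \sum_X eqd (deg adj (upd (c X) a u) a) * g (c X) =
    \sum_(X : {set T} | #|X| == r) g (c X).
  rewrite [RHS]big_mkcond; apply: eq_bigr => X _.
  by rewrite Edeg /eqd dE; case: ifP; rewrite ?mul1r ?mul0r.
have E3 : \sum_X ned (h + #|~: X|) * chi (c X) =
    \sum_(X : {set T} | #|~: X| != r) chi (c X).
  rewrite [RHS]big_mkcond; apply: eq_bigr => X _.
  by rewrite /ned dE; case: ifP; rewrite ?mul1r ?mul0r.
rewrite E1 E2 E3 -sumrB subr_le0.
have offc (X Y : {set T}) t : (forall s, s != t -> (s \in X) = (s \in Y)) ->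
    off (val t) (c X) (c Y).
  move=> XY v vt; apply: H3 => s sv; apply: XY.
  by apply: contra vt => /eqP <-; rewrite sv.
have upd_gr (X : {set T}) (t : T) : t \in X -> a != val t /\ gr adj (upd (c X) a u) a (val t).
  move=> tX; have := H2 X t; rewrite tX /nearby => /andP[ta tn].
  by rewrite /gr upd_same ffunE (negbTE ta) eq_sym ta.
apply: level_growth => [X|X t rX tX|X t Xr tX]; first exact: chi0.
- apply: (gchi _ _ (val t)).
    by apply: offc => s st; rewrite in_setU1 (negbTE st).
  have [a1 a2] := upd_gr (t |: X) t (setU11 _ _).
  by split => //; left.
- apply: (gchi _ _ (val t)).
    by apply: offc => s st; rewrite in_setD1 st.
  have [a1 a2] := upd_gr X t tX.
  split => //; right; split => //; by rewrite Edeg -(subnKC dh) leq_add2l.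
Qed.

(** Growth by a factor at most [K] is growth by at most [(K - 1) e]. *)
Lemma Ex_static_up a u (e : Om -> R) K : 1 <= K -> (forall om, 0 <= e om) ->
  (forall om om' b, off b om om' -> outward a (upd om a u) (upd om' a u) b ->
    e om' <= K * e om) ->
  Ex p (fun om => ne_at (upd om a u) a * e om) <= delta a u * (K * Ex p e).
Proof using pp.
move=> K1 e0 h; have := @Ex_static a u e (fun om => (K - 1) * e om).
rewrite ExZ (_ : Ex p e + (K - 1) * Ex p e = K * Ex p e); last by ring.
apply => [om|om om' b o1 o2]; first by rewrite mulr_ge0 ?subr_ge0.
by have := h _ _ _ o1 o2; lra.
Qed.

Lemma Ex_static_down a u (e : Om -> R) K : K <= 1 -> (forall om, 0 <= e om) ->
  (forall om om' b, off b om om' -> outward a (upd om a u) (upd om' a u) b ->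
    K * e om <= e om') ->
  delta a u * (K * Ex p e) <= Ex p (fun om => ne_at (upd om a u) a * e om).
Proof using pp.
move=> K1 e0 h; have := @Ex_static a u (fun om => - e om) (fun om => (1 - K) * e om).
rewrite ExZ ExN (_ : - Ex p e + (1 - K) * Ex p e = - (K * Ex p e)); last by ring.
rewrite (@eq_Ex _ _ _ p _ (fun om => - (ne_at (upd om a u) a * e om))); last first.
  by move=> om; rewrite mulrN.
rewrite ExN mulrN lerN2; apply => [om|om om' b o1 o2].
  by rewrite mulr_ge0 ?subr_ge0.
by have := h _ _ _ o1 o2; lra.
Qed.

Lemma off_upd b om om' a u : off b om om' -> off b (upd om a u) (upd om' a u).
Proof. by move=> oo v vb; rewrite !ffunE; case: eqP => // _; exact: oo. Qed.

(* The influence of all the other coordinates on one indicator is controlled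
   by a single application of [Ex_static] to an additive function. *)
Lemma cov_Yne_le (h : V -> I -> R) B : 0 <= B ->
  (forall a u, 0 <= h a u) -> (forall a u, w a * h a u <= B) ->
  \sum_a w a * (Ex p (fun om => h a (om a) * Yne om) -
                Ex p (fun om => h a (om a)) * Ex p Yne) <=
  wm * (\sum_a w a * (\sum_u p a u * (h a u * delta a u))) + B * Ex p Yne.
Proof using pp w0.
clear k2 dnz sigP sigP1 sf adj_sym.
move=> B0 h0 hB; have [p0 p1] := pp.
pose cv a g := Ex p (fun om => h a (om a) * ne_at om g) -
   Ex p (fun om => h a (om a)) * Ex p (fun om => ne_at om g).
have ExY : Ex p Yne = \sum_g w g * Ex p (fun om => ne_at om g).
  by rewrite Ex_sum; apply: eq_bigr => g _; rewrite ExZ.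
have cE a : Ex p (fun om => h a (om a) * Yne om) - Ex p (fun om => h a (om a)) * Ex p Yne =
    \sum_g w g * cv a g.
  rewrite (@eq_Ex _ _ _ p _ (fun om => \sum_g w g * (h a (om a) * ne_at om g))).
    rewrite Ex_sum ExY mulr_sumr -sumrB; apply: eq_bigr => g _.
    by rewrite ExZ /cv; ring.
  by move=> om; rewrite mulr_sumr; apply: eq_bigr => g _; rewrite mulrCA.
rewrite (eq_bigr (fun a => w a * (w a * cv a a) + \sum_(g | g != a) w a * (w g * cv a g))); last first.
  by move=> a _; rewrite cE (bigD1 a)//= mulrDr mulr_sumr.
rewrite big_split /=; apply: lerD.
  rewrite mulr_sumr; apply: ler_sum => a _; have /andP[wa wam] := w0 a.
  have h1 : cv a a <= \sum_u p a u * (h a u * delta a u).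
    rewrite /cv; set x := Ex _ _; set y := _ * _.
    have y0 : 0 <= y.
      by apply: mulr_ge0; apply: Ex_ge0 => // om; have /andP[] := ne_at_itv om a.
    have -> : \sum_u p a u * (h a u * delta a u) = x.
      rewrite /x (Ex_upd _ a pp); apply: eq_bigr => u _; congr (_ * _).
      by rewrite -ExZ; apply: eq_Ex => om; rewrite upd_same.
    by rewrite gerBl.
  have h2 : 0 <= \sum_u p a u * (h a u * delta a u).
    apply: sumr_ge0 => u _; rewrite mulr_ge0// mulr_ge0//.
    by have /andP[] := delta_itv a u.
  rewrite [leRHS]mulrCA; apply: ler_wpM2l => //.
  by apply: le_trans (ler_wpM2l wa h1) _; exact: ler_wpM2r.
rewrite (exchange_big_dep predT)//= ExY mulr_sumr; apply: ler_sum => g _.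
have /andP[wg _] := w0 g.
rewrite (eq_bigr (fun a => w g * (w a * cv a g))); last by move=> a _; rewrite mulrCA.
rewrite -mulr_sumr mulrCA; apply: ler_wpM2l => //.
(* All influences on the indicator of [g] are collected in [N], which one move raises by at most
   [B]: a single nonnegative term, bounded by [B], changes. *)
pose N om : R := \sum_(a | g != a) w a * h a (om a).
have -> : \sum_(a | g != a) w a * cv a g =
    Ex p (fun om => ne_at om g * N om) - Ex p N * Ex p (fun om => ne_at om g).
  rewrite (@eq_Ex _ _ _ p _ (fun om => \sum_(a | g != a) w a * (h a (om a) * ne_at om g))).
    rewrite !Ex_sum mulr_suml -sumrB; apply: eq_bigr => a _.
    by rewrite !ExZ /cv; ring.
  by move=> om; rewrite mulr_sumr; apply: eq_bigr => a _; rewrite mulrCA [_ * h _ _]mulrC.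
have Nupd om u : N (upd om g u) = N om.
  by apply: eq_bigr => a ga; rewrite ffunE eq_sym (negbTE ga).
have step u : Ex p (fun om => ne_at (upd om g u) g * N om) <= delta g u * (Ex p N + B).
  have := @Ex_static g u N (fun=> B); rewrite Ex_cst//; apply => // om om' b oo [gb _].
  rewrite /N (bigD1 b)//= [X in _ <= X + _](bigD1 b)//=.
  rewrite (eq_bigr (fun a => w a * h a (om a))); last by move=> v /andP[_ vb]; rewrite oo.
  have := hB b (om' b); have : 0 <= w b * h b (om b).
    by rewrite mulr_ge0//; have /andP[] := w0 b.
  lra.
rewrite Ex_ne_at lerBlDr (_ : _ + _ = \sum_u p g u * (delta g u * (Ex p N + B))); last first.
  by rewrite Ex_ne_atE -mulrDl addrC mulrC mulr_suml; apply: eq_bigr => u _; rewrite mulrA.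
apply: ler_sum => u _; apply: ler_wpM2l => //.
rewrite (@eq_Ex _ _ _ p _ (fun om => ne_at (upd om g u) g * N om)) ?step//.
by move=> om; rewrite Nupd.
Qed.

End NotEqual.

From mathcomp Require Import all_classical all_reals all_analysis measurable_realfun.
Import numFieldNormedType.Exports.

(** * Tilted means *)

Section Scalars.
Variable R : realFieldType.
Implicit Types (x y z t : R) (n : nat).

Lemma geom_sum_le_top y n : 1 <= y -> \sum_(i < n.+2) y ^+ i <= n.+2%:R * y ^+ n.+1.
Proof.
move=> y1; apply: (@le_trans _ _ (\sum_(i < n.+2) y ^+ n.+1)).
  by apply: ler_sum => i _; rewrite ler_weXn2l// -ltnS.
by rewrite sumr_const card_ord mulr_natl.
Qed.

Lemma geom_sum_le_mean y n : 1 <= y ->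
  2 * \sum_(i < n.+2) y ^+ i <= n.+2%:R * (y ^+ n.+1 + y ^+ n).
Proof.
move=> y1; have h : \sum_(i < n.+1) y ^+ i <= n.+1%:R * y ^+ n.
  apply: (@le_trans _ _ (\sum_(i < n.+1) y ^+ n)).
    by apply: ler_sum => i _; rewrite ler_weXn2l// -ltnS.
  by rewrite sumr_const card_ord mulr_natl.
have yn : y ^+ n <= y ^+ n.+1 by rewrite ler_weXn2l.
have : n%:R * y ^+ n <= n%:R * y ^+ n.+1 by rewrite ler_wpM2l.
rewrite big_ord_recr /=; move: h; rewrite -!natr1; lra.
Qed.

Lemma geom_sum_le_ends z n : 0 <= z <= 1 ->
  2 * \sum_(i < n.+2) z ^+ i <= n.+2%:R * (1 + z ^+ n.+1).
Proof.
move=> /andP[z0 z1]; have z01 k : 0 <= z ^+ k <= 1 by rewrite exprn_ge0// exprn_ile1.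
rewrite mulr_natl mulr2n {2}(reindex_inj rev_ord_inj) -big_split /=.
apply: (@le_trans _ _ (\sum_(i < n.+2) (1 + z ^+ n.+1))); last first.
  by rewrite sumr_const card_ord mulr_natl.
apply: ler_sum => i _; have -> : z ^+ n.+1 = z ^+ i * z ^+ (n.+2 - i.+1).
  by rewrite -exprD; congr (_ ^+ _); have := ltn_ord i; lia.
have /andP[a0 a1] := z01 i; have /andP[b0 b1] := z01 (n.+2 - i.+1)%N.
by nra.
Qed.

Lemma geom_sum_le_gap z n : 0 <= z <= 1 ->
  \sum_(i < n.+3) z ^+ i <= n.+3%:R * (1 - z ^+ n.+1 * (1 - z)).
Proof.
move=> /andP[z0 z1]; elim: n => [|n IH].
  by rewrite !big_ord_recr big_ord0 /= expr0 expr1 expr2; nra.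
rewrite big_ord_recr /=.
have zn : 0 <= z ^+ n.+1 by rewrite exprn_ge0.
have S : 1 - z ^+ n.+3 = (1 - z) * \sum_(i < n.+3) z ^+ i.
  by have := subrX1 z n.+3; lra.
have S1 : z ^+ n.+2 <= \sum_(i < n.+3) z ^+ i.
  by rewrite big_ord_recr /= lerDr sumr_ge0// => i _; rewrite exprn_ge0.
have S2 : 0 <= 1 - z ^+ n.+3 - (1 - z) * z ^+ n.+2.
  by rewrite S -mulrBr mulr_ge0 ?subr_ge0.
have e2 : z ^+ n.+2 = z * z ^+ n.+1 by rewrite exprS.
have e3 : z ^+ n.+3 = z * (z * z ^+ n.+1) by rewrite !exprS.
rewrite e2 e3 in S2 *; have {}IH := IH; move: IH S2 zn.
set a := z ^+ n.+1; set s := \sum_(i < _) _ => IH S2 a0.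
have -> : n.+4%:R = n.+3%:R + 1 :> R by rewrite natr1.
have N0 : 0 <= (n.+3%:R : R) by [].
set N : R := n.+3%:R in IH N0 *.
have a1 : 0 <= a * (1 - z) * (1 - z) by rewrite !mulr_ge0// subr_ge0.
have : 0 <= N * (a * (1 - z) * (1 - z)) by rewrite mulr_ge0.
by nra.
Qed.

(** Here [t] and [x] are the conditional probabilities of an indicator before and after tilting, and
    [G] is [wm] times the rate. Once the leading [x] is bounded by the hypothesis, the claim is the
    average of [h0] and [h1] with weights [1 - x] and [x]. *)
Lemma bias_bound_up y x t n : let G := (y ^+ n.+2 - 1) / n.+2%:R in
  1 <= y -> 0 <= x <= 1 -> 0 <= t ->
  x <= y ^+ n * t * (y - (y - 1) * x) -> x * (1 + G * t) + G * t <= y ^+ n.+2 * t.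
Proof.
move=> G y1 /andP[x0 x1] t0 hx.
have Gn : G * n.+2%:R = y ^+ n.+2 - 1 by rewrite /G divfK.
have N0 : 0 < n.+2%:R :> R by [].
have h0 : y ^+ n * y + G <= y ^+ n.+2.
  rewrite -(ler_pM2r N0) mulrDl Gn subrX1.
  have := ler_wpM2l (_ : 0 <= y - 1) (geom_sum_le_top n y1); rewrite subr_ge0 => /(_ y1).
  by rewrite !exprSr; lra.
have h1 : y ^+ n + 2 * G <= y ^+ n.+2.
  rewrite -(ler_pM2r N0) mulrDl -mulrA Gn subrX1.
  have := ler_wpM2l (_ : 0 <= y - 1) (geom_sum_le_mean n y1); rewrite subr_ge0 => /(_ y1).
  by rewrite !exprSr; lra.
have := ler_wpM2l (mulr_ge0 t0 (_ : 0 <= 1 - x)) h0; rewrite subr_ge0 => /(_ x1).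
have := ler_wpM2l (mulr_ge0 t0 x0) h1.
move: hx; set K := y ^+ n; set E := y ^+ n.+2; lra.
Qed.

(** [X s] solves [x = z ^+ n.+1 * s * (z + (1 - z) * x)], the extremal case of the relation between
    [x] and [t]. The exponent [n.+1] plays the role of [n] in [bias_bound_up]; it has to be positive
    for [geom_sum_le_gap]. *)
Lemma bias_bound_down z t n : let G := (1 - z ^+ n.+3) / n.+3%:R in
  let X s := z ^+ n.+2 * s / (1 - z ^+ n.+1 * (1 - z) * s) in
  0 < z <= 1 -> 0 <= t <= 1 ->
  z ^+ n.+3 * t <= X t * (1 - G * t) - G * X 1 * t.
Proof.
move=> G X /andP[z0 z1] /andP[t0 t1].
have z01 : 0 <= z <= 1 by rewrite ltW.
have Gn : G * n.+3%:R = 1 - z ^+ n.+3 by rewrite /G divfK.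
have N0 : 0 < n.+3%:R :> R by [].
pose q := z ^+ n.+1 * (1 - z).
have q0 : 0 <= q by rewrite mulr_ge0 ?subr_ge0// exprn_ge0// ltW.
have q1 : q < 1.
  apply: (@le_lt_trans _ _ (1 * (1 - z))); last by lra.
  by rewrite ler_wpM2r ?subr_ge0// exprn_ile1// ltW.
have S : 1 - z ^+ n.+3 = (1 - z) * \sum_(i < n.+3) z ^+ i.
  by have := subrX1 z n.+3; lra.
have z1' : 0 <= 1 - z by rewrite subr_ge0.
have ha : G <= (1 - z) * (1 - q).
  rewrite -(ler_pM2r N0) Gn S -mulrA ler_wpM2l// mulrC; exact: geom_sum_le_gap.
have hb : z * (1 - q) <= 1 - 2 * G.
  rewrite -(ler_pM2r N0) mulrBl -[2 * G * _]mulrA Gn S.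
  have := ler_wpM2l z1' (geom_sum_le_ends n.+1 z01).
  have -> : q = z ^+ n.+1 - z ^+ n.+2 by rewrite /q [z ^+ n.+2]exprSr; ring.
  by rewrite [z ^+ n.+2]exprSr; lra.
have D0 : 0 < 1 - q * t by rewrite subr_gt0; apply: le_lt_trans q1; rewrite ler_piMr.
have D1 : 0 < 1 - q by rewrite subr_gt0.
have main : z * ((1 - q * t) * (1 - q)) <= (1 - G * t) * (1 - q) - G * (1 - q * t).
  have := ler_wpM2l (_ : 0 <= 1 - t) ha; rewrite subr_ge0 => /(_ t1).
  have := ler_wpM2l (mulr_ge0 t0 (ltW D1)) hb.
  lra.
have -> : X t * (1 - G * t) - G * X 1 * t =
    z ^+ n.+2 * t * (((1 - G * t) * (1 - q) - G * (1 - q * t)) / ((1 - q * t) * (1 - q))).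
  rewrite /X -/q mulr1; field.
  by rewrite !gt_eqF.
have -> : z ^+ n.+3 * t = z ^+ n.+2 * t * z by rewrite exprSr; ring.
apply: ler_wpM2l.
  by rewrite mulr_ge0// exprn_ge0// ltW.
by rewrite ler_pdivlMr// mulr_gt0.
Qed.

End Scalars.

Section Tilted.
Variables (R : realType) (V I : finType) (adj : rel I) (p : V -> I -> R).
Variables (k sig sig1 : nat) (d : V -> nat) (w : V -> R) (wm : R).
Local Notation Om := {ffun V -> I}.
Implicit Types (om : Om) (a b v : V) (u : I).
Hypotheses (pp : prob p) (adj_sym : symmetric adj).
Hypothesis sf : forall om, starfree (gr adj om) k.
Hypotheses (k2 : (1 < k)%N) (dnz : exists v, (0 < d v)%N).
Hypothesis sigP : forall J : {set V}, (#|J| <= k)%N -> (\sum_(x in J) d x <= sig)%N.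
Hypothesis sigP1 : forall J : {set V}, (#|J| <= k)%N -> (\sum_(x in J) (d x).+1 <= sig1)%N.
Hypotheses (w0 : forall v, 0 <= w v <= wm) (wm0 : 0 < wm).

Local Notation Y := (Yne adj d w).
Local Notation ne := (ne_at R adj d).
(** An outward move raises at most [n] other indicators; the two further units in [c] absorb the
    indicator of [a] itself and the covariance terms. *)
Let n := (sig + sig1).-1.
Let c := wm * n.+2%:R.
Variable th : R.
Let W om := expR (th * Y om).
Let y := expR (th * wm).
Let G := (expR (c * th) - 1) / c.

(** Equivalently, the tilted law of the position of [a] has density [1 + G (E (Y | U_a) - E Y)] with
    respect to the original one. *)
Hypothesis critical : forall a (h : I -> R),
  Ex p (fun om => h (om a) * W om) - Ex p W * Ex p (fun om => h (om a)) =
  Ex p W * G * (Ex p (fun om => h (om a) * Y om) - Ex p (fun om => h (om a)) * Ex p Y).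

Let y_exp : y ^+ n.+2 = expR (c * th).
Proof. by rewrite /y -expRM_natl; congr expR; rewrite /c; ring. Qed.

Let W_gt0 om : 0 < W om. Proof. exact: expR_gt0. Qed.

Let ne01 om a : ne om a = 0 \/ ne om a = 1.
Proof. by rewrite /ne_at; case: (_ != _); [right|left]. Qed.

Let tilt_off a u om := expR (th * Yne_off adj d w a (upd om a u)).
Let Fu a u := Ex p (fun om => W (upd om a u)).
Let Au a u := Ex p (fun om => ne (upd om a u) a * W (upd om a u)).
(** The probability under the tilted law that the indicator of [a] is 1, given that [a] is at
    [u]. *)
Let x a u := Au a u / Fu a u.
Let ya a := expR (th * w a).

Let Fu_gt0 a u : 0 < Fu a u. Proof. by apply: Ex_gt0. Qed.

Let FuE a u : Fu a u = Ex p (tilt_off a u) +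
  (ya a - 1) * Ex p (fun om => ne (upd om a u) a * tilt_off a u om).
Proof.
rewrite -ExZ -ExD; apply: eq_Ex => om; rewrite /W (Yne_split adj d w a) mulrDr expRD.
rewrite -/(tilt_off a u om) /ya.
case: (ne01 (upd om a u) a) => ->; rewrite ?mulr0 ?mulr1 ?expR0; ring.
Qed.

Let AuE a u : Au a u = ya a * Ex p (fun om => ne (upd om a u) a * tilt_off a u om).
Proof.
rewrite -ExZ; apply: eq_Ex => om; rewrite /W (Yne_split adj d w a) mulrDr expRD.
rewrite -/(tilt_off a u om) /ya.
by case: (ne01 (upd om a u) a) => ->; rewrite ?mulr0 ?mulr1 ?mul0r ?mulr0 ?mul1r.
Qed.

Let Aoff_itv a u :
  0 <= Ex p (fun om => ne (upd om a u) a * tilt_off a u om) <= Ex p (tilt_off a u).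
Proof.
have t0 om : 0 <= tilt_off a u om by exact: expR_ge0.
apply/andP; split.
  by apply: Ex_ge0 => // om; case: (ne01 (upd om a u) a) => ->; rewrite ?mul0r ?mul1r.
by apply: Ex_le => // om; case: (ne01 (upd om a u) a) => ->; rewrite ?mul0r ?mul1r.
Qed.

Let x_itv a u : 0 <= x a u <= 1.
Proof.
have F0 := Fu_gt0 a u; apply/andP; split; last first.
  rewrite /x ler_pdivrMr// mul1r; apply: Ex_le => // om.
  by case: (ne01 (upd om a u) a) => ->; rewrite ?mul0r ?mul1r ?lexx ?ltW.
apply: divr_ge0; last exact: ltW.
apply: Ex_ge0 => // om.
by case: (ne01 (upd om a u) a) => ->; rewrite ?mul0r ?mul1r ?lexx ?ltW.
Qed.

Let Ex_x a : Ex p (fun om => ne om a * W om) = Ex p (fun om => x a (om a) * W om).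
Proof.
rewrite (Ex_upd _ a pp) [RHS](Ex_upd _ a pp); apply: eq_bigr => u _; congr (_ * _).
rewrite (@eq_Ex _ _ _ p (fun om => x a (upd om a u a) * _) (fun om => x a u * W (upd om a u))).
  by rewrite ExZ -/(Fu a u) /x divfK ?gt_eqF.
by move=> om; rewrite upd_same.
Qed.

Let ExYW : Ex p (fun om => Y om * W om) = \sum_a w a * Ex p (fun om => x a (om a) * W om).
Proof.
rewrite (@eq_Ex _ _ _ p _ (fun om => \sum_a w a * (ne om a * W om))).
  by rewrite Ex_sum; apply: eq_bigr => a _; rewrite ExZ Ex_x.
by move=> om; rewrite mulr_suml; apply: eq_bigr => a _; rewrite mulrA.
Qed.

Let ExYE : Ex p Y = \sum_a w a * \sum_u p a u * delta adj p d a u.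
Proof. by rewrite Ex_sum; apply: eq_bigr => a _; rewrite ExZ (Ex_ne_atE _ _ pp). Qed.

Let crit_sum (h : V -> I -> R) : \sum_a w a * Ex p (fun om => h a (om a) * W om) =
  Ex p W * (\sum_a w a * (\sum_u p a u * h a u) + G *
    \sum_a w a * (Ex p (fun om => h a (om a) * Y om) -
                Ex p (fun om => h a (om a)) * Ex p Y)).
Proof.
rewrite mulr_sumr -big_split mulr_sumr; apply: eq_bigr => a _.
have /(canRL (subrK _)) -> := critical a (h a); rewrite (Ex_coord pp (h a) a) /=; ring.
Qed.

Let y_gt0 : 0 < y. Proof. exact: expR_gt0. Qed.

Let GE : wm * G = (y ^+ n.+2 - 1) / n.+2%:R.
Proof. by rewrite y_exp /G /c; field; rewrite gt_eqF//= gt_eqF. Qed.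

Let yn : y ^+ n = expR (th * (wm * n%:R)).
Proof. by rewrite /y -expRM_natl; congr expR; ring. Qed.

(** Stationarity and [cov_Yne_le] reduce the claim to [bias_bound_up] for each [a] and [u]. Its
    hypothesis on [x a u] comes from [Ex_static_up] for [tilt_off], on which an outward move costs a
    factor at most [y ^+ n]. *)
Lemma tilted_mean_le : 0 <= th ->
  Ex p (fun om => Y om * W om) <= expR (c * th) * Ex p Y * Ex p W.
Proof.
move=> th0; have y1 : 1 <= y by rewrite -expR0 ler_expR mulr_ge0// ltW.
have K1 : 1 <= y ^+ n by rewrite exprn_ege1.
rewrite ExYW crit_sum mulrC; apply: ler_wpM2r; first by rewrite ltW// Ex_gt0.
have G0 : 0 <= G.
  rewrite /G divr_ge0 ?subr_ge0 -?y_exp ?exprn_ege1//.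
  by rewrite /c mulr_ge0// ltW.
have hB a u : w a * x a u <= wm.
  by have /andP[? ?] := x_itv a u; have /andP[? ?] := w0 a; nra.
have x0 a u : 0 <= x a u by have /andP[] := x_itv a u.
have /(ler_wpM2l G0) cov := @cov_Yne_le R V I adj p d w wm pp w0 x wm (ltW wm0) x0 hB.
apply: le_trans (lerD (lexx _) cov) _.
rewrite mulrDr !mulrA [G * wm]mulrC GE -y_exp ExYE !mulr_sumr -!big_split /=.
apply: ler_sum => a _; rewrite ![_ * (w a * _)]mulrCA -!mulrDr.
have /andP[wa _] := w0 a; apply: ler_wpM2l => //.
rewrite mulrDr !mulr_sumr -!big_split; apply: ler_sum => u _ /=.
have [p0 _] := pp; rewrite ![_ * (p a u * _)]mulrCA -!mulrDr; apply: ler_wpM2l => //.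
set t := delta _ _ _ _ _.
have /andP[t0 t1] : 0 <= t <= 1 by exact: delta_itv.
have := @bias_bound_up R y (x a u) t n y1 (x_itv a u) t0; rewrite /= => h.
have : x a u <= y ^+ n * t * (y - (y - 1) * x a u); last first.
  move: h; set g := (_ / _); set E := y ^+ n.+2; set z := x a u => h /h.
  by rewrite (_ : z + _ = z * (1 + g * t) + g * t); last by ring.
have F0 := Fu_gt0 a u; have xF : x a u * Fu a u = Au a u by rewrite /x divfK ?gt_eqF.
rewrite -(ler_pM2r F0) xF.
have -> : y ^+ n * t * (y - (y - 1) * x a u) * Fu a u =
  y ^+ n * t * (y * Fu a u - (y - 1) * (x a u * Fu a u)) by ring.
rewrite xF.
have /andP[am0 amF] := Aoff_itv a u.
have am := @Ex_static_up R V I adj p d pp a u (tilt_off a u) _ K1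
   (fun om => expR_ge0 (th * Yne_off adj d w a (upd om a u))) _.
have ya1 : 1 <= ya a by rewrite -expR0 ler_expR mulr_ge0.
have yay : ya a <= y by rewrite ler_expR ler_wpM2l//; have /andP[] := w0 a.
have {}am : Ex p (fun om => ne (upd om a u) a * tilt_off a u om) <=
    t * (y ^+ n * Ex p (tilt_off a u)).
  apply: am => om om' b oo out; rewrite yn -expRD ler_expR -mulrDr ler_wpM2l// addrC.
  by have := Yne_off_outward adj_sym sf k2 dnz sigP sigP1 w0 (off_upd a u oo) out; exact.
rewrite FuE AuE; move: am; set am := Ex _ _ in am0 amF *; set Fm := Ex _ _ in amF *.
move=> am1; have ya0 : 0 <= ya a by lra.
have := ler_wpM2l ya0 am1.
(* The price of replacing [w a] by [wm]. *)
have : 0 <= t * y ^+ n * ((y - ya a) * (Fm - am)).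
  by rewrite !mulr_ge0 ?subr_ge0// exprn_ge0// ltW.
set K := y ^+ n; lra.
Qed.

Let n_gt0 : (0 < n)%N.
Proof.
have [v dv] := dnz; have := @sigP [set v]; have := @sigP1 [set v].
by rewrite !cards1 !big_set1 /n; lia.
Qed.

(** As [G <= 0], a lower bound again needs covariances bounded above. Before stationarity is used,
    [x] is replaced by its lower bound [X (t a u)], so that [wm * X 1] can serve as the constant [B]
    of [cov_Yne_le]. *)
Lemma tilted_mean_ge : th <= 0 ->
  expR (c * th) * Ex p Y * Ex p W <= Ex p (fun om => Y om * W om).
Proof.
move=> th0; have y1 : y <= 1 by rewrite -expR0 ler_expR mulr_le0_ge0// ltW.
have y01 : 0 <= y <= 1 by rewrite ltW.
have K1 : y ^+ n <= 1 by rewrite exprn_ile1// ltW.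
have K0 : 0 <= y ^+ n by rewrite exprn_ge0// ltW.
pose q := y ^+ n * (1 - y).
have q0 : 0 <= q by rewrite mulr_ge0 ?subr_ge0.
have q1 : q < 1.
  apply: (@le_lt_trans _ _ (1 * (1 - y))); last by have := y_gt0; lra.
  by rewrite ler_wpM2r ?subr_ge0.
pose X s := y ^+ n.+1 * s / (1 - q * s).
pose t a u := delta adj p d a u.
have t01 a u : 0 <= t a u <= 1 by exact: delta_itv.
have D0 s : 0 <= s <= 1 -> 0 < 1 - q * s.
  by move=> /andP[s0 s1]; rewrite subr_gt0; apply: le_lt_trans q1; rewrite ler_piMr.
have one01 : 0 <= (1 : R) <= 1 by rewrite ler01 lexx.
have Xx a u : X (t a u) <= x a u.
  have /andP[t0 t1] := t01 a u.
  rewrite /X ler_pdivrMr ?D0//.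
  have F0 := Fu_gt0 a u; rewrite -(ler_pM2r F0) -[_ * Fu _ _ as X in _ <= X]mulrAC /x divfK ?gt_eqF//.
  have /andP[am0 amF] := Aoff_itv a u.
  have am := @Ex_static_down R V I adj p d pp a u (tilt_off a u) _ K1
     (fun om => expR_ge0 (th * Yne_off adj d w a (upd om a u))) _.
  have /andP[wa wam] := w0 a.
  have ya1 : ya a <= 1 by rewrite -expR0 ler_expR mulr_le0_ge0.
  have yay : y <= ya a by rewrite ler_expR ler_wnM2l.
  have {}am : t a u * (y ^+ n * Ex p (tilt_off a u)) <=
      Ex p (fun om => ne (upd om a u) a * tilt_off a u om).
    apply: am => om om' b oo out; rewrite yn -expRD ler_expR -mulrDr ler_wnM2l// addrC.
    by have := Yne_off_outward adj_sym sf k2 dnz sigP sigP1 w0 (off_upd a u oo) out; exact.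
  rewrite FuE AuE exprSr /q; move: am; set am := Ex _ _ in am0 amF *; set Fm := Ex _ _ in amF *.
  move=> am1; have ya0 : 0 <= ya a by exact: expR_ge0.
  have := ler_wpM2l ya0 am1.
  have : 0 <= t a u * y ^+ n * ((ya a - y) * (Fm - am)).
    by rewrite !mulr_ge0 ?subr_ge0.
  set K := y ^+ n; lra.
have X0 s : 0 <= s <= 1 -> 0 <= X s.
  move=> s01; have /andP[s0 s1] := s01.
  by rewrite divr_ge0 ?mulr_ge0 ?exprn_ge0// ltW// D0.
have X1 s : 0 <= s <= 1 -> X s <= X 1.
  move=> s01; have /andP[s0 s1] := s01.
  have oneD := D0 1 one01; have sD := D0 s s01; rewrite /X; apply: ler_pM.
  - by rewrite mulr_ge0// exprn_ge0// ltW.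
  - by rewrite invr_ge0 ltW.
  - by rewrite ler_wpM2l// exprn_ge0// ltW.
  - by rewrite lef_pV2 ?posrE// lerD2l lerN2 ler_wpM2l.
have G0 : G <= 0.
  rewrite /G mulr_le0_ge0 ?invr_ge0//; last by rewrite /c mulr_ge0// ltW.
  by rewrite -y_exp subr_le0 exprn_ile1// ltW.
rewrite ExYW; apply: le_trans (_ : _ <= \sum_a w a * Ex p (fun om => X (t a (om a)) * W om)) _; last first.
  apply: ler_sum => a _; have /andP[wa _] := w0 a; apply: ler_wpM2l => //.
  by apply: Ex_le => // om; apply: ler_wpM2r; rewrite ?Xx// ltW.
rewrite (crit_sum (fun a u => X (t a u))) [leRHS]mulrC; apply: ler_wpM2r; first by rewrite ltW// Ex_gt0.
have B0 : 0 <= wm * X 1 by rewrite mulr_ge0 ?X0// ltW.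
have hB a u : w a * X (t a u) <= wm * X 1.
  by have /andP[? ?] := w0 a; apply: ler_pM => //; rewrite ?X0 ?X1.
have X0' a u : 0 <= X (t a u) by rewrite X0.
have /(ler_wnM2l G0) cov := @cov_Yne_le R V I adj p d w wm pp w0 (fun a u => X (t a u)) _ B0 X0' hB.
apply: le_trans _ (lerD (lexx _) cov).
have [B1 B1E] : exists B1, B1 = X 1 by exists (X 1).
rewrite -B1E.
rewrite mulrDr !mulrA [G * wm]mulrC GE -y_exp ExYE !mulr_sumr -!big_split /=.
apply: ler_sum => a _; rewrite ![_ * (w a * _)]mulrCA -!mulrDr.
have /andP[wa _] := w0 a; apply: ler_wpM2l => //.
rewrite !mulr_sumr -!big_split; apply: ler_sum => u _ /=.
have [p0 _] := pp; rewrite ![_ * (p a u * _)]mulrCA -!mulrDr; apply: ler_wpM2l => //.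
rewrite -/(t a u).
have := @bias_bound_down R y (t a u) n.-1 _ (t01 a u); rewrite y_gt0 y1 => /(_ isT) /=.
have eg : (1 - y ^+ n.+2) / n.+2%:R = - ((y ^+ n.+2 - 1) / n.+2%:R).
  by rewrite -[RHS]mulNr opprB.
rewrite prednK// -/q -/(X (t a u)) -/(X 1) -B1E eg.
set g := (_ / _); set E := y ^+ n.+2; set z := X _.
by rewrite (_ : z + _ = z * (1 - - g * t a u) - - g * B1 * t a u); last by ring.
Qed.

End Tilted.

Local Open Scope classical_set_scope.
Local Open Scope ring_scope.

(** * Extremal laws *)

Lemma is_derive_big (R : realType) (J : Type) (r : seq J) (F : J -> R -> R) (D : J -> R) (x : R) :
  (forall j, is_derive x (1 : R) (F j) (D j)) ->
  is_derive x 1 (fun t => \sum_(j <- r) F j t) (\sum_(j <- r) D j).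
Proof.
move=> FD; elim: r => [|j r IH].
  rewrite big_nil (_ : (fun _ => _) = cst 0); first exact: is_derive_cst.
  by apply/funext => t; rewrite big_nil.
rewrite big_cons (_ : (fun _ => _) = F j \+ (fun t => \sum_(j <- r) F j t)).
  exact: is_deriveD.
by apply/funext => t; rewrite big_cons.
Qed.

(** The maximum sits at the right end, so only left difference quotients are available. *)
Lemma left_max_derive (R : realType) (f : R -> R) (a x D : R) :
  a < x -> is_derive x 1 f D -> (forall t, a <= t <= x -> f t <= f x) -> 0 <= D.
Proof.
move=> ax fD fmax; rewrite leNgt; apply/negP => D0.
have := @ex_derive _ _ _ _ _ _ _ fD; rewrite /derivable => cf.
have Df : lim ((h^-1 *: ((f \o shift x) (h *: 1) - f x)) @[h --> 0^']) = D.
  by have := @derive_val _ _ _ _ _ _ _ fD.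
have /cvgrPdist_lt /(_ (- D)) := cf; rewrite Df oppr_gt0 => /(_ D0).
move=> [e /= e0 he].
pose h := - Num.min (e / 2) (x - a).
have m0 : 0 < Num.min (e / 2) (x - a) by rewrite lt_min divr_gt0//= subr_gt0.
have h0 : h < 0 by rewrite /h oppr_lt0.
have := he h; rewrite /= sub0r normrN ltr0_norm// opprK.
have he2 : Num.min (e / 2) (x - a) < e.
  by rewrite gt_min; apply/orP; left; lra.
move=> /(_ he2); rewrite lt_eqF// => /(_ isT).
rewrite /shift /= scaler1 addrC => hq.
have : f (x + h) <= f x.
  have h1 : Num.min (e / 2) (x - a) <= x - a by rewrite ge_min lexx orbT.
  by apply: fmax; rewrite /h; move: h1 m0; set z := Num.min _ _ => h1 m0; apply/andP; split; lra.
rewrite -subr_le0 => q0.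
have : 0 <= h^-1 * (f (x + h) - f x) by rewrite mulr_le0// invr_le0 ltW.
by move: hq; rewrite /GRing.scale /= [h + x]addrC ltr_norml => /andP[+ _]; lra.
Qed.

Lemma is_derive_affine_expR (R : realType) (m b a e : R) :
  is_derive e 1 (fun e => m * expR (e * b) - (m + e * a)) (m * (expR (e * b) * b) - a).
Proof.
have h : is_derive e (1 : R) ( *%R^~ b) b.
  have -> : *%R^~ b = b \*: id by apply/funext => t /=; rewrite mulrC.
  by apply: is_derive_eq; rewrite /GRing.scale/= mulr1.
have -> : (fun e => m * expR (e * b) - (m + e * a)) =
    m \*: (expR \o ( *%R^~ b)) - (cst m + a \*: id).
  by apply/funext => t; rewrite /GRing.scale /= [t * a]mulrC.
by apply: is_derive_eq; rewrite /GRing.scale /= add0r mulr1 [expR _ * b]mulrC.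
Qed.

Lemma is_derive_damped (R : realType) (f : R -> R) (s e t D : R) :
  is_derive (s * t) 1 f D ->
  is_derive t 1 (fun t => f (s * t) * expR (- (e * t)))
    (s * D * expR (- (e * t)) - e * (f (s * t) * expR (- (e * t)))).
Proof.
move=> fD.
have h1 : is_derive t (1 : R) ( *%R s) s.
  have -> : *%R s = s \*: id by [].
  by apply: is_derive_eq; rewrite /GRing.scale/= mulr1.
have h2 : is_derive t (1 : R) ( *%R (- e)) (- e).
  have -> : *%R (- e) = (- e) \*: id by [].
  by apply: is_derive_eq; rewrite /GRing.scale/= mulr1.
have -> : (fun t => f (s * t) * expR (- (e * t))) = (f \o ( *%R s)) * (expR \o ( *%R (- e))).
  by apply/funext => x; rewrite -mulNr.
apply: is_derive_eq; rewrite /GRing.scale /= mulNr.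
by set E := expR _; ring.
Qed.

Section Extremal.
Variables (R : realType) (V I : finType) (Y : {ffun V -> I} -> R) (c : R).
Local Notation Om := {ffun V -> I}.
Implicit Types (p : V -> I -> R) (th t : R).
Hypothesis c0 : 0 < c.

Definition mgf p th := Ex p (fun om => expR (th * Y om)).
Definition dmgf p th := Ex p (fun om => Y om * expR (th * Y om)).
Definition rate th := (expR (c * th) - 1) / c.

Definition critical p th := forall a (h : I -> R),
  Ex p (fun om => h (om a) * expR (th * Y om)) - mgf p th * Ex p (fun om => h (om a)) =
  mgf p th * rate th *
    (Ex p (fun om => h (om a) * Y om) - Ex p (fun om => h (om a)) * Ex p Y).

(** The ratio of the two sides of the desired bound, to be shown at most 1. *)
Let excess p th := mgf p th * expR (- (Ex p Y * rate th)).

Lemma is_derive_mgf p th : is_derive th 1 (mgf p) (dmgf p th).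
Proof.
apply: is_derive_big => om.
have -> : (fun t => Pr p om * expR (t * Y om)) = Pr p om \*: (expR \o ( *%R^~ (Y om))).
  by apply/funext => t.
have h : is_derive th (1 : R) ( *%R^~ (Y om)) (Y om).
  have -> : *%R^~ (Y om) = (Y om) \*: id by apply/funext => t /=; rewrite mulrC.
  by apply: is_derive_eq; rewrite /GRing.scale/= mulr1.
apply: is_derive_eq; rewrite /GRing.scale /=; ring.
Qed.

Lemma is_derive_rate th : is_derive th 1 rate (expR (c * th)).
Proof.
have -> : rate = c^-1 \*: ((expR \o ( *%R c)) - cst 1).
  by apply/funext => t; rewrite /rate /GRing.scale /= mulrC.
have h : is_derive th (1 : R) ( *%R c) c.
  have -> : *%R c = c \*: id by [].
  by apply: is_derive_eq; rewrite /GRing.scale/= mulr1.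
by apply: is_derive_eq; rewrite /GRing.scale /= subr0; field; rewrite gt_eqF.
Qed.

Let is_derive_excess p th : is_derive th 1 (excess p)
  ((dmgf p th - mgf p th * (Ex p Y * expR (c * th))) * expR (- (Ex p Y * rate th))).
Proof.
have h1 := is_derive_mgf p th; have h2 := is_derive_rate th.
have -> : excess p = mgf p * (expR \o ((- Ex p Y) \*: rate)).
  by apply/funext => t; rewrite /excess /= /GRing.scale /= -mulNr.
apply: is_derive_eq; rewrite /GRing.scale /= /GRing.scale /= mulNr.
set E1 := expR _; set E2 := expR _; ring.
Qed.

Let excess0 p : prob p -> excess p 0 = 1.
Proof.
move=> pp; rewrite /excess /rate mulr0 expR0 subrr mul0r mulr0 oppr0 expR0 mulr1.
by rewrite /mgf (@eq_Ex _ _ _ p _ (fun=> 1)) ?Ex_cst// => om; rewrite mul0r expR0.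
Qed.

Definition perturb p a (g : I -> R) e : V -> I -> R :=
  fun v i => if v == a then p v i * (1 + e * g i) else p v i.

Lemma Ex_perturb p a g e F :
  Ex (perturb p a g e) F = Ex p F + e * Ex p (fun om => g (om a) * F om).
Proof.
rewrite -ExZ -ExD; apply: eq_bigr => om _; rewrite /Pr (bigD1 a)//= [in RHS](bigD1 a)//=.
rewrite {1}/perturb eqxx (eq_bigr (fun v => p v (om v))) => [|v /negbTE va]; first by ring.
by rewrite /perturb va.
Qed.

Lemma prob_perturb p a g e : prob p -> \sum_i p a i * g i = 0 ->
  (forall i, 0 <= 1 + e * g i) -> prob (perturb p a g e).
Proof.
move=> [p0 p1] pg eg; split => v; rewrite /perturb.
  by move=> i; case: ifP => // _; rewrite mulr_ge0.
have [->|//] := eqVneq v a.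
rewrite (eq_bigr (fun i => p a i + e * (p a i * g i))) => [|i _]; last by ring.
by rewrite big_split /= p1 -mulr_sumr pg mulr0 addr0.
Qed.

(* Affine perturbations of one marginal: at a maximiser of the exponential
   moment, normalised by [expR (Ex p Y * rate th)], the first variation vanishes. *)
Lemma critical_max p th : prob p ->
  (forall p', prob p' -> excess p' th <= excess p th) -> critical p th.
Proof.
move=> pp pmax a h; have [p0 p1] := pp.
pose E := \sum_i p a i * h i; pose g i := h i - E.
have ExE : Ex p (fun om => h (om a)) = E by rewrite (Ex_coord pp h a).
have pg : \sum_i p a i * g i = 0.
  rewrite (eq_bigr (fun i => p a i * h i - E * p a i)) => [|i _]; last by rewrite /g; ring.
  by rewrite sumrB -mulr_sumr p1 mulr1 subrr.
pose A := Ex p (fun om => g (om a) * expR (th * Y om)).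
pose B := Ex p (fun om => g (om a) * Y om).
have EA : A = Ex p (fun om => h (om a) * expR (th * Y om)) - mgf p th * E.
  by rewrite /A mulrC /mgf -ExZ -ExB; apply: eq_Ex => om; rewrite /g; ring.
have EB : B = Ex p (fun om => h (om a) * Y om) - E * Ex p Y.
  by rewrite /B -ExZ -ExB; apply: eq_Ex => om; rewrite /g; ring.
have [AE BE] : A = Ex p (fun om => g (om a) * expR (th * Y om)) /\ B = Ex p (fun om => g (om a) * Y om) by [].
clearbody A B.
(* For [|e| <= 1 / M] the perturbed weights stay nonnegative. *)
pose M := 1 + \sum_i `|g i|.
have M0 : 0 < M by rewrite ltr_pwDl// sumr_ge0.
have gM i : `|g i| <= M.
  by rewrite /M (bigD1 i)//= addrCA lerDl addr_ge0// sumr_ge0.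
(* Maximality against the perturbation of size [e] reads [0 <= ph e], with equality at 0, so the
   derivative at 0 vanishes. *)
pose ph e : R := mgf p th * expR (e * (B * rate th)) - (mgf p th + e * A).
have ph0 e : e \in `]- M^-1, M^-1[ -> ph 0 <= ph e.
  rewrite in_itv /= => /andP[e1 e2].
  have -> : ph 0 = 0 by rewrite /ph !mul0r expR0; ring.
  have eM : `|e| <= M^-1 by rewrite ler_norml !ltW.
  have pe : prob (perturb p a g e).
    apply: prob_perturb => // i; have : `|e * g i| <= 1.
      by rewrite normrM -(mulVf (lt0r_neq0 M0)); apply: ler_pM.
    rewrite ler_norml => /andP[+ _]; lra.
  have := pmax _ pe; rewrite /excess /mgf !Ex_perturb -/(mgf p th) -AE -BE => le.
  rewrite /ph subr_ge0.
  have := ler_wpM2r (expR_ge0 ((Ex p Y + e * B) * rate th)) le.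
  rewrite -[X in X <= _]mulrA -expRD addNr expR0 mulr1 -mulrA -expRD.
  by congr (_ <= _ * expR _); ring.
have M1 : - M^-1 < M^-1 by rewrite -subr_gt0 opprK addr_gt0// invr_gt0.
have dph (e : R) : is_derive e (1 : R) ph (mgf p th * (expR (e * (B * rate th)) * (B * rate th)) - A).
  exact: is_derive_affine_expR.
have z0 : 0 \in `]- M^-1, M^-1[ by rewrite in_itv /= oppr_lt0 invr_gt0 M0.
have := derive1_at_min (ltW M1) (fun t _ => @ex_derive _ _ _ _ _ _ _ (dph t)) z0 ph0.
have d0 := dph 0; rewrite mul0r expR0 mul1r in d0.
move=> d1; have := @derive_val _ _ _ _ _ _ _ d1; rewrite (@derive_val _ _ _ _ _ _ _ d0).
by rewrite ExE -EA -EB => /eqP; rewrite subr_eq0 => /eqP <-; ring.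
Qed.

(** Laws and the parameter [t], stored at [None], share one product of lines, so that compactness
    follows from Tychonoff's theorem. *)
Let Sp := prod_topology (fun _ : option (V * I) => (R : topologicalType)).
Let law (f : Sp) : V -> I -> R := fun v i => f (Some (v, i)).

Let coord_cts i : continuous (fun f : Sp => f i : R).
Proof. exact: (@proj_continuous _ (fun _ : option (V * I) => (R : topologicalType)) i). Qed.

Let sum_cts (J : finType) (F : J -> Sp -> R) :
  (forall j, continuous (F j)) -> continuous (fun f => \sum_j F j f).
Proof. by move=> h; apply: continuous_big => //; exact: add_continuous. Qed.

Let Pr_cts om : continuous (fun f : Sp => Pr (law f) om).
Proof.
apply: continuous_big => [|v _]; first exact: mul_continuous.
exact: coord_cts.
Qed.

Let admissible t0 : set Sp := [set f | prob (law f) /\ 0 <= f None <= t0].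

Let admissible_compact t0 : compact (admissible t0).
Proof.
pose box (i : option (V * I)) : set R := if i is Some _ then `[0, 1]%classic else `[0, t0]%classic.
apply: (@subclosed_compact _ _ [set f : Sp | forall i, box i (f i)]).
- have -> : admissible t0 = [set f : Sp | forall i, box i (f i)] `&`
      \bigcap_(v in [set: V]) ((fun f : Sp => \sum_i law f v i) @^-1` [set 1]).
    apply/seteqP; split => f /=.
      move=> [[f0 f1] ft]; split; last by move=> v _; exact: f1.
      move=> [[v i]|] /=; rewrite in_itv//= f0 -(f1 v) (bigD1 i)//= lerDl.
      by apply: sumr_ge0.
    move=> [fb f1]; split; last by have := fb None; rewrite /= in_itv.
    split; last by move=> v; exact: (f1 v).
    by move=> v i; have := fb (Some (v, i)); rewrite /= in_itv/= => /andP[].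
  apply: closedI.
    apply: compact_closed; first exact: hausdorff_product (fun=> @Rhausdorff R).
    apply: (@tychonoff _ (fun _ : option (V * I) => (R : topologicalType)) box) => -[vi|]; exact: segment_compact.
  apply: closed_bigI => v _; apply: preimage_closed; last first.
    by apply: compact_closed; [exact: Rhausdorff|exact: compact_set1].
  move=> f _; apply: sum_cts => i; exact: coord_cts.
- apply: (@tychonoff _ (fun _ : option (V * I) => (R : topologicalType)) box) => -[vi|]; exact: segment_compact.
- move=> f [[f0 f1] ft] [[v i]|] /=; rewrite in_itv//= f0 -(f1 v) (bigD1 i)//= lerDl.
  by apply: sumr_ge0.
Qed.

Let cts_expR (F : Sp -> R) : continuous F -> continuous (fun f => expR (F f)).
Proof. by move=> h f; apply: continuous_comp; [exact: h|exact: continuous_expR]. Qed.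

Let ctsM (F H : Sp -> R) : continuous F -> continuous H -> continuous (fun f => F f * H f).
Proof. by move=> h1 h2 f; apply: continuousM; [exact: h1|exact: h2]. Qed.

Let ctsC (k : R) : continuous (fun _ : Sp => k).
Proof. exact: cst_continuous. Qed.

Let ctsN (F : Sp -> R) : continuous F -> continuous (fun f => - F f).
Proof.
move=> h; have -> : (fun f => - F f) = (fun f => - 1 * F f).
  by apply/funext => f; rewrite mulN1r.
by apply: ctsM => //; exact: ctsC.
Qed.

Let rate_cts (F : Sp -> R) : continuous F -> continuous (fun f => rate (F f)).
Proof.
move=> h f; apply: continuous_comp; first exact: h.
apply: differentiable_continuous; apply/derivable1_diffP.
exact: (@ex_derive _ _ _ _ _ _ _ (is_derive_rate _)).
Qed.

Let excess_cts s : continuous (fun f : Sp => excess (law f) (s * f None)).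
Proof.
have th_cts : continuous (fun f : Sp => s * f None) by apply: ctsM; [exact: ctsC|exact: coord_cts].
have Ex_cts F : (forall om, continuous (F om : Sp -> R)) -> continuous (fun f : Sp => Ex (law f) (fun om => F om f)).
  by move=> h; apply: sum_cts => om; apply: ctsM; [exact: Pr_cts|exact: h].
apply: ctsM; first by apply: Ex_cts => om; apply: cts_expR; apply: ctsM.
apply: cts_expR; apply: ctsN; apply: ctsM.
  by apply: Ex_cts => om; exact: ctsC.
exact: rate_cts.
Qed.

(* If the bound failed, [expR (- e * t) * excess p (s * t)] would for small [e]
   be maximised over all laws and [0 <= t <= t0] at some [t > 0], where the law is
   critical and the derivative in [t] is nonnegative. *)
Lemma mgf_le p th :
  (forall p th, prob p -> critical p th ->
    (0 <= th -> dmgf p th <= expR (c * th) * Ex p Y * mgf p th) /\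
    (th <= 0 -> expR (c * th) * Ex p Y * mgf p th <= dmgf p th)) ->
  prob p -> mgf p th <= expR (Ex p Y * rate th).
Proof.
move=> bias pp; rewrite leNgt; apply/negP => gt.
have ex1 : 1 < excess p th.
  by rewrite /excess expRN -ltr_pdivrMr ?invr_gt0 ?expR_gt0// invrK mul1r.
pose s : R := if 0 <= th then 1 else - 1; pose t0 := `|th|.
have st : s * t0 = th.
  by rewrite /s /t0; case: ifPn => [/ger0_norm ->|]; rewrite ?mul1r// -ltNge => /ltr0_norm ->; ring.
have t00 : 0 < t0.
  rewrite normr_gt0; apply/eqP => th0; by move: ex1; rewrite th0 excess0// ltxx.
(* Half the damping that would bring the value at [t0] down to 1, so that it still exceeds 1. *)
pose e := ln (excess p th) / (2 * t0).
have ln0 : 0 < ln (excess p th) by rewrite ln_gt0.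
have e0 : 0 < e by rewrite divr_gt0// mulr_gt0.
pose f0 : Sp := fun i => if i is Some (v, i) then p v i else t0.
pose K (f : Sp) := excess (law f) (s * f None) * expR (- (e * f None)).
have Af0 : admissible t0 f0 by split; [exact: pp|rewrite /= ltW ?lexx].
have Kc : continuous K.
  apply: ctsM; first exact: excess_cts.
  by apply: cts_expR; apply: ctsN; apply: ctsM; [exact: ctsC|exact: coord_cts].
have [f /set_mem Af fmax] := compact_EVT_max (ex_intro _ f0 Af0) (@admissible_compact t0)
  (continuous_subspaceT Kc).
have {}fmax g : admissible t0 g -> K g <= K f by move=> Ag; apply: fmax; exact: mem_set.
have [pf /andP[t1 t2]] := Af; set q := law f in pf; set t := f None in t1 t2.
have Kf : 1 < K f.
  apply: lt_le_trans (fmax _ Af0); rewrite /K /f0 /= -/t0 st -[ltLHS]expR0.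
  rewrite -[X in _ < X * _]lnK ?posrE ?(lt_trans _ ex1)// -expRD ltr_expR /e.
  rewrite (_ : _ / _ * _ = ln (excess p th) / 2); first by lra.
  by field; rewrite gt_eqF.
have tpos : 0 < t.
  rewrite lt_neqAle t1 andbT; apply/eqP => t0'; move: Kf.
  by rewrite /K -/t -t0' !mulr0 excess0// oppr0 expR0 mulr1 ltxx.
have crit : critical q (s * t).
  apply: critical_max => // p' pp'.
  have := fmax (fun i => if i is Some (v, i) then p' v i else t).
  rewrite /K /= -/t ler_pM2r ?expR_gt0//; apply; split => //=.
  by rewrite t1.
have slope := is_derive_excess q (s * t).
have [b1 b2] := bias q (s * t) pf crit.
set D := (_ * expR (- (Ex q Y * rate (s * t)))) in slope.
have sD : s * D <= 0.
  rewrite /D mulrA mulr_le0_ge0 ?expR_ge0//; move: b1 b2; rewrite /s.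
  case: ifP => _; rewrite ?mul1r ?mulN1r ?oppr_ge0 ?oppr_le0.
    move=> /(_ t1) + _; rewrite subr_le0 mulrA; congr (_ <= _); ring.
  by move=> _ /(_ t1); rewrite subr_ge0; congr (_ <= _); ring.
have dk : is_derive t 1 (fun t => excess q (s * t) * expR (- (e * t)))
   (s * D * expR (- (e * t)) - e * (excess q (s * t) * expR (- (e * t)))).
  exact: is_derive_damped.
(* With the law fixed, the bias inequality makes [s * D] nonpositive, and damping brings the
   derivative down to at most [- e * K f < 0]. *)
have := @left_max_derive R _ 0 t _ tpos dk _.
have -> : excess q (s * t) * expR (- (e * t)) = K f by [].
have : s * D * expR (- (e * t)) <= 0 by rewrite mulr_le0_ge0 ?expR_ge0.
have : 0 < e * K f by rewrite mulr_gt0// (lt_trans _ Kf).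
move=> h1 h2 /(_ _)/wrap[u /andP[u0 ut]|]; last lra.
have := fmax (fun i => if i is Some (v, i) then q v i else u); apply; split => //=.
by rewrite u0 (le_trans ut).
Qed.

End Extremal.

Section FiniteMgf.
Variables (R : realType) (V I : finType) (adj : rel I) (p : V -> I -> R).
Variables (k : nat) (d : V -> nat) (w : V -> R) (wm : R) (sig : nat).
Hypotheses (pp : prob p) (adj_sym : symmetric adj).
Hypothesis sf : forall om : {ffun V -> I}, starfree (gr adj om) k.
Hypothesis k2 : (1 < k)%N.
Hypothesis sigP : forall J : {set V}, (#|J| <= k)%N -> (\sum_(x in J) d x <= sig)%N.
Hypotheses (w0 : forall v, 0 <= w v <= wm) (wm0 : 0 < wm).

(** Size bias is used with [phi x = exp (th x)] if [th >= 0] and with its negative if [th <= 0]. *)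
Lemma mgf_Yge_le (D : nat) th : (0 < D)%N -> (forall v, 0 < d v <= D)%N -> (D <= sig)%N ->
  mgf (Yge adj d w) p th <=
  expR (Ex p (Yge adj d w) * rate (wm * (D * sig.+1)%:R) th).
Proof.
move=> D0 dD Dsig; set c := wm * _.
have c0 : 0 < c by rewrite mulr_gt0// ltr0n muln_gt0 D0.
apply: mgf_le => // q {}th qq _.
have d0 v : (0 < d v)%N by have /andP[] := dD v.
have dD' v : (d v <= D)%N by have /andP[] := dD v.
have bias := @Ex_Yge_bias R V I adj q k D sig d w wm qq adj_sym sf k2 d0 dD' Dsig sigP w0.
have E : dmgf (Yge adj d w) q th = expR (c * th) *
    Ex q (fun om => Yge adj d w om * expR (th * (Yge adj d w om - c))).
  rewrite -ExZ; apply: eq_Ex => om; rewrite mulrCA -expRD; congr (_ * expR _); ring.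
rewrite E -mulrA; split=> th0; apply: ler_wpM2l; rewrite ?expR_ge0//.
  by apply: (bias (fun x => expR (th * x))) => x y xy; rewrite ler_expR ler_wpM2l.
have := bias (fun x => - expR (th * x)) _.
rewrite ExN mulrN (@eq_Ex _ _ _ q _ (fun om =>
  - (Yge adj d w om * expR (th * (Yge adj d w om - c))))) => [|om]; last by rewrite mulrN.
by rewrite ExN lerN2; apply => x y xy; rewrite lerN2 ler_expR ler_wnM2l.
Qed.

Lemma mgf_Yne_le (sig1 : nat) th : (exists v, 0 < d v)%N ->
  (forall J : {set V}, (#|J| <= k)%N -> (\sum_(x in J) (d x).+1 <= sig1)%N) ->
  mgf (Yne adj d w) p th <=
  expR (Ex p (Yne adj d w) * rate (wm * (sig + sig1).-1.+2%:R) th).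
Proof.
move=> dnz sigP1; apply: mgf_le => [|q {}th qq crit|//]; first exact: mulr_gt0.
split=> th0.
  exact: (@tilted_mean_le R V I adj q k sig sig1 d w wm qq adj_sym sf k2 dnz sigP sigP1 w0 wm0 th crit th0).
exact: (@tilted_mean_ge R V I adj q k sig sig1 d w wm qq adj_sym sf k2 dnz sigP sigP1 w0 wm0 th crit th0).
Qed.

End FiniteMgf.

(** * Geometry of the torus *)

Section Norm.
Variables (R : realType) (p : nat).
Implicit Types u v : 'I_p -> R.

Lemma enorm_ge0 u : 0 <= enorm u. Proof. exact: sqrtr_ge0. Qed.

Lemma sqr_enorm u : enorm u ^+ 2 = \sum_i u i ^+ 2.
Proof. by rewrite sqr_sqrtr// sumr_ge0// => i _; exact: sqr_ge0. Qed.

Lemma eq_enorm u v : u =1 v -> enorm u = enorm v.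
Proof. by move=> uv; rewrite /enorm; congr Num.sqrt; apply: eq_bigr => i _; rewrite uv. Qed.

Lemma ler_enorm u v : (forall i, `|u i| <= `|v i|) -> enorm u <= enorm v.
Proof.
move=> uv; rewrite ler_sqrt; last by apply: sumr_ge0 => i _; exact: sqr_ge0.
by apply: ler_sum => i _; rewrite -(real_normK (num_real (u i))) -(real_normK (num_real (v i))) lerXn2r ?nnegrE.
Qed.

Lemma enormN u : enorm (fun i => - u i) = enorm u.
Proof. by rewrite /enorm; congr Num.sqrt; apply: eq_bigr => i _; rewrite sqrrN. Qed.

Lemma enormZ k u : enorm (fun i => k * u i) = `|k| * enorm u.
Proof.
rewrite /enorm (eq_bigr (fun i => k ^+ 2 * u i ^+ 2)) => [|i _]; last by rewrite exprMn.
by rewrite -mulr_sumr sqrtrM ?sqr_ge0// sqrtr_sqr.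
Qed.

Lemma coord_le_enorm u i : `|u i| <= enorm u.
Proof.
rewrite -(@ler_pXn2r _ 2)// ?nnegrE ?enorm_ge0// sqr_enorm real_normK ?num_real//.
by rewrite (bigD1 i)//= lerDl; apply: sumr_ge0 => j _; exact: sqr_ge0.
Qed.

Lemma enorm_le_bound u e : (forall i, `|u i| <= e) -> enorm u <= Num.sqrt p%:R * e.
Proof.
case: (posnP p) => [p0 _|p0 ue].
  rewrite /enorm big1 ?sqrtr0 ?p0 ?sqrtr0 ?mul0r// => i.
  by exfalso; have := ltn_ord i; rewrite {2}p0.
have e0 : 0 <= e by apply: le_trans (ue (Ordinal p0)).
rewrite -[e]ger0_norm// -sqrtr_sqr -sqrtrM ?ler0n// ler_sqrt; last first.
  by rewrite mulr_ge0// sqr_ge0.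
apply: (@le_trans _ _ (\sum_(i < p) e ^+ 2)); last by rewrite sumr_const card_ord mulr_natl.
apply: ler_sum => i _; rewrite -(real_normK (num_real (u i))) lerXn2r ?nnegrE//.
Qed.

Lemma enormD u v : enorm (fun i => u i + v i) <= enorm u + enorm v.
Proof.
have a0 := enorm_ge0 u; have b0 := enorm_ge0 v.
rewrite -(@ler_pXn2r _ 2)// ?nnegrE ?enorm_ge0 ?addr_ge0//.
rewrite sqr_enorm sqrrD !sqr_enorm.
rewrite (eq_bigr (fun i => u i ^+ 2 + v i ^+ 2 + 2 * (u i * v i))) => [|i _]; last by ring.
rewrite !big_split /= -mulr_sumr -addrA [X in _ <= X]addrAC -addrA lerD2l lerD2l.
rewrite -[X in _ <= X]mulr_natl ler_pM2l//.
have [a0'|aN0] := eqVneq (enorm u) 0.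
  rewrite a0' mul0r big1// => i _.
  by have := coord_le_enorm u i; rewrite a0' normr_le0 => /eqP ->; rewrite mul0r.
have [b0'|bN0] := eqVneq (enorm v) 0.
  rewrite b0' mulr0 big1// => i _.
  by have := coord_le_enorm v i; rewrite b0' normr_le0 => /eqP ->; rewrite mulr0.
have ab : 0 < enorm u * enorm v by rewrite mulr_gt0// lt_def ?aN0 ?bN0 ?a0 ?b0.
rewrite -(ler_pM2l ab) mulr_sumr.
apply: (@le_trans _ _ (\sum_i (enorm v ^+ 2 * u i ^+ 2 + enorm u ^+ 2 * v i ^+ 2) / 2)).
  apply: ler_sum => i _; have := sqr_ge0 (enorm v * u i - enorm u * v i).
  by rewrite sqrrB !exprMn; lra.
rewrite -mulr_suml big_split /= -!mulr_sumr -!sqr_enorm.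
by set a := enorm u; set b := enorm v; rewrite le_eqVlt; apply/orP; left; apply/eqP; field.
Qed.

End Norm.

Section TorusDistance.
Variables (R : realType) (p : nat) (L : R).
Implicit Types x y : 'pt[R]_p.
Local Notation lift_vec x y z := (fun i => (tnth x i : R) - tnth y i + L * (z i)%:~R).

Let dset_lb x y : has_lbound (range (fun z : 'I_p -> int => enorm (lift_vec x y z))).
Proof. by exists 0 => _ [z _ <-]; exact: enorm_ge0. Qed.

Lemma tdist_le x y (z : 'I_p -> int) : tdist L x y <= enorm (lift_vec x y z).
Proof. by apply: ge_inf => //; exists z. Qed.

Hypothesis L0 : 0 < L.

Lemma nearest_shift (t : R) : exists z : int, forall z' : int, `|t + L * z%:~R| <= `|t + L * z'%:~R|.
Proof.
pose z := - Num.floor (t / L + 2^-1); exists z => z'.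
have /andP[f1 f2] := floor_itv (t / L + 2^-1).
have zE : (Num.floor (t / L + 2^-1))%:~R = - z%:~R :> R by rewrite /z rmorphN opprK.
rewrite intrD zE /= in f2; rewrite zE in f1.
have tL : t = t / L * L by rewrite divfK// gt_eqF.
set s := t / L in tL f1 f2.
have [->//|zz] := eqVneq z' z.
have -> : t + L * z%:~R = L * (s + z%:~R) by rewrite {1}tL; ring.
have -> : t + L * z'%:~R = L * (s + z'%:~R) by rewrite {1}tL; ring.
rewrite !normrM ler_wpM2l//.
apply: (@le_trans _ _ 2^-1); first by rewrite ler_norml; apply/andP; split; lra.
have : z' + 1 <= z \/ z + 1 <= z' by lia.
case=> h; have := h; rewrite -(ler_int R) intrD /= => {}h; rewrite ler_normr; apply/orP; [right|left]; lra.
Qed.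

(** The norm increases with each absolute coordinate, so the shift is optimised coordinatewise. *)
Lemma tdist_attained x y : exists z : 'I_p -> int, tdist L x y = enorm (lift_vec x y z).
Proof.
have /choice[z zP] : forall i : 'I_p, exists z : int, forall z' : int,
    `|(tnth x i : R) - tnth y i + L * z%:~R| <= `|(tnth x i : R) - tnth y i + L * z'%:~R|.
  by move=> i; exact: nearest_shift.
exists z; apply/eqP; rewrite eq_le tdist_le /=.
apply: lb_le_inf; first by exists (enorm (lift_vec x y z)); exists z.
by move=> _ [z' _ <-]; apply: ler_enorm => i; exact: zP.
Qed.

Lemma tdist_sym x y : tdist L x y = tdist L y x.
Proof.
suff le (a b : 'pt[R]_p) : tdist L a b <= tdist L b a by apply/eqP; rewrite eq_le !le.
have [z ->] := tdist_attained b a.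
apply: le_trans (tdist_le _ _ (fun i => - z i)) _.
by rewrite -enormN le_eqVlt; apply/orP; left; apply/eqP/eq_enorm => i; rewrite rmorphN /=; ring.
Qed.

Lemma tdist_triangle x y z : tdist L x z <= tdist L x y + tdist L y z.
Proof.
have [a ->] := tdist_attained x y; have [b ->] := tdist_attained y z.
apply: le_trans (enormD _ _); apply: le_trans (tdist_le _ _ (fun i => a i + b i)) _.
by rewrite le_eqVlt; apply/orP; left; apply/eqP/eq_enorm => i; rewrite rmorphD /=; ring.
Qed.

Lemma tdist_le_enorm x y : tdist L x y <= enorm (fun i => (tnth x i : R) - tnth y i).
Proof.
apply: le_trans (tdist_le _ _ (fun=> 0)) _.
by rewrite le_eqVlt; apply/orP; left; apply/eqP/eq_enorm => i; rewrite mulr0 addr0.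
Qed.

(** A common point is the midpoint of a shortest segment between lifts, brought back into the
    cube. *)
Lemma tball_meet x y : cube L x -> cube L y ->
  `[< tball L x `&` tball L y !=set0 >] = (tdist L x y <= 2).
Proof.
move=> xC yC; apply/asboolP/idP => [[w [[_ wx] [_ wy]]]|].
  apply: le_trans (tdist_triangle x w y) _; rewrite tdist_sym.
  by have -> : 2 = 1 + 1 :> R by []; apply: lerD.
have [z ->] := tdist_attained x y => le2.
pose m i : R := (tnth y i : R) + (tnth x i - tnth y i + L * (z i)%:~R) / 2.
pose f i : int := Num.floor (m i / L).
pose c : 'pt[R]_p := [tuple (m i - L * (f i)%:~R : R) | i < p].
have cC : cube L c.
  move=> i; rewrite tnth_mktuple.
  have /andP[f1 f2] := floor_itv (m i / L).
  rewrite -/(f i) in f1 f2; rewrite intrD in f2.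
  have mE : m i = m i / L * L by rewrite divfK// gt_eqF.
  apply/andP; split.
    by rewrite subr_ge0 mE mulrC ler_wpM2r// ltW.
  rewrite ltrBlDr mE (_ : L + _ = ((f i)%:~R + 1) * L); last by ring.
  by rewrite ltr_pM2r.
have half : enorm (fun i => 2^-1 * (tnth x i - tnth y i + L * (z i)%:~R : R)) <= 1.
  by rewrite enormZ ger0_norm ?invr_ge0//; move: le2; set e := enorm _; lra.
exists c; split; split => //.
  apply: le_trans (tdist_le _ _ (fun i => f i - z i)) _; apply: le_trans half.
  rewrite -enormN le_eqVlt; apply/orP; left; apply/eqP/eq_enorm => i.
  by rewrite tnth_mktuple rmorphB /= /m; field.
apply: le_trans (tdist_le _ _ f) _; apply: le_trans half.
rewrite le_eqVlt; apply/orP; left; apply/eqP/eq_enorm => i.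
by rewrite tnth_mktuple /m; field.
Qed.

(** Lifts nearest to [x], relative to [x] and scaled by [2 / rho], have norm at most 2 and mutual
    distances above 2: centers of a packing. A free [rho] accommodates the enlarged radius on the
    grid. *)
Lemma separated_neighbours k rho x (y : 'I_k -> 'pt[R]_p) : 0 < rho ->
  (forall j, tdist L x (y j) <= rho) ->
  (forall i j, i != j -> rho < tdist L (y i) (y j)) -> (k <= kappa1 R p)%N.
Proof.
move=> rho0 near far; have [_ kmax] := kappa1P R p; apply: kmax.
have /choice[z zP] : forall j, exists z : 'I_p -> int,
    tdist L (y j) x = enorm (lift_vec (y j) x z).
  by move=> j; exact: tdist_attained.
pose v j : 'I_p -> R := lift_vec (y j) x (z j).
have vle j : enorm (v j) <= rho by rewrite /v -zP tdist_sym.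
pose c j : 'pt[R]_p := [tuple (2 / rho * v j i : R) | i < p].
exists c; split => [j|i j ij].
  exists [tuple (rho^-1 * v j i : R) | i < p]; split; rewrite /unit_ball /=.
    rewrite (@eq_enorm _ _ _ (fun i => - rho^-1 * v j i)).
      rewrite enormZ normrN ger0_norm; last by rewrite invr_ge0 ltW.
      by rewrite mulrC ler_pdivrMr// mul1r.
    by move=> i; rewrite !tnth_mktuple; field; rewrite gt_eqF.
  rewrite (@eq_enorm _ _ _ (fun i => rho^-1 * v j i)).
    rewrite enormZ ger0_norm; last by rewrite invr_ge0 ltW.
    by rewrite mulrC ler_pdivrMr// mul1r.
  by move=> i; rewrite !tnth_mktuple subr0.
apply/eqP/negPn/negP => /set0P[q [qi qj]].
have := far i j ij; apply/negP; rewrite -leNgt.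
apply: le_trans (tdist_le _ _ (fun l => z i l - z j l)) _.
have E : enorm (lift_vec (y i) (y j) (fun l => z i l - z j l)) = rho / 2 *
    enorm (fun l => ((tnth q l : R) - tnth (c j) l) + - ((tnth q l : R) - tnth (c i) l)).
  rewrite -[rho / 2]ger0_norm; last by rewrite divr_ge0// ltW.
  rewrite -enormZ; apply: eq_enorm => l.
  by rewrite !tnth_mktuple /v rmorphB /=; field; rewrite gt_eqF.
rewrite E; apply: (@le_trans _ _ (rho / 2 * (1 + 1))); last by lra.
rewrite ler_wpM2l//; first by rewrite divr_ge0// ltW.
apply: le_trans (enormD _ _) _.
by rewrite enormN; apply: lerD.
Qed.

End TorusDistance.

(** Unit balls centered at 2 and -2 on the first axis. *)
Lemma kappa1_ge2 (R : realType) (p : nat) : (1 <= p)%N -> (2 <= kappa1 R p)%N.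
Proof.
case: p => // p _; have [_ kmax] := kappa1P R p.+1; apply: kmax.
pose e (t : R) : 'pt[R]_p.+1 := [tuple (if i == ord0 then t else 0) | i < p.+1].
have eE t t' : enorm (fun i => (tnth (e t) i : R) - tnth (e t') i) = `|t - t'|.
  rewrite /enorm (bigD1 ord0)//= big1 => [|i /negbTE i0]; last first.
    by rewrite !tnth_mktuple i0 subrr expr0n.
  by rewrite !tnth_mktuple /= addr0 sqrtr_sqr.
have o0 : origin R p.+1 = e 0.
  by apply: eq_from_tnth => i; rewrite !tnth_mktuple; case: ifP.
exists (fun j : 'I_2 => e (if j == ord0 then 2 else - 2)); split => [j|i j ij].
  exists (e (if j == ord0 then 1 else - 1)); rewrite o0; split; rewrite /unit_ball /= eE.
    by case: ifP => _; rewrite ler_norml; apply/andP; split; lra.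
  by case: ifP => _; rewrite ler_norml; apply/andP; split; lra.
apply/eqP/negPn/negP => /set0P[q [qi qj]].
have := coord_le_enorm (fun i => (tnth q i : R) - tnth (e (if j == ord0 then 2 else - 2)) i) ord0.
have := coord_le_enorm (fun l => (tnth q l : R) - tnth (e (if i == ord0 then 2 else - 2)) l) ord0.
move=> /le_trans /(_ qi) h1 /le_trans /(_ qj) h2; move: h1 h2.
rewrite !tnth_mktuple /=; set s : R := tnth q ord0; clearbody s.
have : (i == ord0) != (j == ord0).
  by case: i ij {qi} => -[|[|//]] ?; case: j {qj} => -[|[|//]] ?.
clear q qi qj o0 eE; rewrite !ler_norml; case: (i == ord0); case: (j == ord0) => // _ /andP[? ?] /andP[? ?]; lra.
Qed.

(** * Discretisation *)

Section FiniteRange.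
Context d (T : measurableType d) (R : realType) (Om : finType) (W : T -> Om).
Hypothesis mW : forall om, measurable (W @^-1` [set om]).

Lemma measurable_preimage_fin (A : set Om) : measurable (W @^-1` A).
Proof.
have -> : W @^-1` A = \bigcup_(om in A) W @^-1` [set om].
  apply/seteqP; split => x /=; first by move=> Ax; exists (W x).
  by move=> [om Aom /= ->].
by apply: fin_bigcup_measurable => // om _; exact: mW.
Qed.

Lemma measurable_fun_fin d' (T' : measurableType d') (F : Om -> T') :
  measurable_fun setT (F \o W).
Proof.
move=> _ Y mY; rewrite setTI comp_preimage; exact: measurable_preimage_fin.
Qed.

Lemma integral_fin (P : probability T R) (F : Om -> R) : (forall om, 0 <= F om) ->
  (\int[P]_x (F (W x))%:E = \sum_om (F om)%:E * P (W @^-1` [set om]))%E.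
Proof.
move=> F0.
have E x : (F (W x))%:E = (\sum_om (F om)%:E * (\1_(W @^-1` [set om]) x)%:E)%E.
  rewrite (bigD1 (W x))//= big1 => [|om omW]; last first.
    rewrite indicE memNset ?mule0// => /= h; by rewrite h eqxx in omW.
  by rewrite indicE mem_set//= mule1 adde0.
under eq_integral do rewrite E.
rewrite ge0_integral_sum//.
- apply: eq_bigr => om _; rewrite ge0_integralZl//.
  + by rewrite integral_indic// setIT.
  + by apply/measurable_EFinP; exact: measurable_indic.
  + by rewrite lee_fin.
- move=> om; apply: measurable_funeM.
  by apply/measurable_EFinP; exact: measurable_indic.
- by move=> om x _; rewrite mule_ge0 ?lee_fin.
Qed.

End FiniteRange.

Section Grid.
Variables (R : realType) (p : nat) (L : R) (N : nat).
Hypothesis L0 : 0 < L.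
Local Notation I := {ffun 'I_p -> 'I_N.+1}.
Implicit Types (x y : 'pt[R]_p) (j : I).

Definition mesh : R := L / N.+1%:R.
Definition cell x : I := [ffun i => inord (Num.truncn ((tnth x i : R) / mesh))].
Definition corner j : 'pt[R]_p := [tuple ((j i)%:R * mesh : R) | i < p].
Definition box j : set 'pt[R]_p :=
  [set x | forall i, `[(j i)%:R * mesh, (j i).+1%:R * mesh[%classic (tnth x i : R)].
Definition slack : R := Num.sqrt p%:R * mesh.
(** A point is within [slack] of its corner, so this margin keeps every pair at distance at most 2
    adjacent. *)
Definition cell_adj : rel I := fun j j' => tdist L (corner j) (corner j') <= 2 + 2 * slack.

Lemma mesh_gt0 : 0 < mesh. Proof. by rewrite divr_gt0. Qed.

Lemma slack_ge0 : 0 <= slack. Proof. by rewrite mulr_ge0 ?sqrtr_ge0// ltW// mesh_gt0. Qed.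

Lemma measurable_box j : measurable (box j).
Proof.
rewrite (_ : box j = \bigcap_(i : 'I_p) (fun x : 'pt[R]_p => tnth x i) @^-1`
    (`[(j i)%:R * mesh, (j i).+1%:R * mesh[%classic : set (measurableTypeR R))); last first.
  by apply/seteqP; split => x /= H i; [move=> _; exact: H|exact: (H i)].
apply: fin_bigcap_measurable => // i _.
have := @measurable_tnth _ (measurableTypeR R) p i measurableT
   (`[(j i)%:R * mesh, (j i).+1%:R * mesh[%classic : set (measurableTypeR R)) _.
by rewrite setTI; apply; exact: measurable_itv.
Qed.

Let cell_coord x i : cube L x ->
  (cell x i)%:R * mesh <= tnth x i < (cell x i).+1%:R * mesh.
Proof.
move=> /(_ i) /andP[x0 xL]; have m0 := mesh_gt0.
have q0 : 0 <= (tnth x i : R) / mesh by rewrite divr_ge0// ltW.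
have /andP[t1 t2] := truncn_itv q0.
rewrite ffunE inordK; last first.
  rewrite -(ltr_nat R); apply: le_lt_trans t1 _.
  by rewrite ltr_pdivrMr// /mesh mulrCA divff ?mulr1// pnatr_eq0.
by rewrite -ler_pdivlMr// t1 -ltr_pdivrMr.
Qed.

Lemma cell_box x j : cube L x -> cell x = j <-> box j x.
Proof.
move=> xC; split=> [<- i|bx]; first by rewrite /= in_itv; exact: cell_coord.
apply/ffunP => i; apply/val_inj => /=; have /andP[a1 a2] := cell_coord i xC.
have := bx i; rewrite /= in_itv /= => /andP[b1 b2]; have m0 := mesh_gt0.
have := le_lt_trans a1 b2; have := le_lt_trans b1 a2.
by rewrite !ltr_pM2r// !ltr_nat; lia.
Qed.

Lemma tdist_corner x : cube L x -> tdist L x (corner (cell x)) <= slack.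
Proof.
move=> xC; apply: le_trans (tdist_le_enorm _ _ _) _.
apply: enorm_le_bound => i; rewrite tnth_mktuple.
have /andP[a1 a2] := cell_coord i xC.
rewrite ger0_norm ?subr_ge0// lerBlDl; apply: ltW.
by rewrite -natr1 mulrDl mul1r in a2.
Qed.

Lemma cell_adj_sym : symmetric cell_adj.
Proof. by move=> j j'; rewrite /cell_adj tdist_sym. Qed.

Lemma cell_adj_starfree (V : finType) (om : {ffun V -> I}) :
  starfree (gr cell_adj om) (kappa1 R p).
Proof.
move=> v S Sv indS.
have r0 : 0 < 2 + 2 * slack by have := slack_ge0; lra.
apply: (@separated_neighbours R p L L0 #|S| (2 + 2 * slack) (corner (om v))
   (fun i : 'I_#|S| => corner (om (enum_val i)))) => // [i|i i' ii'].
  have : enum_val i \in nbr (gr cell_adj om) [set: V]%SET v by apply: (fintype.subsetP Sv); exact: enum_valP.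
  by rewrite finset.in_set /gr => /andP[_ /andP[_]].
have := (indepP _ _ indS) (enum_val i) (enum_val i') (enum_valP i) (enum_valP i').
rewrite (inj_eq enum_val_inj) => /(_ ii'); rewrite /gr (inj_eq enum_val_inj) ii' /=.
by rewrite /cell_adj -ltNge.
Qed.

Lemma close_cell_adj x y : cube L x -> cube L y -> tdist L x y <= 2 ->
  cell_adj (cell x) (cell y).
Proof.
move=> xC yC xy; rewrite /cell_adj.
have h1 := tdist_corner xC; have h2 := tdist_corner yC.
apply: le_trans (tdist_triangle L0 _ x _) _; rewrite tdist_sym//.
have := tdist_triangle L0 x y (corner (cell y)); lra.
Qed.

Lemma cell_adj_close x y : cube L x -> cube L y ->
  cell_adj (cell x) (cell y) -> tdist L x y <= 2 + 4 * slack.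
Proof.
move=> xC yC; rewrite /cell_adj => xy.
have h1 := tdist_corner xC; have h2 := tdist_corner yC.
apply: le_trans (tdist_triangle L0 _ (corner (cell x)) _) _.
have := tdist_triangle L0 (corner (cell x)) (corner (cell y)) y.
by rewrite [tdist L (corner (cell y)) y]tdist_sym//; lra.
Qed.

End Grid.

Section GridLimit.
Variables (R : realType) (p : nat) (L : R).
Hypothesis L0 : 0 < L.
Implicit Types x y : 'pt[R]_p.

Lemma slack_small e : 0 < e -> exists N0, forall N, (N0 <= N)%N -> slack p L N < e.
Proof.
move=> e0; pose a := Num.sqrt p%:R * L / e.
have a0 : 0 <= a by rewrite divr_ge0 ?mulr_ge0 ?sqrtr_ge0// ltW.
exists (Num.truncn a) => N aN; rewrite /slack /mesh mulrA ltr_pdivrMr ?ltr0n//.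
rewrite -ltr_pdivrMl// mulrC; have /andP[_ +] := truncn_itv a0.
by move/lt_le_trans; apply; rewrite ler_nat.
Qed.

(** Pairs at distance exactly 2 are adjacent at every mesh, and farther pairs separate once
    [4 * slack] is below the excess; hence there is no exceptional set. *)
Lemma cell_adj_eventually x y : cube L x -> cube L y ->
  exists N0, forall N, (N0 <= N)%N ->
    cell_adj L (cell L N x) (cell L N y) = (tdist L x y <= 2).
Proof.
move=> xC yC; have [xy|xy] := boolP (tdist L x y <= 2).
  by exists 0%N => N _; exact: close_cell_adj.
rewrite -ltNge in xy.
have e0 : 0 < (tdist L x y - 2) / 4 by rewrite divr_gt0// subr_gt0.
have [N0 hN] := slack_small e0.
by exists N0 => N /hN sl; apply/negbTE/negP => /(cell_adj_close L0 xC yC); lra.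
Qed.

End GridLimit.

Lemma cvg_eventually_eq (R : realType) (u : nat -> R) (l : R) N0 :
  (forall N, (N0 <= N)%N -> u N = l) -> (fun N => (u N)%:E) @ \oo --> l%:E.
Proof.
move=> ul; apply: cvg_near_cst; exists N0 => // N /= h; by rewrite ul.
Qed.

Lemma cvg_integral_eventually d (T : measurableType d) (R : realType) (P : probability T R)
    (Z_ : nat -> T -> R) (Z : T -> R) (B : R) :
  (forall N, measurable_fun setT (Z_ N)) -> (forall N t, `|Z_ N t| <= B) ->
  (forall t, exists N0, forall N, (N0 <= N)%N -> Z_ N t = Z t) ->
  (fun N => \int[P]_t (Z_ N t)%:E)%E @ \oo --> (\int[P]_t (Z t)%:E)%E.
Proof.
move=> mZ ZB Zev; apply: (@dominated_cvg _ _ _ P setT _ _ _ (cst B%:E)) => //.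
- by move=> N; apply/measurable_EFinP.
- by move=> t _; have [N0 h] := Zev t; exact: cvg_eventually_eq h.
- exact: finite_measure_integrable_cst.
- by move=> N t _; rewrite lee_fin.
Qed.

Section Gridded.
Context (R : realType) (p : nat) (L : R) (L0 : 0 < L).
Context d (T : measurableType d) (P : probability T R).
Implicit Types X : T -> 'pt[R]_p.

(** Includes constant maps, so that a fixed point facing a random one is treated like two random
    points. *)
Definition gridded X := (forall t, cube L (X t)) /\
  forall N j, measurable ((cell L N \o X) @^-1` [set j]).

Lemma gridded_RV (X : {RV P >-> 'pt[R]_p}) : (forall t, cube L (X t)) -> gridded X.
Proof.
move=> XC; split => // N j.
have -> : (cell L N \o X) @^-1` [set j] = X @^-1` box L j.
  by apply/seteqP; split => t /= /(cell_box L0 _ (XC t)).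
have := measurable_funPT X measurableT _ (measurable_box L j).
by rewrite setTI.
Qed.

Lemma gridded_cst u : cube L u -> gridded (cst u).
Proof.
move=> uC; split=> // N j; have [e|e] := eqVneq (cell L N u) j.
  by rewrite (_ : _ @^-1` _ = setT)//; apply/seteqP; split.
rewrite (_ : _ @^-1` _ = set0)//; apply/seteqP; split => // t /= E.
by rewrite E eqxx in e.
Qed.

Variables X X' : T -> 'pt[R]_p.
Hypotheses (gX : gridded X) (gX' : gridded X').

Lemma measurable_cell_adj N : measurable [set t | cell_adj L (cell L N (X t)) (cell L N (X' t))].
Proof.
have [_ mX] := gX; have [_ mX'] := gX'.
have mW jj : measurable ((fun t => (cell L N (X t), cell L N (X' t))) @^-1` [set jj]).
  have -> : (fun t => (cell L N (X t), cell L N (X' t))) @^-1` [set jj] =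
      ((cell L N \o X) @^-1` [set jj.1]) `&` ((cell L N \o X') @^-1` [set jj.2]).
    by case: jj => j j'; apply/seteqP; split => t /=; [case=> -> ->|case=> -> ->].
  exact: measurableI.
exact: (measurable_preimage_fin mW [set jj | cell_adj L jj.1 jj.2]).
Qed.

(** Reduces measurability of the event to that of countably many cell events. *)
Lemma tdist_le2E : [set t | tdist L (X t) (X' t) <= 2] =
  \bigcap_N [set t | cell_adj L (cell L N (X t)) (cell L N (X' t))].
Proof.
have [XC _] := gX; have [XC' _] := gX'.
apply/seteqP; split => t /=; first by move=> h N _; exact: close_cell_adj.
move=> h; have [N0 hN] := cell_adj_eventually L0 (XC t) (XC' t).
by rewrite -(hN N0)//; exact: h.
Qed.

Lemma measurable_tdist_le2 : measurable [set t | tdist L (X t) (X' t) <= 2].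
Proof.
rewrite tdist_le2E; apply: bigcapT_measurable => N; exact: measurable_cell_adj.
Qed.

Lemma prob_cell_adj_cvg :
  (fun N => fine (P [set t | cell_adj L (cell L N (X t)) (cell L N (X' t))])) @ \oo -->
  fine (P [set t | tdist L (X t) (X' t) <= 2]).
Proof.
apply: fine_cvg; rewrite fineK ?fin_num_measure//; last exact: measurable_tdist_le2.
pose Z_ N t : R := \1_[set t | cell_adj L (cell L N (X t)) (cell L N (X' t))] t.
pose Z t : R := \1_[set t | tdist L (X t) (X' t) <= 2] t.
have := @cvg_integral_eventually _ T R P Z_ Z 1.
rewrite /Z integral_indic//; last exact: measurable_tdist_le2.
rewrite setIT (_ : (fun N => _) = fun N => P [set t | cell_adj L (cell L N (X t)) (cell L N (X' t))]); last first.
  by apply/funext => N; rewrite /Z_ integral_indic ?setIT//; exact: measurable_cell_adj.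
apply => [N|N t|t].
- by apply: measurable_indic; exact: measurable_cell_adj.
- by rewrite ger0_norm// /Z_ indicE lern1 leq_b1.
have [XC _] := gX; have [XC' _] := gX'.
have [N0 hN] := cell_adj_eventually L0 (XC t) (XC' t).
exists N0 => N /hN e; rewrite /Z_ !indicE; congr (nat_of_bool _)%:R.
by apply/idP/idP; rewrite !inE /= e.
Qed.

End Gridded.

(** * Passage from the grid to the random points *)

Section Model.
Context (R : realType) (p m : nat) (L : R) (L0 : 0 < L).
Context d (T : measurableType d) (P : probability T R).
Variable U : 'I_m -> {RV P >-> 'pt[R]_p}.
Hypotheses (hU : forall a t, cube L (U a t)) (hindep : mutually_independent U).
Local Notation V := 'I_m.
Local Notation I N := {ffun 'I_p -> 'I_N.+1}.
Local Notation pattern := {ffun V * V -> bool}.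

Definition cells N (t : T) : {ffun V -> I N} := [ffun a => cell L N (U a t)].
Definition cell_prob N (a : V) (j : I N) : R := fine (P (U a @^-1` box L j)).
(** Patterns take finitely many values at every mesh, and all degrees are functions of them. *)
Definition pat N (om : {ffun V -> I N}) : pattern := [ffun ab => cell_adj L (om ab.1) (om ab.2)].
Definition pattern_of (t : T) : pattern := [ffun ab => tdist L (U ab.1 t) (U ab.2 t) <= 2].

Let gU a : gridded L (U a). Proof. exact: gridded_RV. Qed.

Let mU N a (j : I N) : measurable (U a @^-1` box L j).
Proof. by have := measurable_funPT (U a) measurableT _ (measurable_box L j); rewrite setTI. Qed.

Let U_box N a (j : I N) : (cell L N \o U a) @^-1` [set j] = U a @^-1` box L j.
Proof. by apply/seteqP; split => t /= /(cell_box L0 _ (hU a t)). Qed.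

Lemma cell_probE N a (j : I N) : P (U a @^-1` box L j) = (cell_prob a j)%:E.
Proof. by rewrite /cell_prob fineK//; apply: fin_num_measure; exact: mU. Qed.

Lemma cell_prob_prob N : prob (cell_prob (N := N)).
Proof.
split=> [a j|a]; first by rewrite /cell_prob fine_ge0.
have [_ mc] := gU a; have := @integral_fin _ T R _ _ (mc N) P (fun=> 1) (fun=> ler01).
rewrite integral_cst// mul1e => h; have {}h := etrans (esym (@probability_setT _ _ _ P)) h.
apply: EFin_inj.
rewrite -sumEFin h; apply: eq_bigr => j _.
by rewrite mul1e U_box cell_probE.
Qed.

Lemma cells_law N om : P (cells N @^-1` [set om]) = (Pr (cell_prob (N := N)) om)%:E.
Proof.
have -> : cells N @^-1` [set om] = \bigcap_(a in [set` [set: V]%SET]) (U a @^-1` box L (om a)).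
  apply/seteqP; split => t /=.
    by move=> <- a _; apply/(cell_box L0 _ (hU a t)); rewrite ffunE.
  move=> h; apply/ffunP => a; rewrite ffunE; apply/(cell_box L0 _ (hU a t)).
  by apply: h; rewrite /= finset.in_setT.
rewrite hindep => [|a]; last exact: measurable_box.
rewrite /Pr -prodEFin; apply: eq_big => [a|a _]; first by rewrite finset.in_setT.
exact: cell_probE.
Qed.

Lemma measurable_cells N om : measurable (cells N @^-1` [set om]).
Proof.
have -> : cells N @^-1` [set om] = \bigcap_(a in [set: V]) (U a @^-1` box L (om a)).
  apply/seteqP; split => t /=.
    by move=> <- a _; apply/(cell_box L0 _ (hU a t)); rewrite ffunE.
  by move=> h; apply/ffunP => a; rewrite ffunE; apply/(cell_box L0 _ (hU a t)); exact: h.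
by apply: fin_bigcap_measurable => // a _; exact: mU.
Qed.

Lemma integral_cells N (F : {ffun V -> I N} -> R) : (forall om, 0 <= F om) ->
  (\int[P]_t (F (cells N t))%:E = (Ex (cell_prob (N := N)) F)%:E)%E.
Proof.
move=> F0; rewrite (integral_fin (@measurable_cells N))// /Ex -sumEFin.
by apply: eq_bigr => om _; rewrite cells_law -EFinM mulrC.
Qed.

Lemma measurable_pattern rho : measurable (pattern_of @^-1` [set rho]).
Proof.
pose S ab := [set t | tdist L (U ab.1 t) (U ab.2 t) <= 2].
have mS ab : measurable (S ab) by exact: measurable_tdist_le2.
have -> : pattern_of @^-1` [set rho] = \bigcap_(ab in [set: V * V])
    (if rho ab then S ab else ~` S ab).
  apply/seteqP; split => t /=.
    by move=> <- ab _; rewrite ffunE; case: ifP => /= [|/negbT/negP].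
  move=> h; apply/ffunP => ab; rewrite ffunE; have := h ab Logic.I.
  by case: (rho ab) => /=; [|move/negP/negbTE].
apply: fin_bigcap_measurable => // ab _; case: ifP => _ //.
exact: measurableC.
Qed.

Definition pat_mean (F : pattern -> R) : R :=
  \sum_rho F rho * fine (P (pattern_of @^-1` [set rho])).

Lemma integral_pattern (F : pattern -> R) : (forall rho, 0 <= F rho) ->
  (\int[P]_t (F (pattern_of t))%:E = (pat_mean F)%:E)%E.
Proof.
move=> F0; rewrite (integral_fin measurable_pattern)// /pat_mean -sumEFin.
apply: eq_bigr => rho _; rewrite EFinM fineK// fin_num_measure//.
exact: measurable_pattern.
Qed.

(** For each outcome the finitely many adjacencies stabilise, and [F] is bounded: dominated
    convergence. *)
Lemma pat_mean_cvg (F : pattern -> R) : (forall rho, 0 <= F rho) ->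
  (fun N => Ex (cell_prob (N := N)) (fun om => F (pat om))) @ \oo --> pat_mean F.
Proof.
move=> F0.
have := @cvg_integral_eventually _ T R P (fun N t => F (pat (cells N t)))
  (fun t => F (pattern_of t)) (\sum_rho F rho) _ _ _.
rewrite integral_pattern// (_ : (fun N => _) =
    fun N => (Ex (cell_prob (N := N)) (fun om => F (pat om)))%:E); last first.
  by apply/funext => N; rewrite (integral_cells (F := fun om => F (pat om))).
move=> h; apply: (fine_cvg (h _ _ _)) => [N|N t|t].
- exact: (measurable_fun_fin (@measurable_cells N) (fun om => F (pat om))).
- by rewrite ger0_norm// (bigD1 (pat (cells N t)))//= lerDl sumr_ge0.
have /choice[n nP] : forall ab : V * V, exists n, forall N, (n <= N)%N ->
    cell_adj L (cell L N (U ab.1 t)) (cell L N (U ab.2 t)) = (tdist L (U ab.1 t) (U ab.2 t) <= 2).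
  by move=> ab; exact: cell_adj_eventually.
exists (\max_ab n ab) => N hN; congr F; apply/ffunP => ab; rewrite !ffunE.
by apply: nP; apply: leq_trans hN; exact: leq_bigmax.
Qed.

Lemma mgf_limit (Y : pattern -> R) (r th : R) : (forall rho, 0 <= Y rho) ->
  (forall N, mgf (fun om => Y (pat om)) (cell_prob (N := N)) th <=
     expR (Ex (cell_prob (N := N)) (fun om => Y (pat om)) * r)) ->
  pat_mean (fun rho => expR (th * Y rho)) <= expR (pat_mean Y * r).
Proof.
move=> Y0 h.
have c1 := pat_mean_cvg (fun rho => expR_ge0 (th * Y rho)).
have c2 : (fun N => expR (Ex (cell_prob (N := N)) (fun om => Y (pat om)) * r)) @ \oo -->
    expR (pat_mean Y * r).
  apply: continuous_cvg; first exact: continuous_expR.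
  apply: cvgM; [exact: pat_mean_cvg|exact: cvg_cst].
by apply: ler_cvg_to c1 c2 _; near=> N; exact: h.
Unshelve. all: by end_near.
Qed.

End Model.

(** * The mean *)

Section PoissonBinomial.
Variables (R : realType) (V : finType).
Implicit Types (r : V -> R) (g : nat -> R) (J s : {set V}).

(* The mean of [g] of the number of successes in independent trials, indexed
   by [J], with success probabilities [r]. *)
Definition pb_mean g J r : R := \sum_(s : {set V} | (s \subset J)%SET)
  g #|s| * ((\prod_(j in s) r j) * \prod_(j in (J :\: s)%SET) (1 - r j)).

Lemma q_eqE J r (k : int) : q_eq J r k = pb_mean (fun n => (n%:Z == k)%:R) J r.
Proof.
rewrite /q_eq /pb_mean [RHS]big_mkcond [LHS]big_mkcond; apply: eq_bigr => s _.
by case: (s \subset J)%SET => //=; case: ifP; rewrite ?mul1r ?mul0r.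
Qed.

Lemma q_geE J r (k : int) : q_ge J r k = pb_mean (fun n => (k <= n%:Z)%R%:R) J r.
Proof.
rewrite /q_ge /q_eq (exchange_big_dep (fun s : {set V} => s \subset J)%SET) /=; last first.
  by move=> i s _ /andP[].
apply: eq_bigr => s sJ; have sz : (#|s| < #|J|.+1)%N by rewrite ltnS subset_leq_card.
have [ks|ks] := boolP (k <= #|s|%:Z); last first.
  rewrite mul0r big1// => i /andP[ki /andP[_ /eqP si]].
  by rewrite -si (negbTE ks) in ki.
rewrite mul1r (big_pred1 (Ordinal sz))// => i /=; rewrite sJ /=.
apply/andP/eqP => [[_ /eqP[e]]|->]; last by rewrite ks eqxx.
by apply/val_inj.
Qed.

Lemma pb_mean_itv g J r : (forall n, 0 <= g n <= 1) -> (forall v, 0 <= r v <= 1) ->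
  0 <= pb_mean g J r <= #|{set V}|%:R.
Proof.
move=> g01 r01.
have t01 s : 0 <= g #|s| * ((\prod_(j in s) r j) * \prod_(j in (J :\: s)%SET) (1 - r j)) <= 1.
  have h1 : 0 <= \prod_(j in s) r j <= 1.
    by apply/andP; split; [apply: prodr_ge0 => j _; have /andP[] := r01 j|
      apply: prodr_ile1 => j _; exact: r01].
  have h2 : 0 <= \prod_(j in (J :\: s)%SET) (1 - r j) <= 1.
    have h j : 0 <= 1 - r j <= 1 by have /andP[? ?] := r01 j; apply/andP; split; lra.
    by apply/andP; split; [apply: prodr_ge0 => j _; have /andP[] := h j|
      apply: prodr_ile1 => j _; exact: h].
  have /andP[? ?] := g01 #|s|; have /andP[? ?] := h1; have /andP[? ?] := h2.
  by rewrite !mulr_ge0//= mulr_ile1// ?mulr_ge0// mulr_ile1.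
apply/andP; split; first by apply: sumr_ge0 => s _; have /andP[] := t01 s.
rewrite /pb_mean big_mkcond; apply: (@le_trans _ _ (\sum_(s : {set V}) 1)).
  by apply: ler_sum => s _; case: ifP => // _; have /andP[] := t01 s.
by rewrite sumr_const.
Qed.

Lemma pb_mean_cvg g J (r_ : nat -> V -> R) r : (forall v, r_ ^~ v @ \oo --> r v) ->
  (fun N => pb_mean g J (r_ N)) @ \oo --> pb_mean g J r.
Proof.
move=> rc; apply: cvg_big => [|s _]; first exact: add_continuous.
apply: cvgM; first exact: cvg_cst.
apply: cvgM; (apply: cvg_big => [|j _]; first exact: mul_continuous).
  exact: rc.
by apply: cvgB; [exact: cvg_cst|exact: rc].
Qed.

Variables (I : finType) (p : V -> I -> R) (xi : V -> pred I).
Hypothesis pp : prob p.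

Lemma Ex_hitset s : Ex p (fun om => ([set v | xi v (om v)]%SET == s)%:R) =
  \prod_v (if v \in s then \sum_i p v i * (xi v i)%:R else 1 - \sum_i p v i * (xi v i)%:R).
Proof.
transitivity (\prod_v \sum_i p v i * (xi v i == (v \in s))%:R).
  rewrite bigA_distr_bigA /=; apply: eq_bigr => om _; rewrite big_split /=.
  congr (_ * _); have [/eqP hs|hs] := boolP ([set v | xi v (om v)]%SET == s).
    by rewrite big1// => v _; rewrite -hs finset.in_set eqxx.
  have [v hv|all] := pickP (fun v => xi v (om v) != (v \in s)).
    by rewrite (bigD1 v)//= (negbTE hv) mul0r.
  exfalso; move/negP: hs; apply; apply/eqP/finset.setP => v; rewrite finset.in_set.
  by have /negbFE/eqP := all v.
apply: eq_bigr => v _; have [_ p1] := pp; case: (v \in s).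
  by apply: eq_bigr => i _; case: (xi v i).
rewrite (_ : 1 - _ = \sum_i (p v i - p v i * (xi v i)%:R)); last by rewrite sumrB p1.
apply: eq_bigr => i _.
by case: (xi v i); rewrite ?mulr1 ?mulr0 ?subrr ?subr0.
Qed.

(** The coordinate [a] succeeds with probability 0, so hit sets containing [a] have no weight and
    its factor is 1 in the others. *)
Lemma Ex_hits g (a : V) : (forall i, ~~ xi a i) ->
  Ex p (fun om => g (hits xi om)) =
  pb_mean g [set b | b != a]%SET (fun v => \sum_i p v i * (xi v i)%:R).
Proof.
move=> xia; set r := (X in pb_mean _ _ X).
rewrite (@eq_Ex _ _ _ p _ (fun om => \sum_(s : {set V})
    g #|s| * ([set v | xi v (om v)]%SET == s)%:R)); last first.
  move=> om; rewrite (bigD1 [set v | xi v (om v)]%SET)//= eqxx mulr1 big1 ?addr0//.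
  by move=> s /negbTE; rewrite eq_sym => ->; rewrite mulr0.
rewrite Ex_sum /pb_mean [RHS]big_mkcond; apply: eq_bigr => s _.
rewrite ExZ Ex_hitset -/(r _).
have ra : r a = 0 by rewrite /r big1// => i _; rewrite (negbTE (xia i)) mulr0.
have [sJ|sJ] := boolP (s \subset [set b | b != a]%SET)%SET; last first.
  have as_ : a \in s.
    apply: contraNT sJ => nas; apply/fintype.subsetP => b bs; rewrite finset.in_set.
    by apply: contraNneq nas => <-.
  by rewrite (bigD1 a)//= as_ -/(r a) ra mul0r mulr0.
congr (_ * _); rewrite (bigID (fun v => v \in s)) /=; congr (_ * _).
  by apply: eq_bigr => v vs; rewrite vs.
have nas : a \notin s.
  by apply/negP => /(fintype.subsetP sJ); rewrite finset.in_set eqxx.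
rewrite (bigD1 a)//= (negbTE nas) -/(r a) ra subr0 mul1r.
apply: eq_big => [v|v /andP[vs _]]; last by rewrite (negbTE vs).
by rewrite !finset.inE.
Qed.

End PoissonBinomial.

Section MeanFormula.
Context (R : realType) (p m : nat) (L : R) (L0 : 0 < L).
Context d (T : measurableType d) (P : probability T R).
Variable U : 'I_m -> {RV P >-> 'pt[R]_p}.
Hypotheses (hU : forall a t, cube L (U a t)) (hindep : mutually_independent U).
Variables (a : 'I_m) (f : 'pt[R]_p -> R).
Hypotheses (hf : has_density (U a) (cube L) f) (f0 : forall u, cube L u -> 0 < f u).

Lemma measurable_cube : measurable (cube L : set 'pt[R]_p).
Proof.
rewrite (_ : cube L = \bigcap_(i : 'I_p) (fun x : 'pt[R]_p => tnth x i) @^-1`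
    (`[0, L[%classic : set (measurableTypeR R))); last first.
  by apply/seteqP; split => x /= H i; [move=> _|]; have := H i; rewrite /= in_itv//=; apply.
apply: fin_bigcap_measurable => // i _.
have := @measurable_tnth _ (measurableTypeR R) p i measurableT
   (`[0, L[%classic : set (measurableTypeR R)) _.
by rewrite setTI; apply; exact: measurable_itv.
Qed.

Let cell_step N (phi : {ffun 'I_p -> 'I_N.+1} -> R) u : cube L u ->
  phi (cell L N u) = \sum_j phi j * \1_(box L j) u.
Proof.
move=> uC; rewrite (bigD1 (cell L N u))//= big1 ?addr0 => [|j jN].
  by rewrite indicE mem_set ?mulr1//; exact/(cell_box L0 _ uC).
rewrite indicE memNset ?mulr0// => /(cell_box L0 _ uC) E.
by rewrite E eqxx in jN.
Qed.

Lemma integral_cell_density N (phi : {ffun 'I_p -> 'I_N.+1} -> R) : (forall j, 0 <= phi j) ->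
  (\int[leb R p]_(u in cube L) (phi (cell L N u) * f u)%:E =
   (\sum_j cell_prob L U a j * phi j)%:E)%E.
Proof.
move=> phi0; have [mf fP] := hf; have mC := measurable_cube.
rewrite (eq_integral (fun u => (\sum_j (phi j)%:E * ((EFin \o f) \_ (box L j) u))%E)); last first.
  move=> u /set_mem uC; rewrite cell_step// mulr_suml -sumEFin; apply: eq_bigr => j _.
  rewrite patchE indicE; case: (u \in box L j); rewrite ?mulr1 ?mulr0 ?mul0r ?mule0//.
have mfj N' (j : {ffun 'I_p -> 'I_N'.+1}) : measurable_fun (cube L) ((EFin \o f) \_ (box L j)).
  apply/measurable_restrict => //; first exact: measurable_box.
  apply: measurable_funS mC _ _ ; first exact: subIsetl.
  exact/measurable_EFinP.
have fj0 N' (j : {ffun 'I_p -> 'I_N'.+1}) u : cube L u -> (0 <= ((EFin \o f) \_ (box L j)) u)%E.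
  by move=> uC; rewrite patchE; case: ifP => // _; rewrite lee_fin ltW// f0.
rewrite ge0_integral_sum//; last 2 first.
- by move=> j; apply: measurable_funeM; exact: mfj.
- by move=> j u uC; rewrite mule_ge0 ?lee_fin// fj0.
rewrite -sumEFin; apply: eq_bigr => j _; rewrite ge0_integralZl//;
  [|by move=> u; exact: fj0|by rewrite lee_fin phi0].
rewrite -integral_mkcondr setIC -fP; last exact: measurable_box.
by rewrite cell_probE -EFinM mulrC.
Qed.

Lemma measurable_cell_density N (phi : {ffun 'I_p -> 'I_N.+1} -> R) :
  measurable_fun (cube L) (fun u => (phi (cell L N u) * f u)%:E).
Proof.
have [mf _] := hf; have mC := measurable_cube.
apply: (eq_measurable_fun (fun u => ((\sum_j phi j * \1_(box L j) u) * f u)%:E)).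
  by move=> u /set_mem uC; rewrite cell_step.
apply/measurable_EFinP; apply: measurable_funM => //.
apply: measurable_sum => j; apply: measurable_funM => //.
by apply: measurable_indic; exact: measurable_box.
Qed.

Definition pat_deg (rho : {ffun 'I_m * 'I_m -> bool}) (b : 'I_m) : nat :=
  #|[set c | (b != c) && rho (b, c)]%SET|.

Lemma pat_degE N (om : {ffun 'I_m -> {ffun 'I_p -> 'I_N.+1}}) b :
  pat_deg (pat L om) b = deg (@cell_adj R p L N) om b.
Proof.
rewrite /pat_deg /deg /nbr; apply: eq_card => c; rewrite !finset.in_set /gr.
by rewrite /= ffunE.
Qed.

Let near_prob N (j : {ffun 'I_p -> 'I_N.+1}) b :=
  \sum_i cell_prob L U b i * (cell_adj L j i)%:R.

Let near_probE N (j : {ffun 'I_p -> 'I_N.+1}) b :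
  near_prob j b = fine (P [set t | cell_adj L j (cell L N (U b t))]).
Proof.
have [_ mc] := gridded_RV L0 (hU b).
have mA : measurable [set t | cell_adj L j (cell L N (U b t))].
  exact: (measurable_preimage_fin (mc N) [set i | cell_adj L j i]).
have h := integral_fin (mc N) P (F := fun i => (cell_adj L j i)%:R) (fun i => ler0n _ _).
have e : (\int[P]_t (cell_adj L j ((cell L N \o U b) t))%:R%:E =
    P [set t | cell_adj L j (cell L N (U b t))])%E.
  rewrite -[X in _ = P X]setIT -integral_indic//; apply: eq_integral => t _.
  rewrite indicE; congr (_%:R)%:E; congr nat_of_bool.
  by apply/idP/idP; rewrite inE.
rewrite -e h /near_prob; apply: EFin_inj; rewrite fineK; last first.
  by rewrite -h e fin_num_measure.
rewrite -sumEFin; apply: eq_bigr => i _; rewrite EFinM -cell_probE muleC.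
congr (_ * P _)%E; apply/seteqP; split => t /=.
  by move/(cell_box L0 _ (hU b t)).
by move/(cell_box L0 _ (hU b t)).
Qed.

Let near_prob_itv N (j : {ffun 'I_p -> 'I_N.+1}) b : 0 <= near_prob j b <= 1.
Proof.
rewrite near_probE fine_ge0//= -lee_fin fineK ?probability_le1//.
  exact: (measurable_preimage_fin (proj2 (gridded_RV L0 (hU b)) N) [set i | cell_adj L j i]).
apply: fin_num_measure.
exact: (measurable_preimage_fin (proj2 (gridded_RV L0 (hU b)) N) [set i | cell_adj L j i]).
Qed.

Let eq_pb_mean g (J : {set 'I_m}) (r r' : 'I_m -> R) :
  (forall j, j \in J -> r j = r' j) -> pb_mean g J r = pb_mean g J r'.
Proof.
move=> e; apply: eq_bigr => s /fintype.subsetP sJ; congr (_ * (_ * _)).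
  by apply: eq_bigr => j /sJ /e ->.
by apply: eq_bigr => j; rewrite finset.inE => /andP[_ /e ->].
Qed.

Let J := [set b | b != a]%SET.

Let Ex_deg N (g : nat -> R) : Ex (cell_prob L U (N := N)) (fun om => g (pat_deg (pat L om) a)) =
  \sum_(j : {ffun 'I_p -> 'I_N.+1}) cell_prob L U a j * pb_mean g J (near_prob j).
Proof.
have pp := cell_prob_prob L0 hU N.
rewrite (Ex_upd _ a pp); apply: eq_bigr => j _; congr (_ * _).
rewrite (@eq_Ex _ _ _ _ _ (fun om => g (hits (nearby (@cell_adj R p L N) a j) om))); last first.
  by move=> om; rewrite pat_degE deg_upd.
rewrite (Ex_hits pp g (a := a)); last by move=> i; rewrite /nearby eqxx.
apply: eq_pb_mean => b; rewrite finset.in_set => ba; apply: eq_bigr => i _.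
by rewrite /nearby ba.
Qed.

(** On the grid, conditioning on the cell of [U a] gives a Poisson-binomial mean integrated against
    [f]. Both sides converge with the mesh, the integrands being dominated by [2 ^ m * f]. *)
Lemma pat_mean_deg (g : nat -> R) : (forall k, 0 <= g k <= 1) ->
  ((pat_mean L U (fun rho => g (pat_deg rho a)))%:E =
   \int[leb R p]_(u in cube L) (pb_mean g J (p_near L U u) * f u)%:E)%E.
Proof.
move=> g01; have [mf fP] := hf; have mC := measurable_cube.
have c1 := pat_mean_cvg L0 hU hindep (F := fun rho => g (pat_deg rho a))
  (fun rho => proj1 (andP (g01 (pat_deg rho a)))).
have {}c1 : (fun N => (Ex (cell_prob L U (N := N)) (fun om => g (pat_deg (pat L om) a)))%:E)
    @ \oo --> (pat_mean L U (fun rho => g (pat_deg rho a)))%:E.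
  by apply: cvg_EFin; [exact: nearW|exact: c1].
pose h N (j : {ffun 'I_p -> 'I_N.+1}) := pb_mean g J (near_prob j).
have h01 N j : 0 <= @h N j <= #|{set 'I_m}|%:R by apply: pb_mean_itv.
have e N : (Ex (cell_prob L U (N := N)) (fun om => g (pat_deg (pat L om) a)))%:E =
    (\int[leb R p]_(u in cube L) (h N (cell L N u) * f u)%:E)%E.
  rewrite Ex_deg integral_cell_density// => j.
  by have /andP[] := h01 _ j.
have c2 : (fun N => \int[leb R p]_(u in cube L) (h N (cell L N u) * f u)%:E)%E @ \oo -->
    (\int[leb R p]_(u in cube L) (pb_mean g J (p_near L U u) * f u)%:E)%E.
  apply: (@dominated_cvg _ _ _ (leb R p) (cube L) mC _ _
     (fun u => (#|{set 'I_m}|%:R * f u)%:E)).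
  - by move=> N; exact: measurable_cell_density.
  - move=> u uC; apply: cvg_EFin; first by near=> N.
    apply: cvgM; last exact: cvg_cst.
    apply: pb_mean_cvg => b.
    rewrite (_ : (fun N => _) = fun N => fine (P [set t | cell_adj L (cell L N u) (cell L N (U b t))])); last first.
      by apply/funext => N; rewrite near_probE.
    have gu : gridded L (cst u : T -> _) by exact: gridded_cst.
    exact: (prob_cell_adj_cvg (P := P) L0 gu (gridded_RV L0 (hU b))).
  - done.
  - rewrite (_ : (fun u => _) = (fun u => (#|{set 'I_m}|%:R)%:E * (EFin \o f) u)%E).
      apply: (integrableZl mC).
      apply/integrableP; split; first exact/measurable_EFinP.
      rewrite (eq_integral (EFin \o f)); last first.
        by move=> u /set_mem uC /=; rewrite ger0_norm// ltW// f0.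
      have := fP _ measurableT; rewrite setTI preimage_setT probability_setT => <-.
      exact: ltry.
    by apply/funext => u; rewrite EFinM.
  - move=> N u uC; rewrite lee_fin normrM (ger0_norm (ltW (f0 uC))).
    have /andP[h0 h1] := h01 N (cell L N u).
    by rewrite ger0_norm// ler_wpM2r// ltW// f0.
rewrite -(funext e) in c2.
exact: (cvg_unique _ c1 c2).
Unshelve. all: by end_near.
Qed.

End MeanFormula.

(** * Tail estimates *)

Section ExpBounds.
Variable R : realType.
Implicit Types x : R.

Let derive_ge0 (f f' : R -> R) x : (forall t : R, is_derive t 1 f (f' t)) ->
  (forall t, 0 <= t -> 0 <= f' t) -> 0 <= x -> f 0 <= f x.
Proof.
move=> df f0 x0; rewrite -subr_ge0.
have cf : {within `[0, x], continuous f}.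
  by apply: derivable_within_continuous => t _; exact: ex_derive.
have [c] := MVT_segment x0 (fun t _ => df t) cf.
by rewrite in_itv/= => /andP[c0 _] ->; rewrite mulr_ge0 ?f0// subr0.
Qed.

Lemma expR_ge1Dx2 x : 0 <= x -> 1 + x + x ^+ 2 / 2 <= expR x.
Proof.
move=> x0; rewrite -subr_ge0.
have := @derive_ge0 (fun t => expR t - (1 + t + t ^+ 2 / 2)) (fun t => expR t - (1 + t)) x.
rewrite expR0 addr0 expr0n mul0r addr0 subrr; apply => // t.
  by apply: is_derive_eq; rewrite /GRing.scale/=; field.
by rewrite subr_ge0 => _; exact: expR_ge1Dx.
Qed.

(** The right side times [1 + x + x ^+ 2 / 2], itself at most [exp x], equals [1 + x ^+ 4 / 4]. *)
Lemma expRN_le x : 0 <= x -> expR (- x) <= 1 - x + x ^+ 2 / 2.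
Proof.
move=> x0; rewrite expRN -[leLHS]mul1r ler_pdivrMr ?expR_gt0//.
apply: (@le_trans _ _ ((1 - x + x ^+ 2 / 2) * (1 + x + x ^+ 2 / 2))).
  have -> : (1 - x + x ^+ 2 / 2) * (1 + x + x ^+ 2 / 2) = 1 + (x ^+ 2 / 2) ^+ 2 by field.
  by rewrite lerDl sqr_ge0.
rewrite ler_wpM2l ?expR_ge1Dx2//.
have -> : 1 - x + x ^+ 2 / 2 = ((1 - x) ^+ 2 + 1) / 2 by field.
by rewrite divr_ge0// addr_ge0// sqr_ge0.
Qed.

(* Bernstein's bound on the Poisson exponent, cleared of its denominator. *)
Lemma bernstein_expR x : 0 <= x -> (1 - x / 3) * (expR x - 1 - x) <= x ^+ 2 / 2.
Proof.
move=> x0; rewrite -subr_ge0.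
have psi_ge0 (t : R) : 0 <= t -> 0 <= t + 2 + (t - 2) * expR t.
  move=> t0; have := @derive_ge0 (fun t => t + 2 + (t - 2) * expR t)
    (fun t => 1 + (t - 1) * expR t) t.
  rewrite expR0 mulr1 sub0r add0r subrr; apply => // s.
    by apply: is_derive_eq; rewrite /GRing.scale/=; ring.
  move=> _; have := expR_ge1Dx (- s); rewrite expRN.
  rewrite -[_ <= _^-1](ler_pM2r (expR_gt0 s)) mulVf ?gt_eqF ?expR_gt0//; lra.
have := @derive_ge0 (fun t => t ^+ 2 / 2 - (1 - t / 3) * (expR t - 1 - t))
  (fun t => (t + 2 + (t - 2) * expR t) / 3) x.
have -> : 0 ^+ 2 / 2 - (1 - 0 / 3) * (expR 0 - 1 - 0) = 0 :> R.
  by rewrite expR0 expr0n !mul0r !subr0 subrr mulr0 subrr.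
apply => // t.
  by apply: is_derive_eq; rewrite /GRing.scale/=; field.
by move=> t0; rewrite divr_ge0// psi_ge0.
Qed.

End ExpBounds.

Section Tails.
Context d (T : measurableType d) (R : realType) (P : probability T R).
Variables (Y : T -> R) (mu c : R).
Hypotheses (mY : measurable_fun setT Y) (mu0 : 0 < mu) (c0 : 0 < c).
Hypothesis mgfY : forall th,
  (\int[P]_x (expR (th * Y x))%:E <= (expR (mu * rate c th))%:E)%E.

(** Markov's inequality at [th = eta / c]: the Chernoff exponent of a Poisson variable of mean [mu],
    divided by [c]. *)
Let chernoff eta s (A : set T) : measurable A ->
  (forall x, A x -> eta * s <= eta * Y x) ->
  (P A <= (expR ((mu * (expR eta - 1) - eta * s) / c))%:E)%E.
Proof.
move=> mA AY; pose th := eta / c.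
have E x : (expR (th * (Y x - s)))%:E = ((expR (- (th * s)))%:E * (expR (th * Y x))%:E)%E.
  by rewrite -EFinM -expRD; congr (expR _)%:E; ring.
have mE : measurable_fun setT (fun x => (expR (th * Y x))%:E).
  apply/measurable_EFinP; apply: measurableT_comp; first exact: measurable_expR.
  exact: measurable_funM.
apply: (@le_trans _ _ (\int[P]_x (expR (th * (Y x - s)))%:E)%E).
  rewrite -[X in (P X <= _)%E]setIT -integral_indic//; apply: ge0_le_integral => //.
  - by apply/measurable_EFinP; exact: measurable_indic.
  - under eq_fun do rewrite E; exact: measurable_funeM.
  move=> x _; rewrite lee_fin indicE; have [/set_mem /AY h|_] := boolP (x \in A).
    have -> : th * (Y x - s) = (eta * Y x - eta * s) / c by rewrite /th; ring.
    apply: (@le_trans _ _ (expR 0)); first by rewrite expR0.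
    by rewrite ler_expR divr_ge0 ?subr_ge0// ltW.
  exact: expR_ge0.
under eq_integral do rewrite E.
rewrite ge0_integralZl//.
apply: (@le_trans _ _ ((expR (- (th * s)))%:E * (expR (mu * rate c th))%:E)%E).
  by apply: lee_wpmul2l; rewrite ?lee_fin ?expR_ge0//; exact: mgfY.
rewrite -EFinM -expRD lee_fin ler_expR le_eqVlt; apply/orP; left; apply/eqP.
have ce : c * th = eta by rewrite /th mulrC divfK// gt_eqF.
by rewrite /rate ce /th; field; rewrite gt_eqF.
Qed.

Let mle s : measurable [set x | Y x - mu <= s].
Proof.
rewrite (_ : mkset _ = Y @^-1` `]-oo, mu + s]%classic).
  by have := mY measurableT (measurable_itv `]-oo, mu + s]); rewrite setTI.
by apply/seteqP; split => x /=; rewrite in_itv/= lerBlDl.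
Qed.

Let mge s : measurable [set x | s <= Y x - mu].
Proof.
rewrite (_ : mkset _ = Y @^-1` `[mu + s, +oo[%classic).
  by have := mY measurableT (measurable_itv `[mu + s, +oo[); rewrite setTI.
by apply/seteqP; split => x /=; rewrite in_itv/= andbT lerBrDl.
Qed.

Let upper eta t : 0 <= eta -> (P [set x | (t <= Y x - mu)%R] <=
  (expR ((mu * (expR eta - 1) - eta * (mu + t)) / c))%:E)%E.
Proof.
move=> e0; apply: chernoff; first exact: mge.
by move=> x /=; rewrite lerBrDl => h; exact: ler_wpM2l.
Qed.

Let lower eta t : eta <= 0 -> (P [set x | (Y x - mu <= t)%R] <=
  (expR ((mu * (expR eta - 1) - eta * (mu + t)) / c))%:E)%E.
Proof.
move=> e0; apply: chernoff; first exact: mle.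
by move=> x /=; rewrite lerBlDl => h; exact: ler_wnM2l.
Qed.

(** The value of the exponent at its minimiser [eta = ln ((mu + t) / mu)]. *)
Let bennettE t : 0 < mu + t ->
  expR ((mu * (expR (ln ((mu + t) / mu)) - 1) - ln ((mu + t) / mu) * (mu + t)) / c) =
  (mu / (mu + t)) `^ ((t + mu) / c) * expR (t / c).
Proof.
move=> mt0; have q0 : 0 < (mu + t) / mu by rewrite divr_gt0.
rewrite lnK ?posrE// -[mu / (mu + t)]invf_div /powR gt_eqF ?invr_gt0//.
rewrite lnV ?posrE// -expRD; congr expR; field; by rewrite !gt_eqF.
Qed.

Let bernstein t : 0 < t -> (P [set x | (t <= Y x - mu)%R] <=
  (expR (- (t ^+ 2 / (2 * c * mu + 2 * c * t / 3))))%:E)%E.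
Proof.
move=> t0; have q0 : 0 < mu + t / 3 by rewrite addr_gt0// divr_gt0.
(* Chosen so that [(1 - eta / 3) * (mu + t / 3) = mu], which matches the factor in
   [bernstein_expR]. *)
set eta := t / (mu + t / 3); have e0 : 0 < eta by rewrite divr_gt0.
apply: le_trans (upper t (ltW e0)) _; rewrite lee_fin ler_expR.
have b := bernstein_expR (ltW e0).
have E1 : (1 - eta / 3) * (mu + t / 3) = mu by rewrite /eta; field; rewrite gt_eqF//; lra.
have E2 : eta * (mu + t / 3) = t by rewrite /eta divfK// gt_eqF.
have h : mu * (expR eta - 1 - eta) <= eta * t / 2.
  rewrite -[X in X * _]E1 -[X in _ <= _ * X / 2]E2 mulrAC.
  have -> : eta * (eta * (mu + t / 3)) / 2 = eta ^+ 2 / 2 * (mu + t / 3) by ring.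
  by rewrite ler_pM2r.
have -> : 2 * c * mu + 2 * c * t / 3 = 2 * c * (mu + t / 3) by field.
have -> : - (t ^+ 2 / (2 * c * (mu + t / 3))) = - (eta * t / 2) / c.
  by rewrite /eta; field; rewrite (gt_eqF c0) gt_eqF//; lra.
rewrite ler_pM2r ?invr_gt0//; lra.
Qed.

Lemma concentration_of_mgf : concentration P Y mu c.
Proof.
split.
(* This [eta] is optimal after [exp] is replaced by its quadratic bound. *)
- move=> t t0; apply: le_trans (lower (eta := - (t / mu)) (- t) _) _.
    by rewrite oppr_le0 divr_ge0// ltW.
  rewrite lee_fin ler_expR; have := expRN_le (divr_ge0 (ltW t0) (ltW mu0)).
  set eta := t / mu; have E : eta * mu = t by rewrite /eta divfK// gt_eqF.
  move=> h; have -> : - (t ^+ 2 / (2 * c * mu)) = (- (eta * t / 2)) / c.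
    by rewrite /eta; field; rewrite !gt_eqF.
  rewrite ler_pM2r ?invr_gt0//.
  have := ler_wpM2l (ltW mu0) h.
  have -> : mu * (1 - eta + eta ^+ 2 / 2) = mu - t + eta * t / 2 by rewrite -E; field.
  have : eta * mu = t by []. nra.
(* Weaker than the Bernstein bound, as [2 / 3 <= 1]. *)
- move=> t t0; apply: le_trans (bernstein t0) _; rewrite lee_fin ler_expR lerN2.
  have h : 0 < 2 * c * mu by rewrite !mulr_gt0.
  have h' : 0 < c * t by rewrite mulr_gt0.
  rewrite ler_wpM2l ?sqr_ge0// lef_pV2 ?posrE; lra.
- split=> [t t0|t /andP[]].
    rewrite -bennettE ?ltr_wpDr//; apply: upper.
    by rewrite ln_ge0// ler_pdivlMr// mul1r lerDl.
  rewrite le_eqVlt => /predU1P[<- _|mt t0]; last first.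
    have mt0 : 0 < mu + t by rewrite -ltrBlDl sub0r.
    rewrite -bennettE//; apply: lower; apply: ln_le0.
    by rewrite ler_pdivrMr// mul1r gerDl.
  (* At [t = - mu] the optimal [eta] is minus infinity. A probability above [exp (- mu / c)] by a
     factor [exp de] is refuted by [eta = ln z] with [z] small. *)
  rewrite subrr invr0 mulr0 addNr mul0r powRr0 mul1r mulNr.
  have mA := mle (- mu).
  rewrite -[P _]fineK ?fin_num_measure// lee_fin leNgt; apply/negP => lt.
  set q := fine _ in lt; have q0 : 0 < q := lt_trans (expR_gt0 _) lt.
  pose de := mu / c + ln q.
  have de0 : 0 < de.
    by rewrite /de -ltrBlDl sub0r -ltr_expR lnK.
  have h eta : eta <= 0 -> de <= mu * expR eta / c.
    move=> /(lower (- mu)); rewrite -[P _]fineK ?fin_num_measure// lee_fin -/q.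
    rewrite -[leLHS]lnK ?posrE// ler_expR subrr mulr0 subr0 => hq.
    have -> : mu * expR eta / c = mu / c + mu * (expR eta - 1) / c by ring.
    by rewrite /de lerD2l.
  pose z := Num.min 1 (de * c / (2 * mu)).
  have z0 : 0 < z by rewrite lt_min ltr01 divr_gt0 ?mulr_gt0.
  have := h (ln z) (ln_le0 _); rewrite ge_min lexx => /(_ isT).
  rewrite lnK ?posrE// leNgt => /negP; apply.
  rewrite -ltr_pdivlMr ?invr_gt0// invrK.
  apply: (@le_lt_trans _ _ (mu * (de * c / (2 * mu)))).
    by rewrite ler_pM2l// ge_min lexx orbT.
  have -> : mu * (de * c / (2 * mu)) = de * c / 2 by field; rewrite gt_eqF.
  have : 0 < de * c by rewrite mulr_gt0.
  lra.
- exact: bernstein.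
Qed.

End Tails.

(** * Largest entries and the constants of the theorem *)

Section TopEntries.
Variable m : nat.
Implicit Types (v : 'I_m -> int) (k : nat).

(** The head of [s] dominates the head of [t]; missing entries are covered by nonnegativity. *)
Let sorted_sum_le (s t : seq int) k : sorted >=%O s -> all (>= 0) s ->
  subseq t s -> (size t <= k)%N ->
  \sum_(x <- t) x <= \sum_(0 <= i < k) nth 0 s i.
Proof.
elim: s t k => [|x s IH] t k.
  by move=> _ _ /eqP -> _; rewrite big_nil sumr_ge0// => i _; rewrite nth_nil.
move=> xs /andP[x0 s0] ts tk.
have ss : sorted >=%O s := path_sorted xs.
case: k tk => [|k]; first by case: t ts => //= _ _; rewrite big_nil big_nat sumr_ge0.
case: t ts => [|y t] ts tk.
  rewrite big_nil; apply: sumr_ge0 => i _; case: (ltnP i (size (x :: s))) => h.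
    by apply: (allP _ _ (mem_nth _ h)); rewrite /= x0.
  by rewrite nth_default.
rewrite big_cons big_nat_recl//=; apply: lerD.
  have /predU1P[->//|ys] : y \in x :: s by apply: (mem_subseq ts); exact: mem_head.
  by have /allP := order_path_min ge_trans xs; apply.
apply: IH => //; move: ts => /=; case: eqP => [_ //|_].
by apply: subseq_trans; exact: subseq_cons.
Qed.

Lemma top_sum_ge v k (J : {set 'I_m}) : (forall a, 0 <= v a) -> (#|J| <= k)%N ->
  \sum_(a in J) v a <= top_sum k v.
Proof.
move=> v0 Jk; rewrite -big_enum -(big_map v xpredT id) /=.
rewrite -(perm_big _ (permEl (perm_sort >=%O _))) /=.
apply: sorted_sum_le.
- by apply: sort_sorted => x y; exact: le_total.
- by apply/allP => x; rewrite mem_sort => /codomP[a ->].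
- apply: subseq_sort; [by move=> x y; exact: le_total|exact: ge_trans|].
  by rewrite /codom /image_mem; apply: map_subseq; rewrite !enumT; exact: filter_subseq.
- by rewrite size_sort size_map -cardE.
Qed.

Lemma top_sum0 v k : (forall a, v a = 0) -> top_sum k v = 0.
Proof.
move=> v0; rewrite /top_sum big1// => i _.
case: (ltnP i (size (sort >=%O (codom v)))) => h; last by rewrite nth_default.
by have := mem_nth 0 h; rewrite mem_sort => /codomP[a ->].
Qed.

End TopEntries.

Lemma vmax_ge (R : realDomainType) m (v : 'I_m -> R) a : v a <= vmax v.
Proof. exact: le_bigmax. Qed.

Lemma vmax_attained (R : realDomainType) m (v : 'I_m -> R) : 'I_m -> exists a, vmax v = v a.
Proof.
move=> a0; rewrite /vmax; elim/big_ind: _ => [|x y [a ->] [b ->]|a _].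
- case E : (codom v) => [|x s] /=.
    by have := codom_f v a0; rewrite E.
  have /codomP[a ->] : x \in codom v by rewrite E mem_head.
  by exists a.
- by case: (leP (v a) (v b)) => _; [exists b|exists a].
- by exists a.
Qed.

(** Expansion of a product of factors equal to 1; the factor [0 + 1] at a point outside [J] removes
    the sets not contained in [J]. *)
Lemma pb_mean_cst1 (R : realType) (V : finType) (J : {set V}) (r : V -> R) :
  pb_mean (fun=> 1) J r = 1.
Proof.
have : \prod_v ((if v \in J then r v else 0) + (if v \in J then 1 - r v else 1)) = 1.
  by rewrite big1// => v _; case: (v \in J); ring.
rewrite bigA_distr => {2}<-.
rewrite /pb_mean big_mkcond; apply: eq_big => // s _.
have [sJ|sJ] := boolP (s \subset J)%SET; last first.
  have [v vs vJ] := fintype.subsetPn sJ.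
  by rewrite (bigD1 v)//= vs (negbTE vJ) mul0r.
rewrite mul1r [RHS](bigID (fun v => v \in s)) /=; congr (_ * _).
  by apply: eq_bigr => v vs; rewrite vs (fintype.subsetP sJ _ vs).
rewrite big_mkcond [RHS]big_mkcond; apply: eq_bigr => v _; rewrite finset.inE.
by case: (v \in s); case: (v \in J).
Qed.

Lemma q_neE (R : realType) (V : finType) (J : {set V}) (r : V -> R) (k : int) :
  q_ne J r k = pb_mean (fun n => (n%:Z != k)%:R) J r.
Proof.
rewrite /q_ne q_eqE -[X in X - _](pb_mean_cst1 J r) /pb_mean -sumrB; apply: eq_bigr => s _.
by rewrite -mulrBl; case: eqP => _; rewrite ?subrr ?subr0.
Qed.

Section Model.
Context (R : realType) (p m : nat) (L : R) (L0 : 0 < L).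
Context d (T : measurableType d) (P : probability T R).
Variable U : 'I_m -> {RV P >-> 'pt[R]_p}.
Hypotheses (hU : forall a t, cube L (U a t)) (hindep : mutually_independent U).
Local Notation pattern := {ffun 'I_m * 'I_m -> bool}.

Lemma neighborsE t a : neighbors L U a t = pat_deg (pattern_of L U t) a.
Proof.
rewrite /neighbors /pat_deg -sum1_card big_mkcond [RHS]big_mkcond; apply: eq_bigr => b _.
rewrite finset.in_set ffunE /= tball_meet// eq_sym.
by case: eqP => //= _; case: (_ <= _).
Qed.

Lemma prob_pattern (b : pred pattern) :
  P [set t | b (pattern_of L U t)] = (pat_mean L U (fun rho => (b rho)%:R))%:E.
Proof.
have mA : measurable [set t | b (pattern_of L U t)].
  exact: (measurable_preimage_fin (measurable_pattern L0 hU) [set rho | b rho]).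
rewrite -(integral_pattern L0 hU (F := fun rho => (b rho)%:R))//.
rewrite -[X in P X = _]setIT -integral_indic//; apply: eq_integral => t _.
rewrite indicE; congr (_%:R)%:E; congr nat_of_bool.
by apply/idP/idP; rewrite inE.
Qed.

Lemma concentration_pattern (Y : pattern -> R) c : (forall rho, 0 <= Y rho) -> 0 < c ->
  0 < pat_mean L U Y ->
  (forall N th, mgf (fun om => Y (pat L om)) (cell_prob L U (N := N)) th <=
    expR (Ex (cell_prob L U (N := N)) (fun om => Y (pat L om)) * rate c th)) ->
  concentration P (fun t => Y (pattern_of L U t)) (pat_mean L U Y) c.
Proof.
move=> Y0 c0 mu0 h; apply: concentration_of_mgf => // [|th].
  exact: (measurable_fun_fin (measurable_pattern L0 hU) Y).
rewrite (integral_pattern L0 hU (F := fun rho => expR (th * Y rho))); last first.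
  by move=> rho; exact: expR_ge0.
by rewrite lee_fin; apply: mgf_limit => // N; exact: h.
Qed.

Variables (f : 'I_m -> 'pt[R]_p -> R) (w : 'I_m -> R) (a0 : 'I_m).
Hypotheses (hf : forall a, has_density (U a) (cube L) (f a))
  (f0 : forall a u, cube L u -> 0 < f a u) (w0 : forall a, 0 < w a).

Variable (b : 'I_m -> nat -> bool).

Definition weighted (deg : 'I_m -> nat) : R := \sum_a w a * (b a (deg a))%:R.

(** The condition [b a] on the degree of [a] covers both sums. The events having positive
    probability, [mu] is positive, as the tail estimates require. *)
Lemma weighted_concentration c : 0 < c ->
  (forall a, 0 < P [set t | b a (neighbors L U a t)])%E ->
  (forall N th, mgf (fun om => weighted (deg (@cell_adj R p L N) om)) (cell_prob L U (N := N)) th <=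
    expR (Ex (cell_prob L U (N := N)) (fun om => weighted (deg (@cell_adj R p L N) om)) * rate c th)) ->
  let Y t := weighted (fun a => neighbors L U a t) in
  exists mu : R,
   [/\ mu%:E = ('E_P[Y])%E,
       mu%:E = (\sum_(a < m) (w a)%:E * \int[leb R p]_(u in cube L)
         (pb_mean (fun k => (b a k)%:R) [set b | b != a]%SET (p_near L U u) * f a u)%:E)%E &
       concentration P Y mu c].
Proof.
move=> c0 Ppos h Y.
pose YP (rho : pattern) := weighted (pat_deg rho).
have YE : Y = (fun t => YP (pattern_of L U t)).
  by apply/funext => t; apply: eq_bigr => a _; rewrite neighborsE.
have YP0 rho : 0 <= YP rho by apply: sumr_ge0 => a _; rewrite mulr_ge0// ltW.
have meanE : pat_mean L U YP =
    \sum_a w a * pat_mean L U (fun rho => (b a (pat_deg rho a))%:R).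
  rewrite /pat_mean; under [RHS]eq_bigr do rewrite mulr_sumr.
  rewrite exchange_big; apply: eq_bigr => rho _; rewrite mulr_suml.
  by apply: eq_bigr => a _; rewrite mulrA.
have pos a : 0 < pat_mean L U (fun rho => (b a (pat_deg rho a))%:R).
  rewrite -lte_fin -(prob_pattern (fun rho => b a (pat_deg rho a))).
  by have := Ppos a; rewrite (_ : mkset _ = [set t | b a (pat_deg (pattern_of L U t) a)])//;
    apply/funext => t; rewrite /mkset neighborsE.
exists (pat_mean L U YP); rewrite YE; split.
- by rewrite unlock -(integral_pattern L0 hU).
- rewrite meanE -sumEFin; apply: eq_bigr => a _; rewrite EFinM; congr (_ * _)%E.
  apply: (pat_mean_deg L0 hU hindep (hf a) (f0 a) (g := fun k => (b a k)%:R)).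
  by move=> k; rewrite ler0n lern1 leq_b1.
- apply: concentration_pattern => // [|N th].
    rewrite meanE (bigD1 a0)//= ltr_wpDr ?mulr_gt0// sumr_ge0// => a _.
    by rewrite mulr_ge0// ltW.
  rewrite (_ : (fun om => YP (pat L om)) = (fun om => weighted (deg (@cell_adj R p L N) om))) ?h//.
  by apply/funext => om; apply: eq_bigr => a _; rewrite pat_degE.
Qed.

End Model.

Section Constants.
Variables (R : realType) (p m : nat) (w : 'I_m -> R) (d : 'I_m -> int) (a0 : 'I_m).
Hypotheses (p1 : (1 <= p)%N) (w0 : forall a, 0 < w a) (d0 : forall a, 0 <= d a).
Local Notation k := (kappa1 R p).
Let dn a := `|d a|%N.
Let sig := `|top_sum k d|%N.

Lemma absz_d a : (dn a)%:Z = d a. Proof. by rewrite gez0_abs. Qed.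

Lemma top_sum_ge0 : 0 <= top_sum k d.
Proof.
by have := @top_sum_ge m d k finset.set0 d0; rewrite finset.cards0 big_set0; apply.
Qed.

Lemma sum_le_top (J : {set 'I_m}) : (#|J| <= k)%N -> (\sum_(a in J) dn a <= sig)%N.
Proof.
move=> Jk; rewrite -lez_nat gez0_abs ?top_sum_ge0//.
rewrite (big_morph _ PoszD (erefl _)).
by under eq_bigr do rewrite absz_d; exact: top_sum_ge.
Qed.

Lemma w_itv a : 0 <= w a <= vmax w. Proof. by rewrite ltW//= vmax_ge. Qed.

Lemma vmax_gt0 : 0 < vmax w. Proof. by have [a ->] := vmax_attained w a0. Qed.

Lemma absz_vmax a : (dn a <= `|vmax d|)%N.
Proof.
rewrite -lez_nat absz_d gez0_abs ?vmax_ge//.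
by have [b ->] := vmax_attained d a0.
Qed.

Lemma single_le_top a : (dn a <= sig)%N.
Proof.
have := @sum_le_top [set a]%SET; rewrite finset.big_set1; apply.
by rewrite finset.cards1; apply: leq_trans (kappa1_ge2 R p1).
Qed.

Lemma vmax_le_top : (`|vmax d| <= sig)%N.
Proof. by have [b ->] := vmax_attained d a0; exact: single_le_top. Qed.

End Constants.

Theorem theorem3p3 (R : realType) (p m : nat) (n : R)
    (hp : (1 <= p)%N) (hm : (1 <= m)%N) (hn : 0 < n)
    (hvol : 2 * m%:R < Num.sqrt p%:R * n `^ (p%:R^-1))
    (hside : 6 < n `^ (p%:R^-1))
    (disp : measure_display) (T : measurableType disp) (P : probability T R)
    (U : 'I_m -> {RV P >-> 'pt[R]_p})
    (hU : forall a x, cube (n `^ (p%:R^-1)) (U a x))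
    (hindep : mutually_independent U)
    (f : 'I_m -> 'pt[R]_p -> R)
    (hf : forall a, has_density (U a) (cube (n `^ (p%:R^-1))) (f a))
    (hf0 : forall a u, cube (n `^ (p%:R^-1)) u -> 0 < f a u)
    (w : 'I_m -> R) (d : 'I_m -> int) (hw : forall a, 0 < w a) :
  let L := n `^ (p%:R^-1) in
  let M := neighbors L U in
  let sigma := fun e : 'I_m -> int => (top_sum (kappa1 R p) e)%:~R : R in
  let c_ge := vmax w * (vmax d)%:~R * (sigma d + 1) in
  let c_ne := vmax w * (sigma d + sigma (fun a => d a + 1) + 1) in
  ((forall a, (0 < P [set x | (d a <= (M a x)%:Z)%R] < 1)%E) ->
   exists mu : R,
     [/\ mu%:E = ('E_P[Y_ge L U w d])%E,
         mu%:E = (\sum_(a < m) (w a)%:E * \int[leb R p]_(u in cube L)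
           (q_ge [set b | b != a] (p_near L U u) (d a) * f a u)%:E)%E &
         concentration P (Y_ge L U w d) mu c_ge]) /\
  ((forall a, (0 < P [set x | (M a x)%:Z != d a] < 1)%E) ->
   exists mu : R,
     [/\ mu%:E = ('E_P[Y_ne L U w d])%E,
         mu%:E = (\sum_(a < m) (w a)%:E * \int[leb R p]_(u in cube L)
           (q_ne [set b | b != a] (p_near L U u) (d a) * f a u)%:E)%E &
         concentration P (Y_ne L U w d) mu c_ne]).
Proof.
move=> L M sigma c_ge c_ne; pose a0 : 'I_m := Ordinal hm.
have L0 : 0 < L by apply: lt_trans hside.
have k2 := kappa1_ge2 R hp; have wm0 := vmax_gt0 a0 hw.
have sigmaE e : (forall a, 0 <= e a) -> sigma e = (`|top_sum (kappa1 R p) e|%N)%:R.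
  by move=> e0; rewrite /sigma -[in LHS](gez0_abs (top_sum_ge0 R p e0)) -pmulrn.
have adj_sym N : symmetric (@cell_adj R p L N) by exact: cell_adj_sym.
have sf N om : starfree (gr (@cell_adj R p L N) om) (kappa1 R p) by exact: cell_adj_starfree.
split=> H.
(* A threshold at most 0 would make the indicator constant. *)
- have d1 a : 1 <= d a.
    rewrite leNgt; apply/negP => da; have := H a; rewrite (_ : mkset _ = setT).
      by rewrite probability_setT ltxx andbF.
    apply/seteqP; split => // x _ /=; lia.
  have d0 a : 0 <= d a by apply: le_trans (d1 a).
  have D1 : (0 < `|vmax d|)%N.
    by rewrite -ltz_nat gez0_abs; have [b ->] := vmax_attained d a0; [exact: d1|exact: d0].
  pose sig := `|top_sum (kappa1 R p) d|%N.
  have cE : c_ge = vmax w * (`|vmax d| * sig.+1)%:R.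
    rewrite /c_ge sigmaE// natrM -natr1 mulrA; congr (_ * _ * _).
    by rewrite -[in LHS](@gez0_abs (vmax d)) -?pmulrn//; have [b ->] := vmax_attained d a0.
  have c0 : 0 < c_ge by rewrite cE mulr_gt0// ltr0n muln_gt0 D1.
  have [||mu [E1 E2 C]] := weighted_concentration (c := c_ge) L0 hU hindep a0 hf hf0 hw
    (b := fun a k => d a <= k%:Z) c0.
  + by move=> a; have /andP[] := H a.
  + move=> N th; rewrite (_ : (fun om => _) = Yge (@cell_adj R p L N) (fun a => `|d a|%N) w).
      rewrite cE; apply: (mgf_Yge_le (cell_prob_prob L0 hU N) (adj_sym N) (sf _ N) k2
        (sum_le_top d0) (w_itv hw) wm0) => // [v|]; last exact: vmax_le_top.
      by rewrite absz_vmax// andbT; have := d1 v; lia.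
    apply/funext => om; apply: eq_bigr => a _.
    by rewrite -[in LHS](absz_d d0).
  exists mu; split => //; rewrite E2; apply: eq_bigr => a _; congr (_ * _)%E.
  by apply: eq_integral => u _; rewrite q_geE.
(* A negative number is never a degree, so the indicator would be constant. *)
- have d0 a : 0 <= d a.
    rewrite leNgt; apply/negP => da; have := H a; rewrite (_ : mkset _ = setT).
      by rewrite probability_setT ltxx andbF.
    apply/seteqP; split => // x _ /=; apply/negP => /eqP e.
    by rewrite -e in da.
  have e0 a : 0 <= d a + 1 by rewrite addr_ge0.
  have eE a : absz (d a + 1) = (absz (d a)).+1 by have := d0 a; lia.
  pose sig := `|top_sum (kappa1 R p) d|%N.
  pose sig1 := absz (top_sum (kappa1 R p) (fun a => d a + 1)).
  have sig1P (J : {set 'I_m}) : (#|J| <= kappa1 R p)%N -> (\sum_(x in J) `|d x|.+1 <= sig1)%N.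
    by move=> /(sum_le_top e0); under eq_bigr do rewrite eE.
  have sig10 : (0 < sig1)%N.
    by have := single_le_top R hp e0 a0; rewrite eE; apply: leq_trans.
  have cE : c_ne = vmax w * (sig + sig1).+1%:R.
    by rewrite /c_ne !sigmaE// -natr1 natrD.
  have c0 : 0 < c_ne by rewrite cE mulr_gt0.
  have [||mu [E1 E2 C]] := weighted_concentration (c := c_ne) L0 hU hindep a0 hf hf0 hw
    (b := fun a k => k%:Z != d a) c0.
  + by move=> a; have /andP[] := H a.
  + move=> N th; have [/existsP[v dv]|/existsPn dz] := boolP [exists v, (0 < `|d v|)%N].
      rewrite (_ : (fun om => _) = Yne (@cell_adj R p L N) (fun a => `|d a|%N) w).
        rewrite cE -[(sig + sig1)%N]prednK ?addn_gt0 ?sig10 ?orbT//.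
        apply: (mgf_Yne_le (cell_prob_prob L0 hU N) (adj_sym N) (sf _ N) k2
          (sum_le_top d0) (w_itv hw) wm0) => //.
        by exists v.
      apply/funext => om; apply: eq_bigr => a _.
      by rewrite -[in LHS](absz_d d0).
    (* If all [d a] vanish, [Y_ne] is the sum of the other kind with thresholds 1, and the constants
       agree since [sigma_d = 0]. *)
    have dE a : d a = 0 by have := dz a; lia.
    rewrite (_ : (fun om => _) = Yge (@cell_adj R p L N) (fun=> 1%N) w).
      have -> : c_ne = vmax w * (1 * sig1.+1)%:R by rewrite cE /sig top_sum0// add0n mul1n.
      apply: (mgf_Yge_le (cell_prob_prob L0 hU N) (adj_sym N) (sf _ N) k2
        _ (w_itv hw) wm0) => // J /sig1P.
      by apply: leq_trans; apply: leq_sum => a _; lia.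
    apply/funext => om; apply: eq_bigr => a _; rewrite dE.
    by rewrite lt0n.
  exists mu; split => //; rewrite E2; apply: eq_bigr => a _; congr (_ * _)%E.
  by apply: eq_integral => u _; rewrite q_neE.
Qed.
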